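(* Let $n\ge1$ and let $(M,\nabla,P)$ be an infinitesimally homogeneous affine manifold with structure group $G=\operatorname{U}(n)\times\{1\}$, with torsion parameters $\tau_1,\tau_2,\tau_3$ and inner torsion parameters $a,b,\alpha,\beta,\gamma,\delta$. Then $$d\eta(X,Y)=(\tau_3-2\delta)\,\omega(X,Y),\qquad X,Y\in H.$$ In particular, $H$ is a contact distribution, that is, $\eta\wedge(d\eta)^n\neq0$, if and only if $\tau_3\neq2\delta$. In that case $\alpha=a+\tau_1$; equivalently, the symmetrized connection $\nabla^s=\nabla-\frac12T$ belongs to the branch $a^s=\alpha^s$ of the torsion-free classification, for which the Kähler parameter $\kappa^s$ is unrestricted by the classification.
   Context: Let $V$ be a finite-dimensional real vector space and $G\subseteq\operatorname{GL}(V)$ a Lie subgroup with Lie algebra $\mathfrak g\subseteq\mathfrak{gl}(V)$. A $G$-structure on a smooth manifold $M$ with $\dim M=\dim V$ is a principal $G$-subbundle $P$ of the frame bundle $\operatorname{FR}(TM)$; elements $p\in P_x$ are linear isomorphisms $p:V\to T_xM$, and two frames in $P_x$ differ by right composition with an element of $G$. An affine manifold with $G$-structure is a triple $(M,\nabla,P)$ with $\nabla$ an affine connection on $M$ and $P$ a $G$-structure. Put $T(X,Y)=\nabla_XY-\nabla_YX-[X,Y]$ and $R(X,Y)=\nabla_X\nabla_Y-\nabla_Y\nabla_X-\nabla_{[X,Y]}$. Inner torsion: for a local section $s:U\to P$ define $\Lambda^s_x(u)\in\mathfrak{gl}(V)$ by $\nabla_{s(x)u}(s\,w)=s(x)(\Lambda^s_x(u)w)$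 for $u,w\in V$, where $s\,w$ is the vector field $x\mapsto s(x)w$. With $\mathfrak g_x=\operatorname{Ad}_p(\mathfrak g)$ for any $p\in P_x$ and $\overline{\operatorname{Ad}}_p:\mathfrak{gl}(V)/\mathfrak g\to\mathfrak{gl}(T_xM)/\mathfrak g_x$ induced by conjugation by $p$, the inner torsion is $\mathfrak I^P_x:T_xM\to\mathfrak{gl}(T_xM)/\mathfrak g_x$, $\mathfrak I^P_x(s(x)u)=\overline{\operatorname{Ad}}_{s(x)}(\Lambda^s_x(u)+\mathfrak g)$ (independent of $s$). $(M,\nabla,P)$ is infinitesimally homogeneous if there are linear maps $T_0:\Lambda^2V\to V$, $R_0:\Lambda^2V\to\mathfrak{gl}(V)$, $\mathfrak I_0:V\to\mathfrak{gl}(V)/\mathfrak g$ (the characteristic tensors) with $T_x(pu,pv)=p\,T_0(u,v)$, $R_x(pu,pv)pw=p\,R_0(u,v)w$, $\mathfrak I^P_x(pu)=\overline{\operatorname{Ad}}_p(\mathfrak I_0(u))$ for all $x\in M$, $p\in P_x$, $u,v,w\in V$. Here $V=H_0\oplus\mathbb Re$, where $H_0\simeq\mathbb R^{2n}$ has its standard Euclidean metric $h_0$, standard complex structure $J_0$ and $\omega_0(X,Y)=h_0(J_0X,Y)$. $G=\operatorname{U}(n)\times\{1\}\subset\operatorname{GL}(V)$ acts on $H_0$ by the standard real representation of $\operatorname{U}(n)$ and fixes $e$; $\mathfrak g=\mathfrak u(n)\oplus\{0\}$. Write $Z^\flat=h_0(Z,\cdot)$; matrices are with respect to $V=H_0\oplus\mathbb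 Re$. Torsion parameters: the unique $\tau_1,\tau_2,\tau_3\in\mathbb R$ with $T_0(X,Y)=\tau_3\omega_0(X,Y)e$, $T_0(X,e)=\tau_1X+\tau_2J_0X$ for $X,Y\in H_0$. Inner torsion parameters: the unique $a,b,\alpha,\beta,\gamma,\delta\in\mathbb R$ with $\mathfrak I_0(X+se)=\lambda(X+se)+\mathfrak g$, where $$\lambda(X+se)=\begin{pmatrix}as\,\operatorname{Id}_{H_0}&\alpha X+\beta J_0X\\(\gamma X+\delta J_0X)^\flat&bs\end{pmatrix}.$$ $(M,\nabla^s,P)$ is also infinitesimally homogeneous; a superscript $s$ denotes its inner torsion parameters. In the branch $a^s=\alpha^s$ of the torsion-free classification the horizontal block $B^s$ of the curvature characteristic tensor of $\nabla^s$ is $$B^s(X,Y)Z=h_0(Q^s(Y),Z)P^s(X)-h_0(Q^s(X),Z)P^s(Y)-2a^s\delta^s\omega_0(X,Y)Z-2\beta^s\delta^s\omega_0(X,Y)J_0Z+\kappa^sK_{X,Y}Z,$$ with $P^s(X)=a^sX+\beta^sJ_0X$, $Q^s(X)=\gamma^sX+\delta^sJ_0X$, $K_{X,Y}Z=\frac14(h_0(Y,Z)X-h_0(X,Z)Y+\omega_0(Y,Z)J_0X-\omega_0(X,Z)J_0Y-2\omega_0(X,Y)J_0Z)$; $\kappa^s$ is the Kähler parameter, and ''unrestricted'' means that every real value of $\kappa^s$ occurs together with any $(a^s,b^s,\beta^s,\gamma^s,\delta^s)$. Geometric data of the $G$-structure: $H\subset TM$ is the rank-$2n$ distribution $H_x=p(H_0)$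 and $\xi_x=p(e)$, $p\in P_x$; $h,J$ on $H$ correspond to $h_0,J_0$ through frames in $P$; $\eta$ is the $1$-form with $\eta(\xi)=1$, $\eta|_H=0$; $\omega$ is the $2$-form with $\omega(X,Y)=h(JX,Y)$ on $H$ and $\iota_\xi\omega=0$. The exterior derivative is normalized by $d\eta(X,Y)=X\eta(Y)-Y\eta(X)-\eta([X,Y])$. *)

(* Defs.v *)
From HB Require Import structures.
From mathcomp Require Import all_boot all_order all_algebra all_fingroup.
From mathcomp Require Import all_classical all_reals all_analysis.

Set Implicit Arguments.
Unset Strict Implicit.
Unset Printing Implicit Defensive.

Import Order.TTheory GRing.Theory Num.Theory numFieldNormedType.Exports.

Local Open Scope ring_scope.
Local Open Scope classical_set_scope.

Section SmoothMaps.
Context {R : realType} {E F : normedModType R}.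

(* Used only for open [U] in a finite-dimensional [E], where this is the usual
   C^k: [f] is C^(k+1) iff it is differentiable and x |-> 'd f x is C^k, the
   latter being tested on every vector [v]. *)
Fixpoint Ck (k : nat) (U : set E) (f : E -> F) : Prop :=
  match k with
  | 0 => forall x, U x -> {for x, continuous f}
  | k'.+1 => (forall x, U x -> differentiable f x) /\
             (forall v : E, Ck k' U (fun x => 'D_v f x))
  end.

Definition smooth (U : set E) (f : E -> F) : Prop := forall k, Ck k U f.

End SmoothMaps.

(* [chart_map] and [chart_inv] are total functions that are meaningful on
   [chart_dom] and on its image only. *)
Record chart (R : realType) (N : nat) (T : topologicalType) := Chart {
  chart_dom : set T ;
  chart_map : T -> 'cV[R]_N ;
  chart_inv : 'cV[R]_N -> T ;
  chart_dom_open : open chart_dom ;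
  chart_img_open : open (chart_map @` chart_dom) ;
  chart_mapK : forall x, chart_dom x -> chart_inv (chart_map x) = x ;
  chart_map_continuous : forall x, chart_dom x -> {for x, continuous chart_map} ;
  chart_inv_continuous : forall y, (chart_map @` chart_dom) y ->
    {for y, continuous chart_inv} }.

(* A nonempty smooth manifold of dimension [N]: an atlas, not necessarily
   maximal, with a preferred chart at each point.  The tangent space at [x] is
   'cV[R]_N, a tangent vector being identified with its coordinates in the
   preferred chart at [x]. *)
Record manifold (R : realType) (N : nat) := Manifold {
  carrier :> topologicalType ;
  atlas : set (chart R N carrier) ;
  chart_at : carrier -> chart R N carrier ;
  chart_at_atlas : forall x, atlas (chart_at x) ;
  mem_chart_at : forall x, chart_dom (chart_at x) x ;
  atlas_compatible : forall c d, atlas c -> atlas d ->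
    smooth (chart_map c @` (chart_dom c `&` chart_dom d))
           (chart_map d \o chart_inv c) ;
  manifold_hausdorff : hausdorff_space carrier ;
  manifold_second_countable : @second_countable carrier ;
  manifold_nonempty : [set: carrier] !=set0 }.

Section Calculus.
Context {R : realType} {N : nat} (M : manifold R N).

Definition vfield := M -> 'cV[R]_N.

(* The value at [v] of the differential of the transition map from [c] to [d],
   taken at the point of coordinates [chart_map c x]. *)
Definition coord_change (c d : chart R N M) (x : M) (v : 'cV[R]_N) : 'cV[R]_N :=
  'D_v (chart_map d \o chart_inv c) (chart_map c x).

Definition field_in_chart (c : chart R N M) (X : vfield) (y : 'cV[R]_N) :
    'cV[R]_N :=
  let x := chart_inv c y in coord_change (chart_at x) c x (X x).

Definition smooth_field (U : set M) (X : vfield) : Prop :=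
  forall c, atlas c ->
    smooth (chart_map c @` (chart_dom c `&` U)) (field_in_chart c X).

Definition smooth_function (U : set M) (f : M -> R) : Prop :=
  forall c, atlas c ->
    smooth (chart_map c @` (chart_dom c `&` U)) (f \o chart_inv c).

Definition dir_deriv (x : M) (v : 'cV[R]_N) (f : M -> R) : R :=
  'D_v (f \o chart_inv (chart_at x)) (chart_map (chart_at x) x).

(* [X,Y] at [x], by the coordinate formula DY(X) - DX(Y) in the chart at [x]. *)
Definition lie_bracket (X Y : vfield) : vfield := fun x =>
  let c := chart_at x in
  'D_(X x) (field_in_chart c Y) (chart_map c x)
  - 'D_(Y x) (field_in_chart c X) (chart_map c x).

(* The extension of the tangent vector [v] at [x] to a field, smooth near [x],
   that has constant coordinates in the chart at [x].  Values at a point of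
   tensors given on vector fields are computed with these extensions; by
   tensoriality any other local extension gives the same result. *)
Definition extend (x : M) (v : 'cV[R]_N) : vfield :=
  fun y => coord_change (chart_at x) (chart_at y) y v.

(* [nabla x v Y] is the covariant derivative of the field [Y] along the tangent
   vector [v] at [x]; only fields that are smooth near [x] are meaningful.  A
   connection acts on local fields, hence the locality axiom;
   C^oo-linearity in the first argument is linearity in [v]. *)
Definition cov_deriv := forall x : M, 'cV[R]_N -> vfield -> 'cV[R]_N.

Record affine_connection (nabla : cov_deriv) : Prop := {
  conn_linear : forall (x : M) (U : set M) (Y : vfield),
    open U -> U x -> smooth_field U Y ->
    forall (a : R) (v w : 'cV[R]_N),
      nabla x (a *: v + w) Y = a *: nabla x v Y + nabla x w Y ;
  conn_additive : forall (x : M) (U : set M) (Y Z : vfield) (v : 'cV[R]_N),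
    open U -> U x -> smooth_field U Y -> smooth_field U Z ->
    nabla x v (fun y => Y y + Z y) = nabla x v Y + nabla x v Z ;
  conn_Leibniz : forall (x : M) (U : set M) (f : M -> R) (Y : vfield)
      (v : 'cV[R]_N),
    open U -> U x -> smooth_function U f -> smooth_field U Y ->
    nabla x v (fun y => f y *: Y y) = dir_deriv x v f *: Y x + f x *: nabla x v Y ;
  conn_local : forall (x : M) (U : set M) (Y Z : vfield) (v : 'cV[R]_N),
    open U -> U x -> smooth_field U Y -> (forall y, U y -> Y y = Z y) ->
    nabla x v Y = nabla x v Z ;
  conn_smooth : forall (U : set M) (X Y : vfield),
    open U -> smooth_field U X -> smooth_field U Y ->
    smooth_field U (fun x => nabla x (X x) Y) }.

Definition torsion (nabla : cov_deriv) (X Y : vfield) : vfield := fun x =>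
  nabla x (X x) Y - nabla x (Y x) X - lie_bracket X Y x.

Definition curvature (nabla : cov_deriv) (X Y Z : vfield) : vfield := fun x =>
  nabla x (X x) (fun y => nabla y (Y y) Z)
  - nabla x (Y x) (fun y => nabla y (X y) Z)
  - nabla x (lie_bracket X Y x) Z.

Definition torsion_at (nabla : cov_deriv) (x : M) (u v : 'cV[R]_N) : 'cV[R]_N :=
  torsion nabla (extend x u) (extend x v) x.

Definition curvature_at (nabla : cov_deriv) (x : M) (u v w : 'cV[R]_N) :
    'cV[R]_N :=
  curvature nabla (extend x u) (extend x v) (extend x w) x.

Definition symmetrized (nabla : cov_deriv) : cov_deriv := fun x v Y =>
  nabla x v Y - 2^-1 *: torsion_at nabla x v (Y x).

Definition ext_deriv (eta : M -> 'cV[R]_N -> R) (X Y : vfield) (x : M) : R :=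
  dir_deriv x (X x) (fun y => eta y (Y y))
  - dir_deriv x (Y x) (fun y => eta y (X y))
  - eta x (lie_bracket X Y x).

Definition ext_deriv_at (eta : M -> 'cV[R]_N -> R) (x : M) (u v : 'cV[R]_N) : R :=
  ext_deriv eta (extend x u) (extend x v) x.

End Calculus.

Section ExteriorAlgebra.
Context {R : realType} {N : nat}.

Definition kform (k : nat) := ('I_k -> 'cV[R]_N) -> R.

Definition wedge (k l : nat) (f : kform k) (g : kform l) : kform (k + l) :=
  fun v => ((k`! * l`!)%N%:R)^-1 *
    \sum_(s : 'S_(k + l)) (-1) ^+ s *
      f (fun i => v (s (lshift l i))) * g (fun j => v (s (rshift k j))).

Fixpoint wedge_power (f : kform 2) (m : nat) : kform (m * 2) :=
  match m return kform (m * 2) with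
  | 0 => fun _ => 1
  | m'.+1 => wedge f (@wedge_power f m')
  end.

Definition kform1 (f : 'cV[R]_N -> R) : kform 1 := fun v => f (v ord0).

Definition kform2 (f : 'cV[R]_N -> 'cV[R]_N -> R) : kform 2 :=
  fun v => f (v ord0) (v ord_max).

End ExteriorAlgebra.

Arguments wedge_power {R N} f m v.

Section GStructures.
Context {R : realType} {N : nat} (M : manifold R N).

(* The model space is V = 'cV[R]_N, so that a frame at [x] is an invertible
   matrix and gl(V) is 'M[R]_N. *)
Definition smooth_frame (U : set M) (s : M -> 'M[R]_N) : Prop :=
  forall w : 'cV[R]_N, smooth_field U (fun x => s x *m w).

Definition local_section (P : M -> set 'M[R]_N) (U : set M) (s : M -> 'M[R]_N) :
    Prop :=
  [/\ open U, (forall x, U x -> P x (s x)) & smooth_frame U s].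

Record G_structure (G : set 'M[R]_N) (P : M -> set 'M[R]_N) : Prop := {
  Gstr_frame : forall (x : M) (p : 'M[R]_N), P x p -> p \in unitmx ;
  Gstr_orbit : forall (x : M) (p q : 'M[R]_N), P x p ->
    (P x q <-> exists2 g, G g & q = p *m g) ;
  Gstr_section : forall x : M, exists U s, U x /\ local_section P U s }.

(* Elements of gl/g are represented by cosets, as sets of matrices. *)
Definition coset_mod (g : set 'M[R]_N) (A : 'M[R]_N) : set 'M[R]_N :=
  [set B | g (B - A)].

Definition Ad (p A : 'M[R]_N) : 'M[R]_N := p *m A *m invmx p.

Definition is_Lambda (nabla : cov_deriv M) (s : M -> 'M[R]_N) (x : M)
    (u : 'cV[R]_N) (A : 'M[R]_N) : Prop :=
  forall w : 'cV[R]_N,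
    nabla x (s x *m u) (fun y => s y *m w) = s x *m (A *m w).

(* The coset Ad_{s(x)} (Lambda^s_x(u) + g), where v = s(x) u, does not depend on
   the local section [s]; the definition takes the union over all of them. *)
Definition inner_torsion (g : set 'M[R]_N) (nabla : cov_deriv M)
    (P : M -> set 'M[R]_N) (x : M) (v : 'cV[R]_N) : set 'M[R]_N :=
  [set B | exists U s u A, [/\ U x, local_section P U s, v = s x *m u,
      is_Lambda nabla s x u A & (Ad (s x) @` coset_mod g A) B]].

Definition alternating_bilinear (W : lmodType R)
    (f : 'cV[R]_N -> 'cV[R]_N -> W) : Prop :=
  [/\ forall (a : R) u v w, f (a *: u + v) w = a *: f u w + f v w,
      forall (a : R) u v w, f w (a *: u + v) = a *: f w u + f w v &
      forall u, f u u = 0].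

Definition linear_to_quotient (g : set 'M[R]_N) (I0 : 'cV[R]_N -> set 'M[R]_N) :
    Prop :=
  (forall u, exists A, I0 u = coset_mod g A) /\
  (forall (a : R) u v A B, I0 u A -> I0 v B -> I0 (a *: u + v) (a *: A + B)).

(* (M, nabla, P) is infinitesimally homogeneous with the given characteristic
   tensors. *)
Record inf_homogeneous (g : set 'M[R]_N) (nabla : cov_deriv M)
    (P : M -> set 'M[R]_N) (T0 : 'cV[R]_N -> 'cV[R]_N -> 'cV[R]_N)
    (R0 : 'cV[R]_N -> 'cV[R]_N -> 'M[R]_N) (I0 : 'cV[R]_N -> set 'M[R]_N) :
    Prop := {
  char_torsion_bilinear : alternating_bilinear T0 ;
  char_curvature_bilinear : alternating_bilinear R0 ;
  char_inner_linear : linear_to_quotient g I0 ;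
  char_torsionE : forall (x : M) (p : 'M[R]_N), P x p ->
    forall u v : 'cV[R]_N,
    torsion_at nabla x (p *m u) (p *m v) = p *m T0 u v ;
  char_curvatureE : forall (x : M) (p : 'M[R]_N), P x p ->
    forall u v w : 'cV[R]_N,
    curvature_at nabla x (p *m u) (p *m v) (p *m w) = p *m (R0 u v *m w) ;
  char_innerE : forall (x : M) (p : 'M[R]_N), P x p ->
    forall u : 'cV[R]_N,
    inner_torsion g nabla P x (p *m u) = Ad p @` I0 u }.

End GStructures.

Section Model.
Context {R : realType} {n : nat}.

(* H_0 = R^(2n) with J_0 (x, y) = (- y, x), and V = H_0 + R e. *)
Local Notation H0 := 'cV[R]_(n + n).
Local Notation V0 := 'cV[R]_(n + n + 1).

Definition h0 (X Y : H0) : R := (X^T *m Y) 0 0.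

Definition J0mx : 'M[R]_(n + n) := block_mx 0 (- 1%:M) 1%:M 0.

Definition J0 (X : H0) : H0 := J0mx *m X.

Definition omega0 (X Y : H0) : R := h0 (J0 X) Y.

Definition hor (X : H0) : V0 := col_mx X 0.

Definition e0 : V0 := col_mx 0 1%:M.

Definition unitary_group : set 'M[R]_(n + n + 1) :=
  [set A | exists B : 'M[R]_(n + n),
     [/\ B^T *m B = 1%:M, B *m J0mx = J0mx *m B & A = block_mx B 0 0 1%:M]].

Definition unitary_algebra : set 'M[R]_(n + n + 1) :=
  [set A | exists B : 'M[R]_(n + n),
     [/\ B^T = - B, B *m J0mx = J0mx *m B & A = block_mx B 0 0 0]].

Definition torsion_parameters (T0 : V0 -> V0 -> V0) (t1 t2 t3 : R) : Prop :=
  (forall X Y : H0, T0 (hor X) (hor Y) = (t3 * omega0 X Y) *: e0) /\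
  (forall X : H0, T0 (hor X) e0 = hor (t1 *: X + t2 *: J0 X)).

Definition inner_matrix (a b al be ga de : R) (X : H0) (s : R) :
    'M[R]_(n + n + 1) :=
  block_mx (a * s)%:M (al *: X + be *: J0 X)
           (ga *: X + de *: J0 X)^T (b * s)%:M.

Definition inner_torsion_parameters (I0 : V0 -> set 'M[R]_(n + n + 1))
    (a b al be ga de : R) : Prop :=
  forall (X : H0) (s : R), I0 (hor X + s *: e0) =
    coset_mod unitary_algebra (inner_matrix a b al be ga de X s).

Definition Kcurv (X Y Z : H0) : H0 :=
  4^-1 *: (h0 Y Z *: X - h0 X Z *: Y + omega0 Y Z *: J0 X - omega0 X Z *: J0 Y
           - (2 * omega0 X Y) *: J0 Z).

Definition branch_block (a be ga de kappa : R) (X Y Z : H0) : H0 :=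
  let P X := a *: X + be *: J0 X in
  let Q X := ga *: X + de *: J0 X in
  h0 (Q Y) Z *: P X - h0 (Q X) Z *: P Y
  - (2 * a * de * omega0 X Y) *: Z - (2 * be * de * omega0 X Y) *: J0 Z
  + kappa *: Kcurv X Y Z.

(* [kappa] is the Kaehler parameter of a torsion-free structure in the branch
   a = alpha with curvature characteristic tensor [R0]. *)
Definition Kaehler_parameter (R0 : V0 -> V0 -> 'M[R]_(n + n + 1))
    (a be ga de kappa : R) : Prop :=
  forall X Y Z : H0,
    ulsubmx (R0 (hor X) (hor Y)) *m Z = branch_block a be ga de kappa X Y Z.

Section Geometry.
Context (M : manifold R (n + n + 1)).

Definition horizontal (P : M -> set 'M[R]_(n + n + 1)) (x : M) : set V0 :=
  [set v | exists p X, P x p /\ v = p *m hor X].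

(* [h] and [J] are meaningful on horizontal vectors only. *)
Record geometric_data (P : M -> set 'M[R]_(n + n + 1)) (xi : vfield M)
    (h : M -> V0 -> V0 -> R) (J : M -> V0 -> V0)
    (eta : M -> V0 -> R) (omega : M -> V0 -> V0 -> R) : Prop := {
  geo_xi : forall x p, P x p -> xi x = p *m e0 ;
  geo_h : forall x p, P x p ->
    forall X Y : H0, h x (p *m hor X) (p *m hor Y) = h0 X Y ;
  geo_J : forall x p, P x p ->
    forall X : H0, J x (p *m hor X) = p *m hor (J0 X) ;
  geo_eta_linear : forall x (a : R) u v,
    eta x (a *: u + v) = a * eta x u + eta x v ;
  geo_eta_xi : forall x, eta x (xi x) = 1 ;
  geo_eta_hor : forall x v, horizontal P x v -> eta x v = 0 ;
  geo_omega_bilinear : forall x,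
    alternating_bilinear (W := R^o) (omega x) ;
  geo_omega_hor : forall x u v, horizontal P x u -> horizontal P x v ->
    omega x u v = h x (J x u) v ;
  geo_omega_xi : forall x v, omega x (xi x) v = 0 }.

Definition contact (eta : M -> V0 -> R) : Prop :=
  forall x : M, exists v,
    wedge (kform1 (eta x)) (wedge_power (kform2 (ext_deriv_at eta x)) n) v != 0.

End Geometry.

End Model.

(* In the branch a = alpha, every real kappa occurs together with any
   (a, b, beta, gamma, delta). *)
Definition Kaehler_unrestricted (R : realType) (n : nat) : Prop :=
  forall a b be ga de kappa : R,
  exists (M : manifold R (n + n + 1)) (nabla : cov_deriv M)
    (P : M -> set 'M[R]_(n + n + 1))
    (R0 : 'cV[R]_(n + n + 1) -> 'cV[R]_(n + n + 1) -> 'M[R]_(n + n + 1))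
    (I0 : 'cV[R]_(n + n + 1) -> set 'M[R]_(n + n + 1)),
    [/\ affine_connection nabla, G_structure unitary_group P,
        inf_homogeneous unitary_algebra nabla P (fun _ _ => 0) R0 I0,
        inner_torsion_parameters I0 a b a be ga de &
        Kaehler_parameter R0 a be ga de kappa].

(* Main.v *)
Require Import Defs.
From HB Require Import structures.
From mathcomp Require Import all_boot all_order all_algebra all_fingroup.
From mathcomp Require Import all_classical all_reals all_analysis.
From mathcomp Require Import ring lra zify.
Set Implicit Arguments.
Unset Strict Implicit.
Unset Printing Implicit Defensive.
Import Order.TTheory GRing.Theory Num.Theory numFieldNormedType.Exports.
Local Open Scope ring_scope.
Local Open Scope classical_set_scope.

(** Everything is read off from the two structure equations of Cartan.  In a
    local section [s] of [P] over a chart, the coframe consists of the components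
    in [s] of the coordinate fields, and the connection matrices [L u] are those
    of [nabla] along these fields.  The equations [structure1] and [structure2]
    express torsion and curvature by the first derivatives of the coframe and of
    the connection matrices.  Infinitesimal homogeneity says that the torsion has
    the constant components [tor], and that [L u] is the inner torsion matrix
    [lam] of the coframe applied to [u], up to a matrix in u(n)
    ([inner_torsion_coset], [frame_inner]).

    Exterior derivative.  The form [eta] is the e-component of the coframe.
    Matrices in u(n) have no e-component, so the e-component of the first
    structure equation involves only [tor] and [lam]; skew-symmetrizing the
    e-component of [lam] leaves [2 * delta * omega], whence
    [d eta = (tau3 - 2 delta) omega] ([ext_deriv_frame]).  On the frame that
    consists of e and a symplectic basis of the horizontal space,
    [eta /\ (d eta)^n] is therefore [(tau3 - 2 delta)^n * n!]
    ([wedge_contact]), which decides the contact condition.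

    The branch.  Subtracting half of the torsion changes the connection matrices
    by the constant map [tor] applied to the coframe.  This shifts the inner
    torsion parameters ([lams_sym]): [a^s = a + tau1 / 2],
    [alpha^s = alpha - tau1 / 2], [delta^s = delta - tau3 / 2]; and the curvature
    of the symmetrized connection still has constant components [Rsym].  Modulo
    u(n), curvature is an algebraic expression in [lam] ([curvature_split]),
    because the derivatives of the u(n)-part stay in u(n).  The e-component of
    the first Bianchi identity is hence a condition on the parameters alone:
    evaluated on [X], [J X], [e] it reads [delta^s * (a^s - alpha^s) = 0]
    ([torsion_free_branch]).  As [tau3 - 2 delta = - 2 delta^s], a contact
    distribution forces [a^s = alpha^s], that is [alpha = a + tau1].

    The Kaehler parameter.  In this branch, the horizontal curvature minus its
    part determined by [lam] has all the symmetries of the curvature of a Kaehler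
    metric and is invariant under U(n).  Since U(n) is transitive on the unit
    sphere, its holomorphic sectional curvature is constant, and this determines
    the tensor up to the factor [kappa] ([kaehler_tensor_invariant],
    [torsion_free_kaehler]).

    That every [kappa] occurs is shown by explicit models, with [L] equal to
    [lam] of the coframe plus a connection with values in u(n).  The horizontal
    part is the metric of constant holomorphic sectional curvature [kappa] on a
    ball in C^n, with its Levi-Civita connection; the vertical part of the coframe
    is [dt] plus a multiple of a primitive of the Kaehler form, chosen so that
    [d eta = - 2 delta omega]; and the term [beta * eta * J] in the connection
    compensates for the part of [lam] that involves [beta]
    ([model_structure1], [model_structure2]). *)

(** * Smooth maps between normed spaces *)

Section NearEq.
Context {R : realType} {E F : normedModType R}.

Lemma near_eq_differentiable (f g : E -> F) (x : E) :
  (\near x, f x = g x) -> differentiable f x -> differentiable g x.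
Proof.
move=> fg df; have [dfc dfo] := (diff_locallyP _ _).1 df.
have go : g \o shift x = cst (g x) + 'd f x +o_ 0 id.
  apply/eqaddoP => e e0; move/eqaddoP: dfo => /(_ e e0); apply: filter_app.
  have {}fg : \forall h \near 0, f (h + x) = g (h + x).
    by move: fg; rewrite (near_shift 0 x) /= subr0.
  have fgx : f x = g x by have := nbhs_singleton fg; rewrite add0r.
  near=> h; rewrite !fctE /= -fgx (_ : g (h + x) = f (h + x)) //.
  by apply/esym; near: h.
by apply/diff_locallyP; rewrite (diff_unique dfc go).
Unshelve. all: by end_near. Qed.

Lemma open_eq_near (U : set E) (f g : E -> F) (x : E) :
  open U -> U x -> (forall y, U y -> f y = g y) -> \near x, f x = g x.
Proof.
by move=> oU Ux fg; apply: filterS (open_nbhs_nbhs (conj oU Ux)) => y /fg.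
Qed.

Lemma open_eq_derive (U : set E) (f g : E -> F) (x v : E) :
  open U -> U x -> (forall y, U y -> f y = g y) -> 'D_v f x = 'D_v g x.
Proof. by move=> oU Ux fg; apply: near_eq_derive; apply: open_eq_near fg. Qed.

Lemma Ck_eq k (U : set E) (f g : E -> F) : open U ->
  (forall y, U y -> f y = g y) -> Ck k U f -> Ck k U g.
Proof.
move=> oU; elim: k f g => [|k IH] f g fg /=.
  move=> fc x Ux; have fcx : f @ x --> f x := fc x Ux.
  suff : g @ x --> f x by rewrite (fg x Ux).
  apply: cvg_trans fcx; apply: near_eq_cvg.
  by apply: open_eq_near oU Ux _ => y /fg.
move=> [df Df]; split=> [x Ux|v].
  exact: near_eq_differentiable (open_eq_near oU Ux fg) (df x Ux).
by apply: IH (Df v) => y Uy; exact: open_eq_derive fg.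
Qed.

Lemma Ck_sub k (U V : set E) (f : E -> F) : V `<=` U -> Ck k U f -> Ck k V f.
Proof.
move=> VU; elim: k f => [|k IH] f /=; first by move=> fc x /VU /fc.
by move=> [df Df]; split=> [x /VU /df //|v]; apply: IH.
Qed.

Lemma Ck_le1 k (U : set E) (f : E -> F) : Ck k.+1 U f -> Ck k U f.
Proof.
elim: k f => [|k IH] f; first by move=> [df _] x /df /differentiable_continuous.
by move=> [df Df]; split=> // v; apply/IH/Df.
Qed.

Lemma smooth_eq (U : set E) (f g : E -> F) : open U ->
  (forall y, U y -> f y = g y) -> smooth U f -> smooth U g.
Proof. by move=> oU fg sf k; apply: Ck_eq fg (sf k). Qed.

Lemma smooth_sub (U V : set E) (f : E -> F) :
  V `<=` U -> smooth U f -> smooth V f.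
Proof. by move=> VU sf k; apply: Ck_sub VU (sf k). Qed.

Lemma smooth_differentiable (U : set E) (f : E -> F) x :
  smooth U f -> U x -> differentiable f x.
Proof. by move=> /(_ 1%N)[+ _]; apply. Qed.

Lemma smooth_derivable (U : set E) (f : E -> F) x v :
  smooth U f -> U x -> derivable f x v.
Proof. by move=> sf Ux; apply/diff_derivable/(smooth_differentiable sf). Qed.

Lemma smooth_derive (U : set E) (f : E -> F) v :
  smooth U f -> smooth U (fun x => 'D_v f x).
Proof. by move=> sf k; have [_] := sf k.+1; apply. Qed.

Lemma Ck_cst k (U : set E) (c : F) : Ck k U (fun=> c).
Proof.
elim: k c => [|k IH] c /=; first by move=> x _; apply: cvg_cst.
split=> [x _|v]; first exact: differentiable_cst.
have -> : (fun x => 'D_v (fun=> c) x) = (fun=> 0) :> (E -> F); last exact: IH.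
by apply/funext => x; exact: derive_cst.
Qed.

Lemma smooth_cst (U : set E) (c : F) : smooth U (fun=> c).
Proof. by move=> k; apply: Ck_cst. Qed.

Lemma CkD k (U : set E) (f g : E -> F) : open U ->
  Ck k U f -> Ck k U g -> Ck k U (fun x => f x + g x).
Proof.
move=> oU; elim: k f g => [|k IH] f g /=.
  by move=> fc gc x Ux; apply: cvgD; [exact: fc|exact: gc].
move=> [df Df] [dg Dg]; split=> [x Ux|v].
  by apply: (@differentiableD _ _ _ f g); [exact: df|exact: dg].
apply: Ck_eq (IH _ _ (Df v) (Dg v)) => // y Uy.
by rewrite -deriveD //; apply: diff_derivable; [exact: df|exact: dg].
Qed.

Lemma smoothD (U : set E) (f g : E -> F) : open U ->
  smooth U f -> smooth U g -> smooth U (fun x => f x + g x).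
Proof. by move=> oU sf sg k; apply: CkD (sf k) (sg k). Qed.

Lemma CkZ k (U : set E) (c : R) (f : E -> F) : open U ->
  Ck k U f -> Ck k U (fun x => c *: f x).
Proof.
move=> oU; elim: k f => [|k IH] f /=.
  by move=> fc x Ux; apply: cvgZ; [exact: cvg_cst|exact: fc].
move=> [df Df]; split=> [x Ux|v].
  by apply: (@differentiableZ _ _ _ f c); exact: df.
apply: Ck_eq (IH _ (Df v)) => // y Uy.
by rewrite -deriveZ //; apply: diff_derivable; exact: df.
Qed.

Lemma smoothZ (U : set E) (c : R) (f : E -> F) : open U ->
  smooth U f -> smooth U (fun x => c *: f x).
Proof. by move=> oU sf k; apply: CkZ (sf k). Qed.

Lemma smoothN (U : set E) (f : E -> F) : open U ->
  smooth U f -> smooth U (fun x => - f x).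
Proof.
move=> oU sf; apply: smooth_eq (smoothZ (-1) oU sf) => // x _.
by rewrite scaleN1r.
Qed.

Lemma Ck_sum k (U : set E) (I : Type) (r : seq I) (P : pred I)
    (f : I -> E -> F) : open U -> (forall i, P i -> Ck k U (f i)) ->
  Ck k U (fun x => \sum_(i <- r | P i) f i x).
Proof.
move=> oU sf; elim: r => [|i r IH].
  by apply: Ck_eq (Ck_cst k U 0) => // x _; rewrite big_nil.
have [Pi|nPi] := boolP (P i).
  by apply: Ck_eq (CkD oU (sf i Pi) IH) => // x _; rewrite big_cons Pi.
by apply: Ck_eq IH => // x _; rewrite big_cons (negbTE nPi).
Qed.

Lemma smooth_sum (U : set E) (I : Type) (r : seq I) (P : pred I)
    (f : I -> E -> F) : open U -> (forall i, P i -> smooth U (f i)) ->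
  smooth U (fun x => \sum_(i <- r | P i) f i x).
Proof. by move=> oU sf k; apply: Ck_sum => // i /sf. Qed.

End NearEq.

Section ScalarSmooth.
Context {R : realType} {E : normedModType R}.

Lemma CkM k (U : set E) (f g : E -> R) : open U ->
  Ck k U f -> Ck k U g -> Ck k U (fun x => f x * g x).
Proof.
move=> oU; elim: k f g => [|k IH] f g.
  by move=> fc gc x Ux; apply: cvgM; [exact: fc|exact: gc].
move=> sf sg; have [df Df] := sf; have [dg Dg] := sg; split=> [x Ux|v].
  by apply: (@differentiableM _ _ f g); [exact: df|exact: dg].
have Sf := Ck_le1 sf; have Sg := Ck_le1 sg.
apply: Ck_eq (CkD oU (IH _ _ Sf (Dg v)) (IH _ _ Sg (Df v))) => // y Uy.
by rewrite -[RHS]/('D_v (f * g) y) deriveM //; apply: diff_derivable;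
  [exact: df|exact: dg].
Qed.

Lemma smoothM (U : set E) (f g : E -> R) : open U ->
  smooth U f -> smooth U g -> smooth U (fun x => f x * g x).
Proof. by move=> oU sf sg k; apply: CkM (sf k) (sg k). Qed.

Lemma CkV k (U : set E) (f : E -> R) : open U -> (forall x, U x -> f x != 0) ->
  Ck k U f -> Ck k U (fun x => (f x)^-1).
Proof.
move=> oU f0; elim: k => [|k IH].
  by move=> fc x Ux; apply: cvgV; [exact: f0|exact: fc].
move=> sf; have [df Df] := sf; split=> [x Ux|v].
  by apply: differentiableV; [exact: df|exact: f0].
have Sf := IH (Ck_le1 sf).
apply: Ck_eq (CkZ (-1) oU (CkM oU (CkM oU Sf Sf) (Df v))) => // y Uy /=.
rewrite deriveV ?f0 //; last by apply/diff_derivable/df.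
by rewrite scaleN1r /GRing.scale /= mulNr -invfM expr2.
Qed.

Lemma smoothV (U : set E) (f : E -> R) : open U -> (forall x, U x -> f x != 0) ->
  smooth U f -> smooth U (fun x => (f x)^-1).
Proof. by move=> oU f0 sf k; apply: CkV (sf k). Qed.

Lemma smooth_prod (U : set E) (I : Type) (r : seq I) (P : pred I)
    (f : I -> E -> R) : open U -> (forall i, P i -> smooth U (f i)) ->
  smooth U (fun x => \prod_(i <- r | P i) f i x).
Proof.
move=> oU sf; elim: r => [|i r IH].
  by apply: smooth_eq (smooth_cst U (1 : R)) => // x _; rewrite big_nil.
have [Pi|nPi] := boolP (P i).
  by apply: smooth_eq (smoothM oU (sf i Pi) IH) => // x _; rewrite big_cons Pi.
by apply: smooth_eq IH => // x _; rewrite big_cons (negbTE nPi).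
Qed.

End ScalarSmooth.

Section MatrixSmooth.
Context {R : realType} {E : normedModType R}.

Lemma differentiable_mxP m n (f : E -> 'M[R]_(m, n)) x :
  differentiable f x <-> forall i j, differentiable (fun y => f y i j) x.
Proof.
split=> [df i j|df].
  exact: differentiable_comp df (differentiable_coord _ i j).
rewrite (_ : f = \sum_i (\sum_j (fun y => f y i j *: delta_mx i j))).
  by apply: differentiable_sum => i; apply: differentiable_sum => j;
    exact: differentiableZl.
apply/funext => y; rewrite fct_sumE [LHS]matrix_sum_delta.
by apply: eq_bigr => i _; rewrite fct_sumE.
Qed.

Lemma derive_mxE m n (f : E -> 'M[R]_(m, n)) x v i j : derivable f x v ->
  ('D_v f x) i j = 'D_v (fun y => f y i j) x.
Proof. by move=> df; rewrite derive_mx // mxE. Qed.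

Lemma derive_mx_on m n (U : set E) (f : E -> 'M[R]_(m, n)) v i j :
  (forall x, U x -> differentiable f x) ->
  forall x, U x -> ('D_v f x) i j = 'D_v (fun y => f y i j) x.
Proof. by move=> df x Ux; rewrite derive_mxE //; apply/diff_derivable/df. Qed.

Lemma cvg_mxP m n (f : E -> 'M[R]_(m, n)) (x : E) (l : 'M[R]_(m, n)) :
  (forall i j, (fun y => f y i j) @ x --> l i j) -> f @ x --> l.
Proof.
move=> fl; apply/cvgrPdist_le => /= e e0; near=> y.
rewrite /Num.Def.normr/= mx_normrE (bigmax_le _ (ltW e0))//= => i _.
rewrite !mxE/=; move: i; near: y; apply: filter_forall => /= i.
exact: ((cvgrPdist_le _ _).1 (fl i.1 i.2)).
Unshelve. all: by end_near. Qed.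

Lemma Ck0_mxP m n (U : set E) (f : E -> 'M[R]_(m, n)) :
  Ck 0 U f <-> forall i j, Ck 0 U (fun y => f y i j).
Proof.
split=> [fc i j x Ux|fc x Ux].
  have fcx : f @ x --> f x := fc x Ux.
  exact: cvg_comp fcx (@coord_continuous _ m n i j _).
by apply: cvg_mxP => i j; exact: fc.
Qed.

(** Regularity is tested on entries, which reduces matrix calculus to scalar
    calculus: products, inverses and determinants are built from sums and
    products of entries. *)
Lemma Ck_mxP m n k (U : set E) (f : E -> 'M[R]_(m, n)) : open U ->
  Ck k U f <-> forall i j, Ck k U (fun y => f y i j).
Proof.
move=> oU; elim: k f => [|k IH] f; first exact: Ck0_mxP.
have dfE v i j : (forall x, U x -> differentiable f x) ->
    Ck k U (fun y => ('D_v f y) i j) <-> Ck k U ('D_v (fun y => f y i j)).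
  move=> df; have E1 := derive_mx_on v i j df.
  by split; apply: Ck_eq => // y Uy; rewrite E1.
split=> [[df Df] i j|Cf].
  split=> [x Ux|v]; first by have /differentiable_mxP := df x Ux; apply.
  by apply/dfE => //; exact: (IH _).1 (Df v) i j.
have df x : U x -> differentiable f x.
  by move=> Ux; apply/differentiable_mxP => i j; apply: (Cf i j).1.
by split=> // v; apply: (IH _).2 => i j; apply/dfE => //; apply: (Cf i j).2.
Qed.

Lemma smooth_mxP m n (U : set E) (f : E -> 'M[R]_(m, n)) : open U ->
  smooth U f <-> forall i j, smooth U (fun y => f y i j).
Proof.
move=> oU; split=> [sf i j k|sf k]; first exact: (Ck_mxP k f oU).1 (sf k) i j.
by apply/(Ck_mxP k f oU) => i j; apply: sf.
Qed.

Lemma smooth_mulmx m n p (U : set E) (f : E -> 'M[R]_(m, n))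
    (g : E -> 'M[R]_(n, p)) : open U ->
  smooth U f -> smooth U g -> smooth U (fun x => f x *m g x).
Proof.
move=> oU /(smooth_mxP _ oU) sf /(smooth_mxP _ oU) sg.
apply/(smooth_mxP _ oU) => i j.
apply: (@smooth_eq _ _ _ _ (fun x => \sum_k f x i k * g x k j)) => //.
  by move=> y _; rewrite mxE.
by apply: smooth_sum => // k _; exact: smoothM.
Qed.

Lemma smooth_scalemx m n (U : set E) (a : E -> R) (f : E -> 'M[R]_(m, n)) :
  open U -> smooth U a -> smooth U f -> smooth U (fun x => a x *: f x).
Proof.
move=> oU sa /(smooth_mxP _ oU) sf; apply/(smooth_mxP _ oU) => i j.
apply: (@smooth_eq _ _ _ _ (fun x => a x * f x i j)) => //.
  by move=> y _; rewrite mxE.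
exact: smoothM.
Qed.

Lemma smooth_det n (U : set E) (f : E -> 'M[R]_n) : open U ->
  smooth U f -> smooth U (fun x => \det (f x)).
Proof.
move=> oU /(smooth_mxP _ oU) sf; apply: smooth_sum => // s _.
by apply: smoothM => //; [exact: smooth_cst|apply: smooth_prod].
Qed.

Lemma smooth_invmx n (U : set E) (f : E -> 'M[R]_n) : open U ->
  (forall x, U x -> f x \in unitmx) ->
  smooth U f -> smooth U (fun x => invmx (f x)).
Proof.
move=> oU fu sf; have detN0 x : U x -> \det (f x) != 0.
  by move=> /fu; rewrite unitmxE unitfE.
apply: (@smooth_eq _ _ _ _ (fun x => (\det (f x))^-1 *: \adj (f x))) => //.
  by move=> y Uy; rewrite /invmx fu.
apply: smooth_scalemx => //; first by apply: smoothV => //; exact: smooth_det.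
apply/(smooth_mxP _ oU) => i j.
apply: (@smooth_eq _ _ _ _ (fun x => (-1) ^+ (j + i) *
   \det (row' j (col' i (f x))))) => //.
  by move=> y _; rewrite mxE.
apply: smoothM => //; first exact: smooth_cst.
apply: smooth_det => //; apply/(smooth_mxP _ oU) => a b.
apply: (@smooth_eq _ _ _ _ (fun x => f x (lift j a) (lift i b))) => //.
  by move=> y _; rewrite !mxE.
by move/(smooth_mxP _ oU): sf; apply.
Qed.

Lemma smooth_trmx m n (U : set E) (f : E -> 'M[R]_(m, n)) : open U ->
  smooth U f -> smooth U (fun x => (f x)^T).
Proof.
move=> oU /(smooth_mxP _ oU) sf; apply/(smooth_mxP _ oU) => i j.
by apply: smooth_eq (sf j i) => // y _; rewrite mxE.
Qed.

Lemma derive_mulmx m n p (f : E -> 'M[R]_(m, n)) (g : E -> 'M[R]_(n, p)) x v :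
  differentiable f x -> differentiable g x ->
  'D_v (fun y => f y *m g y) x = 'D_v f x *m g x + f x *m 'D_v g x.
Proof.
move=> df dg.
have dfe i j : differentiable (fun y => f y i j) x.
  exact: (differentiable_mxP _ _).1 df i j.
have dge i j : differentiable (fun y => g y i j) x.
  exact: (differentiable_mxP _ _).1 dg i j.
have sE i j : (fun y => (f y *m g y) i j) =
    \sum_k ((fun y => f y i k) * (fun y => g y k j)).
  by apply/funext => y; rewrite mxE fct_sumE; apply: eq_bigr.
have dM i j : differentiable (fun y => (f y *m g y) i j) x.
  by rewrite sE; apply: differentiable_sum => k; exact: differentiableM.
apply/matrixP => i j; rewrite derive_mxE; last first.
  exact/diff_derivable/differentiable_mxP.
rewrite sE derive_sum; last first.
  by move=> k; apply/diff_derivable/differentiableM.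
rewrite !mxE -big_split /=; apply: eq_bigr => k _.
rewrite deriveM; try exact: diff_derivable.
rewrite derive_mxE; last exact: diff_derivable.
rewrite derive_mxE; last exact: diff_derivable.
by rewrite addrC [g x k j *: _]mulrC.
Qed.

Lemma differentiable_mulmx m n p (f : E -> 'M[R]_(m, n))
    (g : E -> 'M[R]_(n, p)) x :
  differentiable f x -> differentiable g x ->
  differentiable (fun y => f y *m g y) x.
Proof.
move=> /differentiable_mxP df /differentiable_mxP dg.
apply/differentiable_mxP => i j; rewrite (_ : (fun y => _) =
    \sum_k ((fun y => f y i k) * (fun y => g y k j))).
  by apply: differentiable_sum => k; exact: differentiableM.
by apply/funext => y; rewrite mxE fct_sumE; apply: eq_bigr.
Qed.

End MatrixSmooth.

(** * Symmetry of second derivatives *)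

Section Schwarz.
Context {R : realType} {E : normedModType R}.
Implicit Types (f : E -> R) (a u v : E).

Lemma is_derive_line f a u (s : R) : derivable f (s *: u + a) u ->
  is_derive s 1 (fun t : R => f (t *: u + a)) ('D_u f (s *: u + a)).
Proof.
have QE : (fun h : R => h^-1 *: (((fun t : R => f (t *: u + a)) \o shift s)
      (h *: 1) - f (s *: u + a))) =
    (fun h : R => h^-1 *: ((f \o shift (s *: u + a)) (h *: u)
      - f (s *: u + a))).
  apply/funext => h /=; congr (_ *: (f _ - _)).
  by rewrite scalerDl addrA [h *: 1]mulr1.
by move=> df; apply: DeriveDef; rewrite /derivable ?/derive QE.
Qed.

Lemma is_derive_translate f (b x u : E) : derivable f (b + x) u ->
  is_derive x u (fun y => f (b + y)) ('D_u f (b + x)).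
Proof.
have QE : (fun h : R => h^-1 *: (((fun y => f (b + y)) \o shift x)
      (h *: u) - f (b + x))) =
    (fun h : R => h^-1 *: ((f \o shift (b + x)) (h *: u) - f (b + x))).
  by apply/funext => h /=; congr (_ *: (f _ - _)); rewrite addrCA.
by move=> df; apply: DeriveDef; rewrite /derivable ?/derive QE.
Qed.

(** The mean value theorem along the line through [a] with direction [u]. *)
Lemma line_MVT f a u (h : R) : 0 < h ->
  (forall s, 0 <= s <= h -> derivable f (s *: u + a) u) ->
  exists2 c, 0 < c < h & f (h *: u + a) - f a = 'D_u f (c *: u + a) * h.
Proof.
move=> h0 df.
have [| |c ch E1] := @MVT R (fun t => f (t *: u + a))
    (fun s => 'D_u f (s *: u + a)) 0 h h0.
- move=> s; rewrite in_itv /= => /andP[s0 sh]; apply: is_derive_line.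
  by apply: df; rewrite (ltW s0) (ltW sh).
- apply: derivable_within_continuous => s; rewrite in_itv /= => sh.
  by have [] := is_derive_line (df s sh).
exists c; first by rewrite in_itv /= in ch.
by rewrite scale0r add0r subr0 in E1.
Qed.

(** Each mixed partial derivative is a limit of the same second difference
    quotients over small parallelograms. *)
Lemma second_difference f a u v (h : R) : 0 < h ->
  (forall s t : R, 0 <= s <= h -> 0 <= t <= h ->
     derivable f (s *: u + (t *: v + a)) u /\
     derivable ('D_u f) (s *: u + (t *: v + a)) v) ->
  exists s t : R, [/\ 0 < s < h, 0 < t < h &
    (f (h *: u + (h *: v + a)) - f (h *: v + a)) - (f (h *: u + a) - f a)
    = 'D_v ('D_u f) (s *: u + (t *: v + a)) * h * h].
Proof.
move=> h0 df.
have hh : 0 <= h <= h by rewrite lexx (ltW h0).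
have z0 : 0 <= (0 : R) <= h by rewrite lexx (ltW h0).
pose g x := f (h *: v + x) - f x.
have dg s : 0 <= s <= h -> is_derive (s *: u + a) u g
    ('D_u f (s *: u + (h *: v + a)) - 'D_u f (s *: u + a)).
  move=> sh; have [d1 _] := df s h sh hh; have [d2 _] := df s 0 sh z0.
  rewrite scale0r add0r in d2.
  have d1' : is_derive (s *: u + a) u (fun x => f (h *: v + x))
      ('D_u f (s *: u + (h *: v + a))).
    rewrite (addrCA (s *: u)) in d1 *.
    exact: is_derive_translate d1.
  exact: is_deriveB d1' (derivableP d2).
have [|s sh E1] := @line_MVT g a u h h0.
  by move=> s sh; have [] := dg s sh.
have sh' : 0 <= s <= h by case/andP: sh => s0 s1; rewrite !ltW.
have [|t th E2] := @line_MVT ('D_u f) (s *: u + a) v h h0.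
  by move=> t th; have [_] := df s t sh' th; rewrite addrCA.
exists s, t; split => //.
have [_ E3] := dg s sh'.
rewrite E3 [s *: u + (h *: v + a)]addrCA E2 /g in E1.
rewrite [h *: u + (h *: v + a)]addrCA [s *: u + _]addrCA -E1.
by rewrite !opprB !addrA [RHS]addrAC [RHS]addrC !addrA; ring.
Qed.

(** Both mixed derivatives are limits of one and the same second difference
    quotient, by [second_difference] with the two directions exchanged. *)
Lemma derive_comm (U : set E) f u v x : open U -> smooth U f -> U x ->
  'D_u ('D_v f) x = 'D_v ('D_u f) x.
Proof.
move=> oU sf Ux; apply/eqP; rewrite -subr_eq0 -normr_le0.
apply/ler_addgt0Pr => e e0; rewrite add0r.
have cuv w w' : {for x, continuous ('D_w ('D_w' f))}.
  apply: differentiable_continuous.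
  exact: smooth_differentiable (smooth_derive w (smooth_derive w' sf)) Ux.
have e2 : 0 < e / 2 by rewrite divr_gt0.
have near1 : \forall y \near x, [/\ U y,
    `|'D_u ('D_v f) x - 'D_u ('D_v f) y| < e / 2 &
    `|'D_v ('D_u f) x - 'D_v ('D_u f) y| < e / 2].
  have n0 : \forall y \near x, U y by exact: open_nbhs_nbhs (conj oU Ux).
  have c1 : 'D_u ('D_v f) @ x --> 'D_u ('D_v f) x := cuv u v.
  have c2 : 'D_v ('D_u f) @ x --> 'D_v ('D_u f) x := cuv v u.
  have n1 := (cvgrPdist_lt _ _).1 c1 _ e2.
  have n2 := (cvgrPdist_lt _ _).1 c2 _ e2.
  clear cuv c1 c2.
  apply: filterS3 n0 (n1 _) (n2 _) => y Uy h1 h2; exact: And3 Uy h1 h2.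
clear cuv; have [d /= d0 dP] := (nbhs_ballP _ _).1 near1.
(* A step so small that the whole parallelogram spanned by [h *: u], [h *: v]
   lies in the ball of radius [d]. *)
pose m := 1 + `|u| + `|v|; pose h := d / (2 * m).
have m0 : 0 < m by rewrite /m -addrA ltr_wpDr // addr_ge0.
have h0 : 0 < h by rewrite divr_gt0 // mulr_gt0.
have near2 (s t : R) : 0 <= s <= h -> 0 <= t <= h ->
    ball x d (s *: u + (t *: v + x)).
  move=> /andP[s0 sh] /andP[t0 th].
  rewrite -ball_normE /ball_ /= distrC addrA addrK.
  apply: le_lt_trans (ler_normD _ _) _; rewrite !normrZ !ger0_norm //.
  apply: (@le_lt_trans _ _ (h * (`|u| + `|v|))).
    by rewrite mulrDr lerD // ler_wpM2r.
  apply: (@lt_le_trans _ _ (h * (2 * m))); last by rewrite divfK // mulf_neq0 ?gt_eqF.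
  rewrite ltr_pM2l // /m; have := normr_ge0 u; have := normr_ge0 v; lra.
have Uy (s t : R) : 0 <= s <= h -> 0 <= t <= h -> U (s *: u + (t *: v + x)).
  by move=> sh th; have [] := dP _ (near2 s t sh th).
have [|s [t [sh th E1]]] := @second_difference f x u v h h0.
  move=> s t sh th; have Ust := Uy s t sh th; split.
    exact: smooth_derivable sf Ust.
  exact: smooth_derivable (smooth_derive u sf) Ust.
have [|t' [s' [th' sh' E2]]] := @second_difference f x v u h h0.
  move=> s1 t1 sh1 th1; have := Uy t1 s1 th1 sh1; rewrite addrCA => Uy1.
  split; first exact: smooth_derivable sf Uy1.
  exact: smooth_derivable (smooth_derive v sf) Uy1.
have W (c : R) : 0 < c < h -> 0 <= c <= h by case/andP=> c0 c1; rewrite !ltW.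
have [_ _ N1] := dP _ (near2 s t (W _ sh) (W _ th)).
have [_ N2 _] := dP _ (near2 s' t' (W _ sh') (W _ th')).
have E3 : 'D_v ('D_u f) (s *: u + (t *: v + x))
    = 'D_u ('D_v f) (s' *: u + (t' *: v + x)).
  have aux (A B F1 F2 F3 F4 : R) : F1 - F2 - (F3 - F4) = A * h * h ->
      F1 - F3 - (F2 - F4) = B * h * h -> A = B.
    have hN0 : h != 0 by rewrite gt_eqF.
    move=> A1 B1; apply: (mulIf hN0); apply: (mulIf hN0).
    by rewrite -A1 -B1; ring.
  rewrite (addrCA (s' *: u)); rewrite (addrCA (h *: v)) in E2.
  exact: aux E1 E2.
rewrite E3 in N1; move: N1 N2; clear => N1 N2.
have aux (A B C : R) : `|B - C| < e / 2 -> `|A - C| < e / 2 -> `|A - B| <= e.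
  move=> B1 A1; have -> : A - B = (A - C) - (B - C) by ring.
  rewrite (splitr e); apply: le_trans (ler_normB _ _) _.
  by apply: ltW; apply: ltrD.
exact: aux N1 N2.
Qed.

End Schwarz.

(** * The chain rule *)

Section Composition.
Context {R : realType}.

Lemma derive_comp (E E' F : normedModType R) (g : E -> E') (f : E' -> F) x v :
  differentiable g x -> differentiable f (g x) ->
  'D_v (f \o g) x = 'D_('D_v g x) f (g x).
Proof.
move=> dg df; rewrite deriveE; last exact: differentiable_comp.
by rewrite diff_comp //= deriveE // deriveE.
Qed.

Lemma derive_linear (E F : normedModType R) (f : E -> F) x : differentiable f x ->
  forall (a : R) u v, 'D_(a *: u + v) f x = a *: 'D_u f x + 'D_v f x.
Proof. by move=> df a u v; rewrite !deriveE // linearP. Qed.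

Lemma derive_sumr (E F : normedModType R) (f : E -> F) x : differentiable f x ->
  forall (I : Type) (r : seq I) (a : I -> R) (u : I -> E),
  'D_(\sum_(i <- r) a i *: u i) f x = \sum_(i <- r) a i *: 'D_(u i) f x.
Proof.
move=> df I r a u; rewrite deriveE // linear_sum; apply: eq_bigr => i _.
by rewrite linearZ deriveE.
Qed.

Lemma col_sum_delta n (v : 'cV[R]_n) : v = \sum_i v i 0 *: delta_mx i 0.
Proof.
rewrite [LHS]matrix_sum_delta; apply: eq_bigr => i _.
by rewrite big_ord_recl big_ord0 addr0.
Qed.

Lemma derive_mulmx_cst (E : normedModType R) m n p (f : E -> 'M[R]_(m, n))
    (w : 'M[R]_(n, p)) x v : differentiable f x ->
  'D_v (fun y => f y *m w) x = 'D_v f x *m w.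
Proof.
move=> df; have dc : differentiable (fun=> w : 'M[R]_(n, p)) x.
  exact: differentiable_cst.
have E1 := derive_mulmx v df dc.
have E2 : 'D_v (fun=> w : 'M[R]_(n, p)) x = 0 by exact: derive_cst.
apply: etrans E1 _; move: E2; move: ('D_v (fun=> w) x) => A ->.
by rewrite mulmx0 addr0.
Qed.

(** By the chain rule a derivative of [f \o g] is a sum of products of a derivative
    of [g] with a composite of [g] and a derivative of [f], so one inducts on the
    order. *)
Lemma smooth_comp (E : normedModType R) n (U : set E) (V : set 'cV[R]_n)
    (g : E -> 'cV[R]_n) (f : 'cV[R]_n -> R) : open U ->
  (forall x, U x -> V (g x)) -> smooth U g -> smooth V f -> smooth U (f \o g).
Proof.
move=> oU UV sg sf k; elim: k f sf => [|k IH] f sf.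
  move=> x Ux.
  have cg := differentiable_continuous (smooth_differentiable sg Ux).
  have cf := differentiable_continuous (smooth_differentiable sf (UV x Ux)).
  exact: continuous_comp cg cf.
split=> [x Ux|v].
  have dg := smooth_differentiable sg Ux.
  have df := smooth_differentiable sf (UV x Ux).
  exact: differentiable_comp dg df.
have S1 : Ck k U (fun x => \sum_i ('D_v g x) i 0 * ('D_(delta_mx i 0) f \o g) x).
  apply: (Ck_sum _ oU) => i _; apply: (CkM oU).
    exact: (smooth_mxP _ oU).1 (smooth_derive v sg) i 0 k.
  by apply: IH; exact: smooth_derive.
apply: (Ck_eq oU _ S1) => x Ux.
have dg := smooth_differentiable sg Ux.
have df := smooth_differentiable sf (UV x Ux).
rewrite (derive_comp v dg df) [in RHS](col_sum_delta ('D_v g x)).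
exact/esym/derive_sumr.
Qed.

Lemma smooth_comp_mx (E : normedModType R) n p q (U : set E) (V : set 'cV[R]_n)
    (g : E -> 'cV[R]_n) (f : 'cV[R]_n -> 'M[R]_(p, q)) : open U -> open V ->
  (forall x, U x -> V (g x)) -> smooth U g -> smooth V f -> smooth U (f \o g).
Proof.
move=> oU oV UV sg sf; apply/(smooth_mxP _ oU) => i j.
apply: (smooth_comp oU UV sg (f := fun y => f y i j)).
exact: (smooth_mxP _ oV).1 sf i j.
Qed.

Lemma smooth_id n (U : set 'cV[R]_n) : smooth U (fun x : 'cV[R]_n => x).
Proof.
move=> [|k].
  by move=> x _; exact: cvg_id.
split=> [x _|v]; first exact: ex_diff.
have -> : (fun x => 'D_v (fun y : 'cV[R]_n => y) x) = (fun=> v) :> (_ -> 'cV[R]_n).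
  by apply/funext => x; exact: derive_id.
exact: Ck_cst.
Qed.

Lemma derive_comm_mx (E : normedModType R) p q (U : set E) (f : E -> 'M[R]_(p, q))
    u v x : open U -> smooth U f -> U x -> 'D_u ('D_v f) x = 'D_v ('D_u f) x.
Proof.
move=> oU sf Ux; apply/matrixP => i j.
have sfe := (smooth_mxP _ oU).1 sf i j.
have DE w w' : ('D_w ('D_w' f) x) i j = 'D_w ('D_w' (fun y => f y i j)) x.
  rewrite derive_mxE; last exact: smooth_derivable (smooth_derive w' sf) Ux.
  apply: (open_eq_derive _ oU Ux) => y Uy.
  by apply: derive_mxE; exact: smooth_derivable sf Uy.
have E1 := derive_comm u v oU sfe Ux.
exact: etrans (DE u v) (etrans E1 (esym (DE v u))).
Qed.

End Composition.

(** * Changes of charts and smooth fields *)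

Lemma invmxM (R : comUnitRingType) m (A B : 'M[R]_m) :
  A \in unitmx -> B \in unitmx -> invmx (A *m B) = invmx B *m invmx A.
Proof.
move=> uA uB; have uAB : A *m B \in unitmx by rewrite unitmx_mul uA.
rewrite -[RHS](mulmxK uAB) mulmxA -(mulmxA _ (invmx A)) mulVmx // mulmx1.
by rewrite mulVmx // mul1mx.
Qed.

Section LinearMatrix.
Context {R : realType} {N p : nat}.

(** The matrix of [f] when [f] is linear ([lmxE]).  It turns pointwise linear maps
    into matrices to which the matrix calculus applies. *)
Definition lmx (f : 'cV[R]_N -> 'cV[R]_p) : 'M[R]_(p, N) :=
  \matrix_(i, j) f (delta_mx j 0) i 0.

Lemma lmx_col f j : lmx f *m delta_mx j (0 : 'I_1) = f (delta_mx j 0).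
Proof. by apply/colP => i; rewrite -colE !mxE. Qed.

Lemma lmxE f : (forall (a : R) u v, f (a *: u + v) = a *: f u + f v) ->
  forall v, f v = lmx f *m v.
Proof.
move=> flin v.
have f0 : f 0 = 0.
  have := flin 1 0 0; rewrite !scale1r addr0 => f00.
  by apply: (@addrI _ (f 0)); rewrite addr0 -f00.
have fsum (I : Type) (r : seq I) (a : I -> R) (u : I -> 'cV[R]_N) :
    f (\sum_(i <- r) a i *: u i) = \sum_(i <- r) a i *: f (u i).
  by elim: r => [|i r IH]; rewrite ?big_nil // !big_cons flin IH.
rewrite {1}(col_sum_delta v) fsum {2}(col_sum_delta v) mulmx_sumr; apply: eq_bigr => i _.
by rewrite -scalemxAr lmx_col.
Qed.

Lemma mx_ext (A B : 'M[R]_(p, N)) :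
  (forall v : 'cV[R]_N, A *m v = B *m v) -> A = B.
Proof.
move=> AB; apply/matrixP => i j.
by have /colP/(_ i) := AB (delta_mx j 0); rewrite -!colE !mxE.
Qed.

End LinearMatrix.

Section Charts.
Context {R : realType} {N : nat} (M : manifold R N).
Implicit Types (c d e : chart R N M) (x y : M) (U : set M).

Definition image_in c U : set 'cV[R]_N := chart_map c @` (chart_dom c `&` U).

Lemma image_inP c U z : image_in c U z <->
  [/\ chart_dom c (chart_inv c z), U (chart_inv c z) &
      chart_map c (chart_inv c z) = z].
Proof.
split=> [[x [dx Ux] <-]|[dz Uz zE]]; first by rewrite chart_mapK.
by exists (chart_inv c z).
Qed.

Lemma image_in_map c U x : chart_dom c x -> U x -> image_in c U (chart_map c x).
Proof. by move=> dx Ux; exists x. Qed.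

Lemma image_in_sub c U V : U `<=` V -> image_in c U `<=` image_in c V.
Proof. by move=> UV z [x [dx /UV Vx] <-]; exists x. Qed.

Lemma open_image_in c U : open U -> open (image_in c U).
Proof.
move=> oU; rewrite openE => z [x [dx Ux] <-].
have n1 : nbhs (chart_map c x) (chart_map c @` chart_dom c).
  by apply: open_nbhs_nbhs; split; [exact: chart_img_open|exists x].
have ci : chart_inv c @ chart_map c x --> chart_inv c (chart_map c x).
  by apply: chart_inv_continuous; exists x.
have n2 : nbhs (chart_map c x) (chart_inv c @^-1` U).
  by apply: ci; apply: open_nbhs_nbhs; rewrite chart_mapK.
apply: filterS2 n1 n2 => _ [y dy <-] /=; rewrite chart_mapK // => Uy.
by exists y.
Qed.

Arguments open_image_in c {U} _.

Lemma transition_smooth c d : atlas c -> atlas d ->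
  smooth (image_in c (chart_dom d)) (chart_map d \o chart_inv c).
Proof. exact: atlas_compatible. Qed.

Lemma transition_differentiable c d x : atlas c -> atlas d ->
  chart_dom c x -> chart_dom d x ->
  differentiable (chart_map d \o chart_inv c) (chart_map c x).
Proof.
move=> ac ad dx ex.
exact: smooth_differentiable (transition_smooth ac ad) (image_in_map dx ex).
Qed.

Lemma coord_change_linear c d x : atlas c -> atlas d ->
  chart_dom c x -> chart_dom d x -> forall (a : R) u v,
  coord_change c d x (a *: u + v)
    = a *: coord_change c d x u + coord_change c d x v.
Proof.
move=> ac ad dx ex a u v; apply: derive_linear.
exact: transition_differentiable.
Qed.

Lemma coord_change_id c x v : chart_dom c x -> coord_change c c x v = v.
Proof.
move=> dx; have oI := open_image_in c (@openT M).
have Iz : image_in c setT (chart_map c x) by exact: image_in_map.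
have E1 z : image_in c setT z -> (chart_map c \o chart_inv c) z = z.
  by case/image_inP.
rewrite /coord_change.
rewrite (@open_eq_derive _ _ _ _ _ (fun z => z) _ v oI Iz E1).
exact: derive_id.
Qed.

Lemma coord_change_comp c d e x v : atlas c -> atlas d -> atlas e ->
  chart_dom c x -> chart_dom d x -> chart_dom e x ->
  coord_change d e x (coord_change c d x v) = coord_change c e x v.
Proof.
move=> ac ad ae cx dx ex; rewrite /coord_change.
have dcd := transition_differentiable ac ad cx dx.
have zE : (chart_map d \o chart_inv c) (chart_map c x) = chart_map d x.
  by rewrite /= chart_mapK.
have dde : differentiable (chart_map e \o chart_inv d)
    ((chart_map d \o chart_inv c) (chart_map c x)).
  by rewrite zE; exact: transition_differentiable.
have E1 := derive_comp v dcd dde.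
rewrite zE in E1; rewrite -E1.
have oI := open_image_in c (chart_dom_open d).
apply: (open_eq_derive _ oI (image_in_map cx dx)) => z /image_inP[_ dz _].
by rewrite /= chart_mapK.
Qed.

Definition ccmx c d x : 'M[R]_N := lmx (coord_change c d x).

Lemma ccmxE c d x v : atlas c -> atlas d -> chart_dom c x -> chart_dom d x ->
  coord_change c d x v = ccmx c d x *m v.
Proof. by move=> *; apply: lmxE; apply: coord_change_linear. Qed.

Lemma ccmx_id c x : atlas c -> chart_dom c x -> ccmx c c x = 1%:M.
Proof.
by move=> ac cx; apply: mx_ext => v; rewrite -ccmxE // coord_change_id // mul1mx.
Qed.

Lemma ccmx_comp c d e x : atlas c -> atlas d -> atlas e ->
  chart_dom c x -> chart_dom d x -> chart_dom e x ->
  ccmx d e x *m ccmx c d x = ccmx c e x.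
Proof.
move=> ac ad ae cx dx ex; apply: mx_ext => v.
rewrite -mulmxA -(ccmxE v ac ad cx dx) -(ccmxE _ ad ae dx ex).
by rewrite -(ccmxE v ac ae cx ex); apply: coord_change_comp ac ad ae cx dx ex.
Qed.

Lemma ccmx_unit c d x : atlas c -> atlas d -> chart_dom c x -> chart_dom d x ->
  ccmx c d x \in unitmx.
Proof.
move=> ac ad cx dx; have := ccmx_comp ac ad ac cx dx cx.
by rewrite ccmx_id // => /mulmx1_unit[].
Qed.

Lemma invmx_ccmx c d x : atlas c -> atlas d -> chart_dom c x -> chart_dom d x ->
  invmx (ccmx c d x) = ccmx d c x.
Proof.
move=> ac ad cx dx; rewrite -[RHS](mulmxK (ccmx_unit ac ad cx dx)).
by rewrite ccmx_comp // ccmx_id // mul1mx.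
Qed.

Lemma field_in_chartE c X z : atlas c -> image_in c setT z ->
  field_in_chart c X z = ccmx (chart_at (chart_inv c z)) c (chart_inv c z)
    *m X (chart_inv c z).
Proof.
move=> ac /image_inP[dz _ _]; rewrite /field_in_chart ccmxE //.
  exact: chart_at_atlas.
exact: mem_chart_at.
Qed.

Lemma sub_image_inT c U : image_in c U `<=` image_in c setT.
Proof. exact: image_in_sub. Qed.

End Charts.

Arguments open_image_in {R N M} c {U} _.

Section SmoothFields.
Context {R : realType} {N : nat} (M : manifold R N).
Implicit Types (c d : chart R N M) (x y : M) (U : set M) (X Y : vfield M).

Definition smooth_map (F : normedModType R) U (f : M -> F) : Prop :=
  forall c, atlas c -> smooth (image_in c U) (f \o chart_inv c).

Lemma smooth_field_eq U X Y : open U -> (forall x, U x -> X x = Y x) ->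
  smooth_field U X -> smooth_field U Y.
Proof.
move=> oU XY sX c ac; have oI := open_image_in c oU.
apply: smooth_eq oI _ (sX c ac) => z Iz; have IT := sub_image_inT Iz.
by rewrite !field_in_chartE // XY //; case/image_inP: Iz.
Qed.

Lemma smooth_field_sub U V X : V `<=` U -> smooth_field U X -> smooth_field V X.
Proof.
by move=> VU sX c ac; apply: smooth_sub (sX c ac); apply: image_in_sub.
Qed.

Lemma smooth_field0 U : open U -> smooth_field U (fun=> 0 : 'cV[R]_N).
Proof.
move=> oU c ac; apply: smooth_eq (smooth_cst _ 0); first exact: open_image_in.
by move=> z /sub_image_inT Iz; rewrite field_in_chartE // mulmx0.
Qed.

Lemma smooth_fieldD U X Y : open U -> smooth_field U X -> smooth_field U Y ->
  smooth_field U (fun x => X x + Y x).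
Proof.
move=> oU sX sY c ac; have oI := open_image_in c oU.
apply: smooth_eq oI _ (smoothD oI (sX c ac) (sY c ac)) => z /sub_image_inT Iz.
by rewrite !field_in_chartE // mulmxDr.
Qed.

Lemma smooth_fieldZ U (f : M -> R) X : open U ->
  smooth_function U f -> smooth_field U X -> smooth_field U (fun x => f x *: X x).
Proof.
move=> oU sf sX c ac; have oI := open_image_in c oU.
apply: smooth_eq oI _ (smooth_scalemx oI (sf c ac) (sX c ac)) => z.
by move=> /sub_image_inT Iz; rewrite !field_in_chartE // scalemxAr.
Qed.

Lemma smooth_function_cst U (a : R) : smooth_function U (fun=> a : R).
Proof. by move=> c ac; apply: smooth_cst. Qed.

Lemma smooth_frame_chart U s c : open U -> atlas c -> smooth_frame U s ->
  smooth (image_in c U) (fun z => ccmx (chart_at (chart_inv c z)) c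
    (chart_inv c z) *m s (chart_inv c z)).
Proof.
move=> oU ac ss; have oI := open_image_in c oU.
apply/(smooth_mxP _ oI) => i j.
have := (smooth_mxP _ oI).1 (ss (delta_mx j 0) c ac) i 0.
apply: smooth_eq oI _ => z /sub_image_inT Iz.
by rewrite field_in_chartE // mulmxA -colE mxE.
Qed.

(** Components of a smooth field in a smooth frame: both are compared in one
    chart, where the frame becomes a smooth invertible matrix. *)
Lemma smooth_coefs U s X : open U -> smooth_frame U s ->
  (forall x, U x -> s x \in unitmx) -> smooth_field U X ->
  smooth_map U (fun x => invmx (s x) *m X x).
Proof.
move=> oU ss su sX c ac; have oI := open_image_in c oU.
have sS := smooth_frame_chart oU ac ss.
have uC z : image_in c U z ->
    ccmx (chart_at (chart_inv c z)) c (chart_inv c z) \in unitmx.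
  by case/image_inP => dz _ _; apply: ccmx_unit => //;
    [exact: chart_at_atlas|exact: mem_chart_at].
have uS z : image_in c U z -> ccmx (chart_at (chart_inv c z)) c
    (chart_inv c z) *m s (chart_inv c z) \in unitmx.
  move=> Iz; rewrite unitmx_mul uC //=; apply: su.
  by case/image_inP: Iz.
apply: smooth_eq oI _ (smooth_mulmx oI (smooth_invmx oI uS sS) (sX c ac)).
move=> z Iz; have IT := sub_image_inT Iz; rewrite field_in_chartE //=.
have uA := uC z Iz; have uB : s (chart_inv c z) \in unitmx.
  by apply: su; case/image_inP: Iz.
move: uA uB; move: (ccmx _ _ _) (s _) (X _) => A B w uA uB.
rewrite invmxM //.
by rewrite -mulmxA (mulmxA _ A) mulVmx // mul1mx.
Qed.

Lemma smooth_field_frame U s (f : M -> 'cV[R]_N) : open U -> smooth_frame U s ->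
  smooth_map U f -> smooth_field U (fun x => s x *m f x).
Proof.
move=> oU ss sf c ac; have oI := open_image_in c oU.
have sS := smooth_frame_chart oU ac ss.
apply: smooth_eq oI _ (smooth_mulmx oI sS (sf c ac)) => z /sub_image_inT Iz.
by rewrite field_in_chartE //= mulmxA.
Qed.

(** The frame of the coordinate fields of the chart at [x]. *)
Definition ext_frame x y : 'M[R]_N := ccmx (chart_at x) (chart_at y) y.

Lemma extendE x v y : chart_dom (chart_at x) y ->
  extend x v y = ext_frame x y *m v.
Proof.
by move=> dy; rewrite /extend ccmxE //; try exact: chart_at_atlas;
  exact: mem_chart_at.
Qed.

Lemma ext_frame_unit x y : chart_dom (chart_at x) y ->
  ext_frame x y \in unitmx.
Proof.
by move=> dy; apply: ccmx_unit => //; try exact: chart_at_atlas;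
  exact: mem_chart_at.
Qed.

Lemma ext_frame_id x : ext_frame x x = 1%:M.
Proof. by apply: ccmx_id; [exact: chart_at_atlas|exact: mem_chart_at]. Qed.

Lemma extend_id x v : extend x v x = v.
Proof. by apply: coord_change_id; apply: mem_chart_at. Qed.

Lemma smooth_ext_frame x : smooth_frame (chart_dom (chart_at x)) (ext_frame x).
Proof.
move=> v c ac; set cx := chart_at x.
have ax : atlas cx by exact: chart_at_atlas.
have oI := open_image_in c (chart_dom_open cx).
have oV := open_image_in cx (chart_dom_open c).
have sT := transition_smooth ac ax.
have sD := smooth_derive v (transition_smooth ax ac).
apply: smooth_eq oI _ (smooth_comp_mx oI oV _ sT sD); last first.
  move=> z /image_inP[dz ez _] /=.
  by apply: image_in_map => //; rewrite chart_mapK.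
move=> z Iz; have IT := sub_image_inT Iz; case/image_inP: Iz => dz ez zE.
rewrite field_in_chartE // mulmxA ccmx_comp //; try exact: chart_at_atlas;
  try exact: mem_chart_at.
by rewrite -ccmxE.
Qed.

Lemma smooth_extend x v : smooth_field (chart_dom (chart_at x)) (extend x v).
Proof.
apply: smooth_field_eq (chart_dom_open _) _ (@smooth_ext_frame x v) => y dy.
by rewrite extendE.
Qed.

(** The derivative of a function with values in a normed space along a tangent
    vector; [dir_deriv] is the scalar case. *)
Definition mderiv (F : normedModType R) x v (f : M -> F) : F :=
  'D_v (f \o chart_inv (chart_at x)) (chart_map (chart_at x) x).

Lemma mderiv_extend (F : normedModType R) U (f : M -> F) x y v :
  open U -> U y -> smooth_map U f -> chart_dom (chart_at x) y ->
  mderiv y (extend x v y) f =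
    'D_v (f \o chart_inv (chart_at x)) (chart_map (chart_at x) y).
Proof.
move=> oU Uy sf dy; set c := chart_at y; set cx := chart_at x.
have [ac ax] : atlas c /\ atlas cx by split; exact: chart_at_atlas.
have cy : chart_dom c y by exact: mem_chart_at.
have dT := transition_differentiable ax ac dy cy.
have zE : (chart_map c \o chart_inv cx) (chart_map cx y) = chart_map c y.
  by rewrite /= chart_mapK.
have df : differentiable (f \o chart_inv c)
    ((chart_map c \o chart_inv cx) (chart_map cx y)).
  by rewrite zE; exact: smooth_differentiable (sf c ac) (image_in_map cy Uy).
have E1 := derive_comp v dT df; rewrite zE in E1.
rewrite -[LHS]E1.
have oI := open_image_in cx (chart_dom_open c).
apply: (open_eq_derive _ oI (image_in_map dy cy)) => z /image_inP[_ dz _].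
by rewrite /= chart_mapK.
Qed.

(** The extensions have constant coordinates in the chart at [x]. *)
Lemma lie_bracket_extend x u v : lie_bracket (extend x u) (extend x v) x = 0.
Proof.
rewrite /lie_bracket; set c := chart_at x.
have ac : atlas c by exact: chart_at_atlas.
have cst_fic w (y : 'cV[R]_N) : image_in c setT y -> field_in_chart c (extend x w) y = w.
  move=> Iy; rewrite field_in_chartE //; case/image_inP: Iy => dy _ _.
  rewrite extendE // mulmxA ccmx_comp //; try exact: chart_at_atlas;
    try exact: mem_chart_at.
  by rewrite ccmx_id // mul1mx.
have Iz : image_in c setT (chart_map c x).
  by apply: image_in_map => //; exact: mem_chart_at.
have D0 w w' : 'D_w (field_in_chart c (extend x w')) (chart_map c x) = 0.
  have oI := open_image_in c (@openT M).
  rewrite (@open_eq_derive _ _ _ _ _ (fun=> w') _ w oI Iz (cst_fic w')).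
  exact: derive_cst.
exact: etrans (congr2 (fun a b => a - b) (D0 _ v) (D0 _ u)) (subrr 0).
Qed.

End SmoothFields.

(** * Connection matrices and the structure equations *)

Section Connection.
Context {R : realType} {N : nat} (M : manifold R N) (nabla : cov_deriv M).
Hypothesis conn : affine_connection nabla.
Implicit Types (x y : M) (U : set M) (s : M -> 'M[R]_N) (X Y : vfield M).

Lemma nabla_eq x v X Y : (forall y, X y = Y y) -> nabla x v X = nabla x v Y.
Proof. by move=> XY; congr nabla; apply/funext. Qed.

Lemma nabla0 x v : nabla x v (fun=> 0) = 0.
Proof.
have s0 := @smooth_field0 R N M setT openT.
have := conn_additive conn v openT (I : [set: M] x) s0 s0.
rewrite (@nabla_eq x v _ (fun=> 0)) => [E1|y]; last by rewrite addr0.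
by apply: (@addrI _ (nabla x v (fun=> 0))); rewrite addr0 -E1.
Qed.

Lemma smooth_field_sum U (I : Type) (r : seq I) (Y : I -> vfield M) : open U ->
  (forall i, smooth_field U (Y i)) ->
  smooth_field U (fun y => \sum_(i <- r) Y i y).
Proof.
move=> oU sY; elim: r => [|i r IH].
  by apply: smooth_field_eq oU _ (smooth_field0 oU) => y _; rewrite big_nil.
apply: smooth_field_eq oU _ (smooth_fieldD oU (sY i) IH) => y _.
by rewrite big_cons.
Qed.

Lemma nabla_sum x U v (I : Type) (r : seq I) (a : I -> M -> R)
    (Y : I -> vfield M) : open U -> U x ->
  (forall i, smooth_function U (a i)) -> (forall i, smooth_field U (Y i)) ->
  nabla x v (fun y => \sum_(i <- r) a i y *: Y i y) =
  \sum_(i <- r) (mderiv x v (a i) *: Y i x + a i x *: nabla x v (Y i)).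
Proof.
move=> oU Ux sa sY; have saY i := smooth_fieldZ oU (sa i) (sY i).
elim: r => [|i r IH].
  by rewrite big_nil -[RHS](nabla0 x v); apply: nabla_eq => y; rewrite big_nil.
rewrite big_cons -IH -(conn_Leibniz conn v oU Ux (sa i) (sY i)).
rewrite -(conn_additive conn v oU Ux (saY i) (smooth_field_sum r oU saY)).
by apply: nabla_eq => y; rewrite big_cons.
Qed.

Lemma smooth_map_coord U (f : M -> 'cV[R]_N) k : open U -> smooth_map U f ->
  smooth_function U (fun y => f y k 0).
Proof.
by move=> oU sf c ac; have := (smooth_mxP _ (open_image_in c oU)).1 (sf c ac) k 0.
Qed.

Lemma smooth_map_differentiable (F : normedModType R) U (f : M -> F) x :
  U x -> smooth_map U f ->
  differentiable (f \o chart_inv (chart_at x)) (chart_map (chart_at x) x).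
Proof.
move=> Ux sf; apply: smooth_differentiable (sf _ (chart_at_atlas x)) _.
by apply: image_in_map => //; exact: mem_chart_at.
Qed.

(** The connection matrix along [v] of the frame [s]. *)
Definition Lam s x v : 'M[R]_N :=
  lmx (fun w => invmx (s x) *m nabla x v (fun y => s y *m w)).

Lemma LamE s U x v w : open U -> U x -> smooth_frame U s -> s x \in unitmx ->
  nabla x v (fun y => s y *m w) = s x *m (Lam s x v *m w).
Proof.
move=> oU Ux ss su; rewrite -lmxE => [|a w1 w2]; first by rewrite mulKVmx.
rewrite scalemxAr -mulmxDr; congr (_ *m _).
have sa : smooth_function U (fun=> a) by exact: smooth_function_cst.
have s1 := smooth_fieldZ oU sa (ss w1).
rewrite (@nabla_eq x v _ (fun y => a *: (s y *m w1) + s y *m w2)); last first.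
  by move=> y; rewrite mulmxDr scalemxAr.
rewrite (conn_additive conn v oU Ux s1 (ss w2)).
rewrite (conn_Leibniz conn v oU Ux sa (ss w1)).
rewrite (_ : dir_deriv x v (fun=> a) = 0) ?scale0r ?add0r //.
exact: derive_cst.
Qed.

(** Expand the field in the columns of the frame and use additivity and the
    Leibniz rule. *)
Lemma nabla_frame s U x v (f : M -> 'cV[R]_N) : open U -> U x ->
  smooth_frame U s -> s x \in unitmx -> smooth_map U f ->
  nabla x v (fun y => s y *m f y) =
    s x *m (mderiv x v f + Lam s x v *m f x).
Proof.
move=> oU Ux ss su sf.
have sf' k := smooth_map_coord k oU sf.
rewrite (@nabla_eq x v _ (fun y => \sum_k f y k 0 *: (s y *m delta_mx k 0))).
  rewrite (nabla_sum v _ oU Ux sf' (fun k => ss (delta_mx k 0))).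
  rewrite big_split /= mulmxDr; congr (_ + _).
    have dE k : mderiv x v (fun y => f y k 0) = (mderiv x v f) k 0.
      apply/esym/derive_mxE/diff_derivable.
      exact: smooth_map_differentiable Ux sf.
    rewrite [in RHS](col_sum_delta (mderiv x v f)) mulmx_sumr.
    by apply: eq_bigr => k _; rewrite dE scalemxAr.
  rewrite [in RHS](col_sum_delta (f x)) !mulmx_sumr.
  by apply: eq_bigr => k _; rewrite (LamE _ _ oU Ux ss su) !scalemxAr.
move=> y; rewrite {1}(col_sum_delta (f y)) mulmx_sumr.
by apply: eq_bigr => k _; rewrite scalemxAr.
Qed.

Lemma nabla_field s U x v Y : open U -> U x -> smooth_frame U s ->
  (forall y, U y -> s y \in unitmx) -> smooth_field U Y ->
  nabla x v Y = s x *m (mderiv x v (fun y => invmx (s y) *m Y y)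
                        + Lam s x v *m (invmx (s x) *m Y x)).
Proof.
move=> oU Ux ss su sY; have sc := smooth_coefs oU ss su sY.
rewrite -(nabla_frame v oU Ux ss (su x Ux) sc).
by apply: (conn_local conn v oU Ux sY) => y Uy; rewrite mulKVmx ?su.
Qed.

Lemma Lam_entry s x v i j : Lam s x v i j =
  (invmx (s x) *m nabla x v (fun y => s y *m delta_mx j (0 : 'I_1))) i 0.
Proof. by rewrite /Lam /lmx mxE. Qed.

Lemma smooth_Lam s U X : open U -> smooth_frame U s ->
  (forall y, U y -> s y \in unitmx) -> smooth_field U X ->
  smooth_map U (fun x => Lam s x (X x)).
Proof.
move=> oU ss su sX c ac; have oI := open_image_in c oU.
apply/(smooth_mxP _ oI) => i j.
have sN := conn_smooth conn oU sX (ss (delta_mx j 0)).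
have := (smooth_mxP _ oI).1 (smooth_coefs oU ss su sN ac) i 0.
by apply: smooth_eq oI _ => z _; exact/esym/Lam_entry.
Qed.

Lemma nabla_dir0 x U Y : open U -> U x -> smooth_field U Y -> nabla x 0 Y = 0.
Proof.
move=> oU Ux sY; have := conn_linear conn oU Ux sY 1 0 0.
rewrite !scale1r addr0 => E1.
by apply: (@addrI _ (nabla x 0 Y)); rewrite addr0 -E1.
Qed.

Lemma torsion_atE x u v : torsion_at nabla x u v =
  nabla x u (extend x v) - nabla x v (extend x u).
Proof.
by rewrite /torsion_at /torsion lie_bracket_extend subr0 !extend_id.
Qed.

(** The torsion tensor of two fields with constant coordinates in the chart at
    [x], evaluated at another point [y]: these fields commute near [x], because
    the second derivatives of the transition map to the chart at [y] are
    symmetric. *)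
Lemma torsion_extend x y u v : chart_dom (chart_at x) y ->
  nabla y (extend x u y) (extend x v) - nabla y (extend x v y) (extend x u)
  = torsion_at nabla y (extend x u y) (extend x v y).
Proof.
move=> dy; set c := chart_at y; set cx := chart_at x.
have [ac ax] : atlas c /\ atlas cx by split; exact: chart_at_atlas.
have cy : chart_dom c y by exact: mem_chart_at.
pose U := chart_dom c `&` chart_dom cx.
have oU : open U by apply: openI; exact: chart_dom_open.
have Uy : U y by [].
have sy : smooth_frame U (ext_frame y).
  by move=> w; apply: smooth_field_sub (smooth_ext_frame y w) => ? [].
have uy z : U z -> ext_frame y z \in unitmx by case=> ? _; exact: ext_frame_unit.
have sx w : smooth_field U (extend x w).
  by apply: smooth_field_sub (smooth_extend x w) => ? [].
pose g w z := invmx (ext_frame y z) *m extend x w z.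
have sg w : smooth_map U (g w) := smooth_coefs oU sy uy (sx w).
have Iz : image_in cx U (chart_map cx y) by exact: image_in_map.
have oI := open_image_in cx oU.
have sT : smooth (image_in cx U) (chart_map c \o chart_inv cx).
  by apply: smooth_sub (transition_smooth ax ac); apply: image_in_sub => ? [].
have gE w z : image_in cx U z -> (g w \o chart_inv cx) z =
    'D_w (chart_map c \o chart_inv cx) z.
  move=> /image_inP[dz [ez _] zE].
  have dzz : chart_dom (chart_at (chart_inv cx z)) (chart_inv cx z).
    exact: mem_chart_at.
  have az : atlas (chart_at (chart_inv cx z)) by exact: chart_at_atlas.
  rewrite /= /g extendE // /ext_frame invmx_ccmx // mulmxA ccmx_comp //.
  by rewrite -ccmxE // /coord_change zE.
have mE w w' : mderiv y (extend x w y) (g w') =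
    'D_w ('D_w' (chart_map c \o chart_inv cx)) (chart_map cx y).
  have E1 := mderiv_extend w oU Uy (sg w') dy.
  exact: etrans E1 (open_eq_derive w oI Iz (gE w')).
have nE w w' : nabla y (extend x w y) (extend x w') =
    'D_w ('D_w' (chart_map c \o chart_inv cx)) (chart_map cx y) +
    Lam (ext_frame y) y (extend x w y) *m extend x w' y.
  rewrite (nabla_field _ oU Uy sy uy (sx w')) -mE ext_frame_id mul1mx.
  by rewrite invmx1 mul1mx.
have tE w w' : nabla y w (extend y w') = Lam (ext_frame y) y w *m w'.
  have E1 := LamE w w' oU Uy sy (uy y Uy); rewrite ext_frame_id mul1mx in E1.
  rewrite -E1; have sy' := smooth_extend y w'.
  have := conn_local conn w (chart_dom_open c) cy sy'; apply => z dz.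
  exact: extendE.
have E1 := derive_comm_mx u v oI sT Iz.
rewrite (nE u v) (nE v u) torsion_atE (tE _ _) (tE _ _).
move: E1; move: ('D_u ('D_v _) _) ('D_v ('D_u _) _) => A B ->.
by rewrite opprD addrACA subrr add0r.
Qed.

(** Local data of a connection in a frame [s] near [x], read in the chart at
    [x]: the coframe [coframe] gives the components in [s] of the coordinate fields
    and [conn_form] the connection matrices along them. *)
Section Gauge.
Variables (x : M) (U : set M) (s : M -> 'M[R]_N).
Hypotheses (oU : open U) (Ux : U x) (ss : smooth_frame U s).
Hypothesis su : forall y, U y -> s y \in unitmx.

Local Notation c := (chart_at x).
Local Notation pt z := (chart_inv (chart_at x) z).

Definition frame_dom := image_in c U.
Definition chart_pt := chart_map c x.
Definition coframe (z : 'cV[R]_N) : 'M[R]_N :=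
  invmx (s (pt z)) *m ext_frame x (pt z).
Definition conn_form (u : 'cV[R]_N) (z : 'cV[R]_N) : 'M[R]_N :=
  Lam s (pt z) (extend x u (pt z)).

Let W := U `&` chart_dom c.
Let oW : open W. Proof. by apply: openI => //; exact: chart_dom_open. Qed.
Let sW : smooth_frame W s.
Proof. by move=> w; apply: smooth_field_sub (ss w) => ? []. Qed.
Let uW y : W y -> s y \in unitmx. Proof. by case=> /su. Qed.
Let xW v : smooth_field W (extend x v).
Proof. by apply: smooth_field_sub (smooth_extend x v) => ? []. Qed.
Let OW : frame_dom `<=` image_in c W.
Proof. by move=> z [y [dy Uy] <-]; exists y. Qed.
Let ac : atlas c. Proof. exact: chart_at_atlas. Qed.
Let ptW z : frame_dom z -> W (pt z). Proof. by case/image_inP. Qed.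

Lemma open_frame_dom : open frame_dom. Proof. exact: open_image_in. Qed.

Lemma mem_chart_pt : frame_dom chart_pt.
Proof. by apply: image_in_map => //; exact: mem_chart_at. Qed.

Lemma chart_inv_pt : pt chart_pt = x.
Proof. by apply: chart_mapK; exact: mem_chart_at. Qed.

Lemma coframe_pt : coframe chart_pt = invmx (s x).
Proof. by rewrite /coframe chart_inv_pt ext_frame_id mulmx1. Qed.

Lemma smooth_coframe : smooth frame_dom coframe.
Proof.
apply/(smooth_mxP _ open_frame_dom) => i j.
have s1 := smooth_coefs oW sW uW (xW (delta_mx j 0)) ac.
have := (smooth_mxP _ (open_image_in c oW)).1 s1 i 0.
move=> /(smooth_sub OW); apply: smooth_eq open_frame_dom _ => z Oz.
have [_ dz] := ptW Oz.
by rewrite /= extendE // mulmxA -colE mxE.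
Qed.

Lemma smooth_conn_form u : smooth frame_dom (conn_form u).
Proof. exact: smooth_sub OW (smooth_Lam oW sW uW (xW u) ac). Qed.

Lemma extend_coframe z u : frame_dom z ->
  extend x u (pt z) = s (pt z) *m (coframe z *m u).
Proof.
move=> /ptW[Uz dz]; rewrite mulmxA /coframe mulmxA mulmxV ?su //.
by rewrite mul1mx extendE.
Qed.

Lemma conn_formE z u : frame_dom z ->
  conn_form u z = Lam s (pt z) (s (pt z) *m (coframe z *m u)).
Proof. by move=> Oz; rewrite /conn_form extend_coframe. Qed.

Let dgF z : frame_dom z -> differentiable coframe z.
Proof. exact: smooth_differentiable smooth_coframe. Qed.

Let coefE v z : frame_dom z ->
  ((fun y => invmx (s y) *m extend x v y) \o chart_inv c) z = coframe z *m v.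
Proof.
move=> Oz; have [Uz _] := ptW Oz.
by rewrite /comp extend_coframe // mulKmx //; apply: su.
Qed.

Let dFw z v (w : 'cV[R]_N) : frame_dom z ->
  'D_v (fun z => coframe z *m w) z = 'D_v coframe z *m w.
Proof. by move=> Oz; exact: derive_mulmx_cst (dgF Oz). Qed.

Lemma nabla_extend z u v : frame_dom z ->
  nabla (pt z) (extend x u (pt z)) (extend x v) =
    s (pt z) *m ('D_u coframe z *m v + conn_form u z *m (coframe z *m v)).
Proof.
move=> Oz; have Wz := ptW Oz; have [Uz dz] := Wz.
have sc := smooth_coefs oW sW uW (xW v).
have zE : chart_map c (pt z) = z by case/image_inP: Oz.
have E1 := nabla_field (extend x u (pt z)) oW Wz sW uW (xW v).
have E2 := mderiv_extend u oW Wz sc dz; rewrite zE in E2.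
have E3 := coefE v.
have E4 := etrans (open_eq_derive u open_frame_dom Oz E3) (dFw u v Oz).
have E5 : invmx (s (pt z)) *m extend x v (pt z) = coframe z *m v := E3 z Oz.
have E6 := congr1 (mulmx (conn_form u z)) E5.
exact: etrans E1 (congr1 (mulmx (s (pt z))) (congr2 +%R (etrans E2 E4) E6)).
Qed.

(** Cartan's first structure equation: the torsion of the coordinate fields, which
    commute, with their covariant derivatives expressed in the frame. *)
Lemma structure1 z u v : frame_dom z ->
  s (pt z) *m (('D_u coframe z *m v + conn_form u z *m (coframe z *m v))
             - ('D_v coframe z *m u + conn_form v z *m (coframe z *m u)))
  = torsion_at nabla (pt z) (s (pt z) *m (coframe z *m u)) (s (pt z) *m (coframe z *m v)).
Proof.
move=> Oz; rewrite mulmxBr -!nabla_extend // -!extend_coframe //.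
by apply: torsion_extend; case: (ptW Oz).
Qed.

(** Cartan's second structure equation at [x]: expand the curvature of coordinate
    fields in the frame.  The second derivatives of the coframe cancel because
    they are symmetric, its first derivatives because each product of them with a
    connection matrix occurs twice. *)
Lemma structure2 u v w : curvature_at nabla x u v w =
  s x *m (('D_u (conn_form v) chart_pt - 'D_v (conn_form u) chart_pt
           + (conn_form u chart_pt *m conn_form v chart_pt
              - conn_form v chart_pt *m conn_form u chart_pt))
          *m (invmx (s x) *m w)).
Proof.
have Wx : W x by split => //; exact: mem_chart_at.
have Oz := mem_chart_pt.
pose G v z := 'D_v coframe z *m w + conn_form v z *m (coframe z *m w).
have nG a b : nabla x a (fun y => nabla y (extend x b y) (extend x w)) =
    s x *m ('D_a (G b) chart_pt + conn_form a chart_pt *m G b chart_pt).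
  have sN := conn_smooth conn oW (xW b) (xW w).
  have GE z : frame_dom z -> invmx (s (pt z)) *m nabla (pt z) (extend x b (pt z))
      (extend x w) = G b z.
    by move=> Oz'; rewrite nabla_extend // mulKmx // su //; case: (ptW Oz').
  have E1 := nabla_field a oW Wx sW uW sN.
  have E2 := open_eq_derive a open_frame_dom Oz GE.
  have E3 := GE chart_pt Oz; rewrite chart_inv_pt in E3.
  have E4 : Lam s x a = conn_form a chart_pt by rewrite /conn_form chart_inv_pt extend_id.
  exact: etrans E1 (congr1 (mulmx (s x)) (congr2 +%R E2 (congr2 mulmx E4 E3))).
rewrite /curvature_at /curvature lie_bracket_extend.
rewrite (nabla_dir0 oW Wx (xW w)) subr0 !extend_id nG nG -mulmxBr.
congr (_ *m _).
have DG a b : 'D_a (G b) chart_pt = 'D_a ('D_b coframe) chart_pt *m w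
   + ('D_a (conn_form b) chart_pt *m (coframe chart_pt *m w)
      + conn_form b chart_pt *m ('D_a coframe chart_pt *m w)).
  have dD : differentiable (fun z => 'D_b coframe z) chart_pt.
    exact: smooth_differentiable (smooth_derive b smooth_coframe) Oz.
  have dc : differentiable (fun=> w : 'cV[R]_N) chart_pt by exact: differentiable_cst.
  have dL : differentiable (conn_form b) chart_pt.
    exact: smooth_differentiable (smooth_conn_form b) Oz.
  have d1 : differentiable (fun z => coframe z *m w) chart_pt.
    exact: differentiable_mulmx (dgF Oz) dc.
  have d2 : differentiable (fun z => 'D_b coframe z *m w) chart_pt.
    exact: differentiable_mulmx dD dc.
  have d3 : differentiable (fun z => conn_form b z *m (coframe z *m w)) chart_pt.
    exact: differentiable_mulmx dL d1.
  have E1 := derive_mulmx_cst w a dD.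
  have E2 := derive_mulmx a dL d1.
  have E3 := deriveD (diff_derivable (v := a) d2) (diff_derivable (v := a) d3).
  have E4 := congr1 (mulmx (conn_form b chart_pt)) (dFw a w Oz).
  have E5 := etrans E2
    (congr1 (+%R ('D_a (conn_form b) chart_pt *m (coframe chart_pt *m w))) E4).
  exact: etrans E3 (congr2 +%R E1 E5).
have alg (DD P Q A B C D F : 'M[R]_N) :
    (DD *m w + (A *m (F *m w) + Q *m (C *m w))) + P *m (D *m w + Q *m (F *m w))
    - ((DD *m w + (B *m (F *m w) + P *m (D *m w)))
       + Q *m (C *m w + P *m (F *m w)))
    = (A - B + (P *m Q - Q *m P)) *m (F *m w).
  rewrite !mulmxDl !mulmxDr !mulNmx -!mulmxA.
  move: (DD *m w) (A *m _) (Q *m _) (P *m _) (P *m (Q *m _)) (B *m _) (Q *m _).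
  by move=> a1 a2 a3 a4 a5 a6 a7; apply/colP => i; rewrite !mxE; ring.
have E1 := derive_comm_mx u v open_frame_dom smooth_coframe Oz.
have E2 := etrans (DG u v) (congr1 (fun A => A *m w +
  ('D_u (conn_form v) chart_pt *m (coframe chart_pt *m w)
   + conn_form v chart_pt *m ('D_u coframe chart_pt *m w))) E1).
have E3 := alg ('D_v ('D_u coframe) chart_pt) (conn_form u chart_pt)
  (conn_form v chart_pt) ('D_u (conn_form v) chart_pt)
  ('D_v (conn_form u) chart_pt) ('D_u coframe chart_pt) ('D_v coframe chart_pt)
  (coframe chart_pt).
have E4 := congr2 (fun a b => a + conn_form u chart_pt *m G v chart_pt
  - (b + conn_form v chart_pt *m G u chart_pt))
  E2 (DG v u).
rewrite -coframe_pt; exact: etrans E4 E3.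
Qed.

End Gauge.
End Connection.

(** * The model space and the unitary group *)

Section Dot.
Context {R : realType} {m : nat}.
Implicit Types u v w : 'cV[R]_m.

Definition dot u v : R := (u^T *m v) 0 0.

Lemma dotE u v : dot u v = \sum_i u i 0 * v i 0.
Proof. by rewrite /dot mxE; apply: eq_bigr => i _; rewrite mxE. Qed.

Lemma dotC u v : dot u v = dot v u.
Proof. by rewrite !dotE; apply: eq_bigr => i _; rewrite mulrC. Qed.

Lemma dotDl u v w : dot (u + v) w = dot u w + dot v w.
Proof. by rewrite /dot linearD mulmxDl mxE. Qed.

Lemma dotZl a u w : dot (a *: u) w = a * dot u w.
Proof. by rewrite /dot linearZ /= -scalemxAl mxE. Qed.

Lemma dotDr u v w : dot w (u + v) = dot w u + dot w v.
Proof. by rewrite dotC dotDl !(dotC w). Qed.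

Lemma dotZr a u w : dot w (a *: u) = a * dot w u.
Proof. by rewrite dotC dotZl (dotC w). Qed.

Lemma dotNl u w : dot (- u) w = - dot u w.
Proof. by rewrite -scaleN1r dotZl mulN1r. Qed.

Lemma dotNr u w : dot w (- u) = - dot w u.
Proof. by rewrite dotC dotNl dotC. Qed.

Lemma dot0l w : dot 0 w = 0.
Proof. by rewrite -(scale0r 0) dotZl mul0r. Qed.

Lemma dot0r w : dot w 0 = 0.
Proof. by rewrite dotC dot0l. Qed.

Lemma dot_mulmx (A : 'M[R]_m) u v : dot (A *m u) v = dot u (A^T *m v).
Proof. by rewrite /dot trmx_mul mulmxA. Qed.

Lemma dot_ge0 u : 0 <= dot u u.
Proof. by rewrite dotE sumr_ge0 // => i _; rewrite -expr2 sqr_ge0. Qed.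

Lemma dot_eq0 u : (dot u u == 0) = (u == 0).
Proof.
apply/eqP/eqP => [|->]; last exact: dot0l.
rewrite dotE => /eqP; rewrite psumr_eq0 => [/allP u0|i _]; last first.
  by rewrite -expr2 sqr_ge0.
apply/colP => i; rewrite mxE; have := u0 i; rewrite mem_index_enum.
by move=> /(_ isT) /=; rewrite -expr2 sqrf_eq0 => /eqP.
Qed.

Lemma dot_gt0 u : u != 0 -> 0 < dot u u.
Proof. by move=> u0; rewrite lt_def dot_eq0 u0 dot_ge0. Qed.

Lemma dot_ext u v : (forall w, dot u w = dot v w) -> u = v.
Proof.
move=> uv; apply/eqP; rewrite -subr_eq0 -dot_eq0 dotDl dotNl uv subrr.
exact: eqxx.
Qed.

End Dot.

Arguments dot_ext {R m} u v.

Section Model.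
Context {R : realType} {n : nat}.
Local Notation V := 'cV[R]_(n + n + 1).
Local Notation gl := 'M[R]_(n + n + 1).
Local Notation ee := (@e0 R n).

Definition Jmx : gl := block_mx J0mx 0 0 0.

(** The e-component.  With [ec], [prj] and [om] the decomposition of the model
    space into the horizontal space and the line of [e] is expressed on whole
    vectors, without blocks. *)
Definition ec (u : V) : R := dot ee u.

Definition prj (u : V) : V := u - ec u *: ee.

Definition om (u v : V) : R := dot (Jmx *m u) v.

Lemma J0mx_tr : (@J0mx R n)^T = - J0mx.
Proof.
by rewrite /J0mx tr_block_mx trmx0 linearN /= trmx1 opp_block_mx !oppr0 opprK.
Qed.

Lemma J0mx_sq : @J0mx R n *m J0mx = - 1%:M.
Proof.
rewrite /J0mx mulmx_block !mul0mx !mulmx0 !add0r !addr0 mulmx1 mulmxN mulmx1.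
by rewrite scalar_mx_block opp_block_mx !oppr0.
Qed.

Lemma Jmx_tr : Jmx^T = - Jmx.
Proof. by rewrite /Jmx tr_block_mx !trmx0 J0mx_tr [RHS]opp_block_mx !oppr0. Qed.

Lemma Jmx_col (X : 'cV[R]_(n + n)) (y : 'cV[R]_1) :
  Jmx *m col_mx X y = col_mx (J0mx *m X) 0.
Proof. by rewrite /Jmx (mul_block_col J0mx) !mul0mx !addr0. Qed.

Lemma Jmx_e0 : Jmx *m ee = 0.
Proof. by rewrite /Jmx /e0 mul_block_col !mulmx0 !mul0mx !addr0 col_mx0. Qed.

Lemma dot_e0 : dot ee ee = 1.
Proof.
by rewrite /dot /e0 tr_col_mx mul_row_col trmx0 mul0mx add0r trmx1 mulmx1 mxE.
Qed.

Lemma ec_col (X : 'cV[R]_(n + n)) (y : 'cV[R]_1) : ec (col_mx X y) = y 0 0.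
Proof.
by rewrite /ec /dot /e0 tr_col_mx mul_row_col trmx0 mul0mx add0r trmx1 mul1mx.
Qed.

Lemma prj_col X y : prj (col_mx X y) = col_mx X 0.
Proof.
rewrite /prj ec_col /e0 scale_col_mx scaler0 opp_col_mx oppr0 add_col_mx addr0.
congr col_mx; apply/colP => i; rewrite !mxE [i]ord1 /=.
by rewrite mulr1 subrr.
Qed.

Lemma hor_e0 (u : V) : u = hor (usubmx u) + ec u *: ee.
Proof.
rewrite -{1 3}(vsubmxK u) ec_col /hor /e0 scale_col_mx scaler0 add_col_mx addr0.
rewrite add0r; congr col_mx; apply/colP => i; rewrite !mxE [i]ord1.
by rewrite mulr1.
Qed.

Lemma ec_hor X : ec (hor X) = 0.
Proof. by rewrite /hor ec_col mxE. Qed.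

Lemma prj_hor X : prj (hor X) = hor X.
Proof. by rewrite /prj ec_hor scale0r subr0. Qed.

Lemma hor_usub (u : V) : hor (usubmx u) = prj u.
Proof. by rewrite -{2}(vsubmxK u) prj_col. Qed.

Lemma horZ a X : hor (a *: X) = a *: hor X :> V.
Proof. by rewrite /hor scale_col_mx scaler0. Qed.

Lemma horD X Y : hor (X + Y) = hor X + hor Y :> V.
Proof. by rewrite /hor add_col_mx addr0. Qed.

Lemma horN X : hor (- X) = - hor X :> V.
Proof. by rewrite /hor opp_col_mx oppr0. Qed.

Lemma hor_J0 X : hor (J0 X) = Jmx *m hor X :> V.
Proof. by rewrite /hor /Jmx /J0 mul_block_col !mulmx0 !mul0mx !addr0. Qed.

Lemma dot_hor X Y : dot (hor X : V) (hor Y) = h0 X Y.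
Proof. by rewrite /dot /h0 /hor tr_col_mx mul_row_col mulmx0 addr0. Qed.

Lemma om_hor X Y : om (hor X) (hor Y) = omega0 X Y.
Proof. by rewrite /om -hor_J0 dot_hor. Qed.

Lemma ec0 : ec ee = 1. Proof. exact: dot_e0. Qed.

Lemma ecD u v : ec (u + v) = ec u + ec v. Proof. exact: dotDr. Qed.
Lemma ecZ a u : ec (a *: u) = a * ec u. Proof. exact: dotZr. Qed.
Lemma ecN u : ec (- u) = - ec u. Proof. exact: dotNr. Qed.

Lemma dotJ u v : dot (Jmx *m u) v = - dot u (Jmx *m v).
Proof. by rewrite dot_mulmx Jmx_tr mulNmx dotNr. Qed.

Lemma ec_J u : ec (Jmx *m u) = 0.
Proof. by rewrite /ec dotC dotJ Jmx_e0 dot0r oppr0. Qed.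

Lemma ec_prj u : ec (prj u) = 0.
Proof. by rewrite /prj ecD ecN ecZ ec0 mulr1 subrr. Qed.

Lemma dot_er u : dot u ee = ec u. Proof. exact: dotC. Qed.

Lemma JJ u : Jmx *m (Jmx *m u) = - prj u.
Proof.
rewrite -(vsubmxK u) prj_col !Jmx_col.
by rewrite mulmxA J0mx_sq mulNmx mul1mx opp_col_mx oppr0.
Qed.

Lemma J_prj u : Jmx *m prj u = Jmx *m u.
Proof. by rewrite /prj mulmxBr -scalemxAr Jmx_e0 scaler0 subr0. Qed.

Lemma prj_J u : prj (Jmx *m u) = Jmx *m u.
Proof. by rewrite /prj ec_J scale0r subr0. Qed.

Lemma prj_e0 : prj ee = 0.
Proof. by rewrite /prj ec0 scale1r subrr. Qed.

Lemma prjD u v : prj (u + v) = prj u + prj v.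
Proof. by rewrite /prj ecD scalerDl opprD addrACA. Qed.

Lemma prjZ a u : prj (a *: u) = a *: prj u.
Proof. by rewrite /prj ecZ scalerBr scalerA. Qed.

Lemma dot_prjl u v : dot (prj u) v = dot u v - ec u * ec v.
Proof. by rewrite /prj dotDl dotNl dotZl. Qed.

Lemma dot_prjr u v : dot u (prj v) = dot u v - ec u * ec v.
Proof. by rewrite dotC dot_prjl dotC mulrC. Qed.

Lemma omC u v : om u v = - om v u.
Proof. by rewrite /om dotJ dotC. Qed.

Lemma om_self u : om u u = 0.
Proof. by have := omC u u; move: (om u u) => a; lra. Qed.

Lemma omDl u v w : om (u + v) w = om u w + om v w.
Proof. by rewrite /om mulmxDr dotDl. Qed.

Lemma omZl a u w : om (a *: u) w = a * om u w.
Proof. by rewrite /om -scalemxAr dotZl. Qed.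

Lemma omDr u v w : om w (u + v) = om w u + om w v.
Proof. exact: dotDr. Qed.

Lemma omZr a u w : om w (a *: u) = a * om w u.
Proof. exact: dotZr. Qed.

Lemma om_e0l u : om ee u = 0.
Proof. by rewrite /om Jmx_e0 dot0l. Qed.

Lemma om_e0r u : om u ee = 0.
Proof. by rewrite omC om_e0l oppr0. Qed.

Lemma om_prjl u v : om (prj u) v = om u v.
Proof. by rewrite /om J_prj. Qed.

Lemma om_prjr u v : om u (prj v) = om u v.
Proof. by rewrite omC om_prjl -omC. Qed.

Lemma om_Jl u v : om (Jmx *m u) v = - (dot u v - ec u * ec v).
Proof. by rewrite /om JJ dotNl dot_prjl. Qed.

Lemma om_Jr u v : om u (Jmx *m v) = dot u v - ec u * ec v.
Proof. by rewrite omC om_Jl opprK dotC mulrC. Qed.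

(** The structure group and its Lie algebra consist of the isometries,
    respectively the skew maps, that commute with the extended complex structure
    and fix, respectively annihilate, the vertical vector. *)
Lemma unitary_groupP (A : gl) : unitary_group A <->
  [/\ A^T *m A = 1%:M, A *m Jmx = Jmx *m A & A *m ee = ee].
Proof.
split=> [[B [Bu BJ ->]]|[Au AJ Ae]].
  split.
  - rewrite tr_block_mx !trmx0 trmx1 mulmx_block !mulmx0 !mul0mx !addr0 !add0r.
    by rewrite Bu mulmx1 -scalar_mx_block.
  - by rewrite /Jmx !mulmx_block !mulmx0 !mul0mx !addr0 BJ.
  - by rewrite /e0 mul_block_col !mulmx0 !mul0mx !addr0 add0r mulmx1.
have Ae' : A^T *m ee = ee by rewrite -{1}Ae mulmxA Au mul1mx.
rewrite -(submxK A) in Au AJ Ae Ae' *.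
move: (ulsubmx A) (ursubmx A) (dlsubmx A) (drsubmx A) Au AJ Ae Ae' => B C D E.
rewrite tr_block_mx /Jmx !mulmx_block !mulmx0 !mul0mx !addr0 scalar_mx_block.
move=> /eq_block_mx[Bu _ _ _] /eq_block_mx[BJ _ _ _].
rewrite /e0 !mul_block_col !mulmx0 !mulmx1 !add0r.
move=> /eq_col_mx[C0 E1] /eq_col_mx[D0 _].
have {}D0 : D = 0 by rewrite -(trmxK D) D0 trmx0.
rewrite C0 D0 E1; rewrite D0 mulmx0 addr0 in Bu.
by exists B.
Qed.

Lemma unitary_algebraP (A : gl) : unitary_algebra A <->
  [/\ A^T = - A, A *m Jmx = Jmx *m A & A *m ee = 0].
Proof.
split=> [[B [Bu BJ ->]]|[Au AJ Ae]].
  split.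
  - by rewrite tr_block_mx !trmx0 Bu opp_block_mx !oppr0.
  - by rewrite /Jmx !mulmx_block !mulmx0 !mul0mx !addr0 BJ.
  - by rewrite /e0 mul_block_col !mulmx0 !mul0mx !addr0 col_mx0.
rewrite -(submxK A) in Au AJ Ae *.
move: (ulsubmx A) (ursubmx A) (dlsubmx A) (drsubmx A) Au AJ Ae => B C D E.
rewrite tr_block_mx opp_block_mx /Jmx !mulmx_block !mulmx0 !mul0mx !addr0.
move=> /eq_block_mx[Bu _ DC _] /eq_block_mx[BJ _ _ _].
rewrite /e0 !mul_block_col !mulmx0 !mulmx1 !add0r.
move=> /eqP; rewrite col_mx_eq0 => /andP[/eqP C0 /eqP E0].
have D0 : D = 0.
  by move: DC; rewrite C0 trmx0 => /esym/eqP; rewrite oppr_eq0 => /eqP.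
by rewrite C0 D0 E0; exists B.
Qed.

Lemma unitary_group1 : unitary_group (1%:M : gl).
Proof. by apply/unitary_groupP; rewrite trmx1 !mulmx1 !mul1mx. Qed.

Lemma unitary_groupM (A B : gl) :
  unitary_group A -> unitary_group B -> unitary_group (A *m B).
Proof.
move=> /unitary_groupP[A1 A2 A3] /unitary_groupP[B1 B2 B3].
apply/unitary_groupP; split.
- by rewrite trmx_mul mulmxA -(mulmxA _ A^T) A1 mulmx1.
- by rewrite -mulmxA B2 mulmxA A2 mulmxA.
- by rewrite -mulmxA B3.
Qed.

Lemma unitary_group_tr (A : gl) : unitary_group A ->
  [/\ A *m A^T = 1%:M, A^T *m Jmx = Jmx *m A^T & A^T *m ee = ee].
Proof.
move=> /unitary_groupP[A1 A2 A3]; split.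
- exact: mulmx1C.
- by have := congr1 trmx A2; rewrite !trmx_mul Jmx_tr mulNmx mulmxN => /oppr_inj.
- by rewrite -{1}A3 mulmxA A1 mul1mx.
Qed.

Lemma unitary_groupT (A : gl) : unitary_group A -> unitary_group A^T.
Proof.
by move=> /unitary_group_tr[A1 A2 A3]; apply/unitary_groupP; rewrite trmxK.
Qed.

Lemma unitary_group_unit (A : gl) : unitary_group A ->
  A \in unitmx /\ invmx A = A^T.
Proof.
move=> UA; have [A1 _ _] := unitary_group_tr UA.
have [uA _] := mulmx1_unit A1; split => //.
by rewrite -[LHS]mulmx1 -A1 mulKmx.
Qed.

Lemma unitary_algebra0 : unitary_algebra (0 : gl).
Proof. by apply/unitary_algebraP; rewrite trmx0 oppr0 !mulmx0 !mul0mx. Qed.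

Lemma unitary_algebraD (A B : gl) : unitary_algebra A -> unitary_algebra B ->
  unitary_algebra (A + B).
Proof.
move=> /unitary_algebraP[A1 A2 A3] /unitary_algebraP[B1 B2 B3].
apply/unitary_algebraP; split; first by rewrite linearD /= A1 B1 opprD.
  by rewrite mulmxDl mulmxDr A2 B2.
by rewrite mulmxDl A3 B3 addr0.
Qed.

Lemma unitary_algebraZ a (A : gl) : unitary_algebra A -> unitary_algebra (a *: A).
Proof.
move=> /unitary_algebraP[A1 A2 A3].
apply/unitary_algebraP; split; first by rewrite linearZ /= A1 scalerN.
  by rewrite -scalemxAl -scalemxAr A2.
by rewrite -scalemxAl A3 scaler0.
Qed.

Lemma unitary_algebraN (A : gl) : unitary_algebra A -> unitary_algebra (- A).
Proof. by move=> Ag; rewrite -scaleN1r; apply: unitary_algebraZ. Qed.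

Lemma unitary_algebraB (A B : gl) : unitary_algebra A -> unitary_algebra B ->
  unitary_algebra (A - B).
Proof. by move=> Ag Bg; apply: unitary_algebraD => //; apply: unitary_algebraN. Qed.

Lemma unitary_algebra_bracket (A B : gl) :
  unitary_algebra A -> unitary_algebra B -> unitary_algebra (A *m B - B *m A).
Proof.
move=> /unitary_algebraP[A1 A2 A3] /unitary_algebraP[B1 B2 B3].
apply/unitary_algebraP; split.
- by rewrite linearB /= !trmx_mul A1 B1 !mulNmx !mulmxN !opprK opprB.
- rewrite mulmxBl mulmxBr -!mulmxA A2 B2 !mulmxA A2 B2.
  by rewrite -!mulmxA.
- by rewrite mulmxBl -!mulmxA A3 B3 !mulmx0 subr0.
Qed.

Lemma unitary_algebra_J : unitary_algebra Jmx.
Proof. by apply/unitary_algebraP; rewrite Jmx_tr Jmx_e0. Qed.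

Lemma unitary_algebra_Ad (g A : gl) : unitary_group g -> unitary_algebra A ->
  unitary_algebra (g *m A *m g^T).
Proof.
move=> Ug /unitary_algebraP[A1 A2 A3].
have [g1 g2 g3] := unitary_group_tr Ug; have /unitary_groupP[g4 g5 g6] := Ug.
apply/unitary_algebraP; split.
- by rewrite !trmx_mul trmxK A1 mulNmx mulmxN mulmxA.
- by rewrite -mulmxA g2 mulmxA -(mulmxA g A) A2 !mulmxA g5.
- by rewrite -mulmxA g3 -mulmxA A3 mulmx0.
Qed.

Lemma unitary_J (g : gl) (u : V) : unitary_group g -> Jmx *m (g *m u) = g *m (Jmx *m u).
Proof. by move=> /unitary_groupP[_ gJ _]; rewrite !mulmxA gJ. Qed.

Lemma unitary_dot (g : gl) u v : unitary_group g -> dot (g *m u) (g *m v) = dot u v.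
Proof. by move=> /unitary_groupP[g1 _ _]; rewrite dot_mulmx mulmxA g1 mul1mx. Qed.

Lemma unitary_ec (g : gl) u : unitary_group g -> ec (g *m u) = ec u.
Proof.
by move=> Ug; have /unitary_groupP[_ _ ge] := Ug; rewrite /ec -{1}ge unitary_dot.
Qed.

Lemma unitary_om (g : gl) u v : unitary_group g -> om (g *m u) (g *m v) = om u v.
Proof. by move=> Ug; rewrite /om unitary_J // unitary_dot. Qed.

Lemma unitary_prj (g : gl) u : unitary_group g -> prj (g *m u) = g *m prj u.
Proof.
move=> Ug; have /unitary_groupP[_ _ ge] := Ug.
by rewrite /prj unitary_ec // mulmxBr -scalemxAr ge.
Qed.

Lemma skew_dot (B : gl) u v : unitary_algebra B -> dot (B *m u) v = - dot u (B *m v).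
Proof. by move=> /unitary_algebraP[B1 _ _]; rewrite dot_mulmx B1 mulNmx dotNr. Qed.

Lemma skew_J (B : gl) (u : V) : unitary_algebra B -> Jmx *m (B *m u) = B *m (Jmx *m u).
Proof. by move=> /unitary_algebraP[_ gJ _]; rewrite !mulmxA gJ. Qed.

Lemma skew_ec (B : gl) u : unitary_algebra B -> ec (B *m u) = 0.
Proof.
move=> Bg; have /unitary_algebraP[_ _ Be] := Bg.
by rewrite /ec dotC skew_dot // Be dot0r oppr0.
Qed.

Lemma skew_prj (B : gl) u : unitary_algebra B -> B *m prj u = B *m u.
Proof.
move=> Bg; have /unitary_algebraP[_ _ Be] := Bg.
by rewrite /prj mulmxBr -scalemxAr Be scaler0 subr0.
Qed.

Lemma prj_skew (B : gl) u : unitary_algebra B -> prj (B *m u) = B *m u.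
Proof. by move=> Bg; rewrite /prj skew_ec // scale0r subr0. Qed.

Lemma skew_om (B : gl) u v : unitary_algebra B -> om (B *m u) v = - om u (B *m v).
Proof. by move=> Bg; rewrite /om skew_J // skew_dot. Qed.

Lemma coset_mod_eq (A B : gl) : unitary_algebra (A - B) ->
  coset_mod unitary_algebra A = coset_mod unitary_algebra B.
Proof.
move=> AB; apply/seteqP; split => C /=; rewrite /coset_mod /= => CA.
  by rewrite -(subrKA A); apply: unitary_algebraD.
by rewrite -(subrKA B) -[B - A]opprB; apply: unitary_algebraB.
Qed.

End Model.

(** * Invariant torsion and inner torsion *)

Lemma alternating_antisym (R : realType) m p q
    (f : 'cV[R]_m -> 'cV[R]_m -> 'M[R]_(p, q)) :
  (forall u v, f u v = - f v u) ->
  (forall (a : R) u v w, f (a *: u + v) w = a *: f u w + f v w) ->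
  alternating_bilinear f.
Proof.
move=> anti lin; split=> [//|a u v w|u].
  by rewrite anti lin opprD -scalerN -!anti.
have := anti u u; move: (f u u) => K E.
by apply/matrixP => i j; have /matrixP/(_ i j) := E; rewrite !mxE; lra.
Qed.

Section InvariantTensors.
Context {R : realType} {n : nat}.
Local Notation V := 'cV[R]_(n + n + 1).
Local Notation gl := 'M[R]_(n + n + 1).
Local Notation ee := (@e0 R n).

Section Alternating.
Context {m : nat} {W : lmodType R} {f : 'cV[R]_m -> 'cV[R]_m -> W}.
Hypothesis alt : alternating_bilinear f.

Lemma altDl u v w : f (u + v) w = f u w + f v w.
Proof. by case: alt => fl _ _; have := fl 1 u v w; rewrite !scale1r. Qed.

Lemma altDr u v w : f w (u + v) = f w u + f w v.
Proof. by case: alt => _ fr _; have := fr 1 u v w; rewrite !scale1r. Qed.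

Lemma alt0l w : f 0 w = 0.
Proof. by apply: (@addrI _ (f 0 w)); rewrite -altDl !addr0. Qed.

Lemma altZl a u w : f (a *: u) w = a *: f u w.
Proof.
by case: alt => fl _ _; have := fl a u 0 w; rewrite !addr0 alt0l addr0.
Qed.

Lemma alternating_anti u v : f u v = - f v u.
Proof.
case: alt => _ _ fa; apply/eqP; rewrite -addr_eq0; apply/eqP.
by have := fa (u + v); rewrite altDl !altDr !fa addr0 add0r.
Qed.

Lemma altZr a u w : f w (a *: u) = a *: f w u.
Proof. by rewrite alternating_anti altZl -scalerN -alternating_anti. Qed.

End Alternating.

Section Torsion.
Variables t1 t2 t3 : R.

(** The alternating bilinear map with the given torsion parameters ([torP]). *)
Definition tor (u v : V) : V := (t3 * om u v) *: ee
  + (ec v *: (t1 *: prj u + t2 *: (Jmx *m u))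
     - ec u *: (t1 *: prj v + t2 *: (Jmx *m v))).

Lemma tor_linearl (a : R) u v w : tor (a *: u + v) w = a *: tor u w + tor v w.
Proof.
rewrite /tor omDl omZl prjD prjZ mulmxDr -scalemxAr ecD ecZ.
move: (prj u) (prj v) (prj w) (Jmx *m u) (Jmx *m v) (Jmx *m w) => A B C D E F.
by apply/colP => i; rewrite !mxE; ring.
Qed.

Lemma tor_anti u v : tor u v = - tor v u.
Proof. by rewrite /tor (omC u) mulrN scaleNr -opprB -opprD. Qed.

Lemma tor_linearr (a : R) u v w : tor w (a *: u + v) = a *: tor w u + tor w v.
Proof. by rewrite !(tor_anti w) tor_linearl opprD scalerN. Qed.

Lemma torP (T0 : V -> V -> V) : alternating_bilinear T0 ->
  torsion_parameters T0 t1 t2 t3 -> forall u v, T0 u v = tor u v.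
Proof.
move=> altT [T1 T2] u v; have [_ _ Ta] := altT.
have He Y : T0 ee (hor Y) = - hor (t1 *: Y + t2 *: J0 Y).
  by rewrite (alternating_anti altT) T2.
rewrite {1}(hor_e0 u) {1}(hor_e0 v) (altDl altT) !(altDr altT).
rewrite !(altZl altT) !(altZr altT) Ta !scaler0 addr0.
rewrite T1 T2 He /tor -om_hor !hor_usub om_prjl om_prjr -addrA.
by rewrite !horD !horZ !hor_J0 !hor_usub !J_prj scalerN.
Qed.

Lemma tor_skew (B : gl) u v : unitary_algebra B ->
  B *m tor u v = tor (B *m u) v + tor u (B *m v).
Proof.
move=> Bg; have /unitary_algebraP[_ _ Be] := Bg.
rewrite /tor !skew_ec // !prj_skew // !skew_J // skew_om //.
rewrite !(skew_prj _ Bg, Be, =^~ scalemxAr, mulmxN, mulmxDr).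
move: (B *m u) (B *m v) (B *m (Jmx *m u)) (B *m (Jmx *m v)) => P Q S T.
move: (om u Q) (ec v) (ec u) (prj u) (prj v) (Jmx *m u) (Jmx *m v) => a b c p q x y.
by apply/colP => i; rewrite !mxE; ring.
Qed.

Definition tormx (u : V) : gl := lmx (tor u).

Lemma tormxE u v : tormx u *m v = tor u v.
Proof. by rewrite -lmxE // => a v1 v2; rewrite tor_linearr. Qed.

Lemma tormx_linear (a : R) u v : tormx (a *: u + v) = a *: tormx u + tormx v.
Proof.
by apply: mx_ext => w; rewrite mulmxDl -scalemxAl !tormxE tor_linearl.
Qed.

Lemma ec_tor u v : ec (tor u v) = t3 * om u v.
Proof.
by rewrite /tor !(ecD, ecN, ecZ, ec_prj, ec_J, ec0); ring.
Qed.

End Torsion.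

Section Inner.
Variables a b al be ga de : R.

(** The inner torsion matrix at [u] applied to [w] ([lam_inner]). *)
Definition lamf (u w : V) : V := (a * ec u) *: prj w
  + ec w *: (al *: prj u + be *: (Jmx *m u))
  + (ga * (dot u w - ec u * ec w) + de * om u w + b * (ec u * ec w)) *: ee.

Definition lam (u : V) : gl := lmx (lamf u).

Lemma lamE u w : lam u *m w = lamf u w.
Proof.
rewrite -lmxE // => c w1 w2; rewrite /lamf omDr omZr dotDr dotZr prjD prjZ ecD ecZ.
move: (prj w1) (prj w2) (prj u) (Jmx *m u) => A B C D.
by apply/colP => i; rewrite !mxE; ring.
Qed.

Lemma lam_linear (c : R) u v : lam (c *: u + v) = c *: lam u + lam v.
Proof.
apply: mx_ext => w; rewrite mulmxDl -scalemxAl !lamE.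
rewrite /lamf omDl omZl dotDl dotZl prjD prjZ ecD ecZ mulmxDr -scalemxAr.
move: (prj u) (prj v) (prj w) (Jmx *m u) (Jmx *m v) => A B C D E.
by apply/colP => i; rewrite !mxE; ring.
Qed.

Lemma lam_inner X s : inner_matrix a b al be ga de X s = lam (hor X + s *: ee).
Proof.
apply: mx_ext => w; rewrite lamE /lamf !(ecD, ecZ, ec_hor, ec0) mulr1 add0r.
rewrite prjD prjZ prj_e0 scaler0 addr0 prj_hor mulmxDr -scalemxAr Jmx_e0 scaler0.
rewrite addr0 omDl omZl om_e0l mulr0 addr0 -(vsubmxK w).
set W := usubmx w; set y := dsubmx w; rewrite prj_col ec_col -/(hor W).
have -> : col_mx W y = hor W + y 0 0 *: ee.
  have := hor_e0 (col_mx W y); rewrite col_mxKu ec_col; exact.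
rewrite !(dotDl, dotDr, dotZl, dotZr) !(dot_er, ec_hor, ec0) -/(ec (hor W)).
rewrite ec_hor dot_hor !omDr omZr om_e0r om_hor -hor_J0 -!horZ -horD -!horZ.
rewrite /inner_matrix /hor /e0 !scale_col_mx !add_col_mx mul_block_col.
rewrite !mul_scalar_mx !scaler0 !addr0 !add0r; congr col_mx.
  by rewrite -scalemxAr mulmx1.
apply/colP => i; rewrite [i]ord1.
have -> : (ga *: X + de *: J0 X)^T *m W = (ga * h0 X W + de * omega0 X W)%:M.
  apply/matrixP => k l; rewrite [k]ord1 [l]ord1 linearD /= !linearZ /= mulmxDl.
  rewrite -!scalemxAl [RHS]mxE eqxx mulr1n /omega0 /h0.
  move: (X^T *m W) (_^T *m W) => A B; by rewrite !mxE.
by rewrite !mxE /= !mulr1n; ring.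
Qed.

Lemma inner_torsion_parametersP (I0 : V -> set gl) :
  inner_torsion_parameters I0 a b al be ga de ->
  forall u, I0 u = coset_mod unitary_algebra (lam u).
Proof. by move=> I0P u; rewrite {1}(hor_e0 u) I0P lam_inner -hor_e0. Qed.

Lemma lam_parameters :
  inner_torsion_parameters (fun u => coset_mod unitary_algebra (lam u))
    a b al be ga de.
Proof. by move=> X s; rewrite lam_inner. Qed.

Lemma lam_unitary (g : gl) u (w : V) : unitary_group g ->
  lam (g *m u) *m (g *m w) = g *m (lam u *m w).
Proof.
move=> Ug; have /unitary_groupP[_ _ ge] := Ug.
rewrite !lamE /lamf unitary_om // !unitary_ec // !unitary_prj // !unitary_J //.
by rewrite unitary_dot // !(mulmxDr, mulmxN, =^~ scalemxAr) ge.
Qed.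

(** Infinitesimal equivariance of [lam]: all its constituents are invariant. *)
Lemma lam_skew (B : gl) u : unitary_algebra B ->
  B *m lam u - lam u *m B = lam (B *m u).
Proof.
move=> Bg; have /unitary_algebraP[_ _ Be] := Bg.
apply: mx_ext => w; rewrite mulmxBl -!mulmxA !lamE /lamf.
rewrite !skew_ec // !prj_skew // !skew_J // skew_om // skew_dot //.
rewrite !(skew_prj _ Bg, Be, =^~ scalemxAr, mulmxN, mulmxDr).
move: (B *m u) (B *m w) (B *m (Jmx *m u)) => P Q S.
move: (om u Q) (dot u Q) (prj u) (prj w) (Jmx *m u) (Jmx *m w) => c d p q x y.
by apply/colP => i; rewrite !mxE; ring.
Qed.

Lemma ec_lam u w : ec (lam u *m w) =
  ga * (dot u w - ec u * ec w) + de * om u w + b * (ec u * ec w).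
Proof.
by rewrite lamE /lamf !(ecD, ecZ, ec_prj, ec_J, ec0); ring.
Qed.

(** The part of the curvature that the inner torsion determines: the curvature
    of the connection differs from it by the curvature, with values in the
    structure algebra, of the connection obtained by subtracting [lam]. *)
Definition lamcurv (u v : V) : gl :=
  lam u *m lam v - lam v *m lam u - lam (lam u *m v - lam v *m u).

End Inner.
End InvariantTensors.

(** * Inner torsion in local sections *)

Section UnitaryDerivative.
Context {R : realType} {E : normedModType R} {n : nat}.
Local Notation gl := 'M[R]_(n + n + 1).
Implicit Types (O : set E) (f : E -> gl).

Lemma differentiable_trmx p q (f : E -> 'M[R]_(p, q)) z :
  differentiable f z -> differentiable (fun y => (f y)^T) z.
Proof.
move=> df; apply/differentiable_mxP => i j.
have -> : (fun y => (f y)^T i j) = (fun y => f y j i).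
  by apply/funext => y; rewrite mxE.
exact: (differentiable_mxP f z).1 df j i.
Qed.

Lemma derive_trmx p q (f : E -> 'M[R]_(p, q)) z v : differentiable f z ->
  'D_v (fun y => (f y)^T) z = ('D_v f z)^T.
Proof.
move=> df; apply/matrixP => i j.
have d1 := diff_derivable (v := v) (differentiable_trmx df).
have E1 := derive_mxE i j d1.
have E2 := derive_mxE j i (diff_derivable (v := v) df).
have E3 : (fun y => (f y)^T i j) = (fun y => f y j i).
  by apply/funext => y; rewrite mxE.
have E4 : ('D_v f z)^T i j = ('D_v f z) j i by move: ('D_v f z) => A; rewrite mxE.
apply: etrans E1 _; rewrite E3; apply: etrans (esym E2) (esym E4).
Qed.

Lemma derive_cst_mulmx p q r (A : 'M[R]_(p, q)) (f : E -> 'M[R]_(q, r)) z v :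
  differentiable f z -> 'D_v (fun y => A *m f y) z = A *m 'D_v f z.
Proof.
move=> df; have dc : differentiable (fun=> A : 'M[R]_(p, q)) z.
  exact: differentiable_cst.
have E1 := derive_mulmx v dc df.
have E2 : 'D_v (fun=> A : 'M[R]_(p, q)) z = 0 by exact: derive_cst.
apply: etrans E1 _; move: E2; move: ('D_v (fun=> A) z) => B ->.
by rewrite mul0mx add0r.
Qed.

(** [f] satisfies linear conditions with constant coefficients, so its
    derivatives do. *)
Lemma derive_unitary_algebra O f z v : open O -> O z -> differentiable f z ->
  (forall y, O y -> unitary_algebra (f y)) -> unitary_algebra ('D_v f z).
Proof.
move=> oO Oz df fu; apply/unitary_algebraP.
have eq1 (y : E) : O y -> (f y)^T = - f y by move=> /fu/unitary_algebraP[].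
have eq2 (y : E) : O y -> f y *m Jmx = Jmx *m f y.
  by move=> /fu/unitary_algebraP[].
have eq3 (y : E) : O y -> f y *m e0 = 0 by move=> /fu/unitary_algebraP[].
split.
- have E1 := open_eq_derive v oO Oz eq1.
  have E2 := deriveN (diff_derivable (v := v) df).
  exact: etrans (esym (derive_trmx v df)) (etrans E1 E2).
- have E1 := open_eq_derive v oO Oz eq2.
  exact: etrans (esym (derive_mulmx_cst Jmx v df))
    (etrans E1 (derive_cst_mulmx Jmx v df)).
- have E1 := open_eq_derive v oO Oz eq3.
  exact: etrans (esym (derive_mulmx_cst e0 v df)) (etrans E1 (derive_cst _ _ _)).
Qed.

(** The logarithmic derivative of a map into the structure group. *)
Lemma log_derive_unitary O f z v : open O -> O z -> differentiable f z ->
  (forall y, O y -> unitary_group (f y)) ->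
  unitary_algebra ('D_v f z *m (f z)^T).
Proof.
move=> oO Oz df fu; have [f1 f2 f3] := unitary_group_tr (fu z Oz).
have eq1 (y : E) : O y -> f y *m (f y)^T = 1%:M.
  by move=> /fu/unitary_group_tr[].
have eq2 (y : E) : O y -> f y *m Jmx = Jmx *m f y.
  by move=> /fu/unitary_groupP[].
have eq3 (y : E) : O y -> f y *m e0 = e0 by move=> /fu/unitary_groupP[].
have E1 : 'D_v f z *m (f z)^T + f z *m ('D_v f z)^T = 0.
  have D1 := open_eq_derive v oO Oz eq1.
  have D2 := derive_mulmx v df (differentiable_trmx df).
  have D3 := congr1 (fun A => 'D_v f z *m (f z)^T + f z *m A) (derive_trmx v df).
  have D4 : 'D_v (fun=> 1%:M : gl) z = 0 by exact: derive_cst.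
  exact: etrans (esym (etrans D2 D3)) (etrans D1 D4).
have E2 : 'D_v f z *m Jmx = Jmx *m 'D_v f z.
  have D1 := open_eq_derive v oO Oz eq2.
  exact: etrans (esym (derive_mulmx_cst Jmx v df))
    (etrans D1 (derive_cst_mulmx Jmx v df)).
have E3 : 'D_v f z *m e0 = 0.
  have D1 := open_eq_derive v oO Oz eq3.
  exact: etrans (esym (derive_mulmx_cst e0 v df)) (etrans D1 (derive_cst _ _ _)).
move: ('D_v f z) E1 E2 E3 => D E1 E2 E3; apply/unitary_algebraP; split.
- by apply/eqP; rewrite trmx_mul trmxK -addr_eq0 addrC E1.
- by rewrite -mulmxA f2 mulmxA E2 mulmxA.
- by rewrite -mulmxA f3 E3.
Qed.

End UnitaryDerivative.

Section Sections.
Context {R : realType} {n : nat} (M : manifold R (n + n + 1)).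
Local Notation V := 'cV[R]_(n + n + 1).
Local Notation gl := 'M[R]_(n + n + 1).
Variables (P : M -> set gl).
Hypothesis P_str : G_structure unitary_group P.
Implicit Types (x y : M) (U : set M) (s : M -> gl).

Lemma section_unit U s y : local_section P U s -> U y -> s y \in unitmx.
Proof. by case=> _ sP _ /sP; apply: (Gstr_frame P_str). Qed.

Lemma smooth_frame_mulr U s (g : gl) :
  smooth_frame U s -> smooth_frame U (fun y => s y *m g).
Proof.
move=> ss w; have := ss (g *m w); congr smooth_field.
by apply/funext => y; rewrite mulmxA.
Qed.

Lemma smooth_frame_sub U U' s : U' `<=` U -> smooth_frame U s -> smooth_frame U' s.
Proof. by move=> UU ss w; apply: smooth_field_sub (ss w). Qed.

(** Translating a section by a constant element of the structure group gives a
    section through any prescribed frame. *)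
Lemma section_through x (p : gl) : P x p ->
  exists U s, [/\ U x, local_section P U s & s x = p].
Proof.
move=> Pp; have [U [s [Ux [oU sP ss]]]] := Gstr_section P_str x.
have [g Ug pE] := (Gstr_orbit P_str p (sP x Ux)).1 Pp.
exists U, (fun y => s y *m g); split; [exact: Ux| |exact: esym pE].
split; first exact: oU.
- by move=> y Uy; apply/(Gstr_orbit P_str _ (sP y Uy)); exists g.
- exact: smooth_frame_mulr.
Qed.

Lemma Ad_inj (p A B : gl) : p \in unitmx -> Ad p A = Ad p B -> A = B.
Proof.
move=> up; rewrite /Ad => /(congr1 (mulmxr p)); rewrite /= !mulmxKV //.
by move=> /(congr1 (mulmx (invmx p))); rewrite !mulKmx.
Qed.

Section InnerTorsion.
Variable nabla : cov_deriv M.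
Hypothesis conn : affine_connection nabla.

(** Two sections differ by a map [g] into the structure group, and their
    connection matrices by conjugation and the logarithmic derivative of [g],
    which lies in the structure algebra. *)
Lemma inner_torsion_coset x U s (u : V) : U x -> local_section P U s ->
  inner_torsion unitary_algebra nabla P x (s x *m u) =
  Ad (s x) @` coset_mod unitary_algebra (Lam nabla s x (s x *m u)).
Proof.
move=> Ux sS; have [oU sP ss] := sS; have su y := section_unit (y := y) sS.
set A := Lam _ _ _ _; apply/seteqP; split => B; last first.
  move=> AB; exists U, s, u, A; split => // w.
  have := LamE conn (s x *m u) w oU Ux ss (su x Ux); exact.
case=> U' [s' [u' [A' [U'x s'S vE LA [B' /= AB' <-]]]]].
have [oU' s'P ss'] := s'S; have su' y := section_unit (y := y) s'S.
pose W := U `&` U'; have oW : open W by exact: openI.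
have Wx : W x by [].
have sW : smooth_frame W s by apply: smooth_frame_sub ss => y [].
have s'W : smooth_frame W s' by apply: smooth_frame_sub ss' => y [].
have uW y : W y -> s y \in unitmx by case=> /su.
pose g y := invmx (s y) *m s' y.
have gE y : W y -> s y *m g y = s' y.
  by move=> Wy; rewrite mulKVmx ?uW.
have gU y : W y -> unitary_group (g y).
  move=> Wy; have [Uy U'y] := Wy.
  have [k Uk kE] := (Gstr_orbit P_str (s' y) (sP y Uy)).1 (s'P y U'y).
  by rewrite /g kE mulKmx ?uW.
have sg (w : V) : smooth_map W (fun y => g y *m w).
  move=> c ac; apply: smooth_eq (smooth_coefs oW sW uW (s'W w) ac).
    exact: open_image_in.
  by move=> z _; rewrite /= mulmxA.
set c := chart_at x; have ac : atlas c by exact: chart_at_atlas.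
have oO := open_image_in c oW.
have Oz : image_in c W (chart_map c x).
  by apply: image_in_map => //; exact: mem_chart_at.
have sgc : smooth (image_in c W) (g \o chart_inv c).
  apply/(smooth_mxP _ oO) => i j.
  have := (smooth_mxP _ oO).1 (sg (delta_mx j 0) c ac) i 0.
  by apply: smooth_eq oO _ => z _; rewrite /= -colE mxE.
have dg := smooth_differentiable sgc Oz.
have gx : (g \o chart_inv c) (chart_map c x) = g x.
  by rewrite /= chart_mapK //; exact: mem_chart_at.
set v := s x *m u in vE A *.
set D := 'D_v (g \o chart_inv c) (chart_map c x).
have DU : unitary_algebra (D *m (g x)^T).
  rewrite -gx; apply: (log_derive_unitary v oO Oz dg) => z Iz.
  by apply: gU; case/image_inP: Iz.
have [ug Vg] := unitary_group_unit (gU x Wx).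
have A'E : g x *m A' = D + A *m g x.
  apply: mx_ext => w; have E1 := nabla_frame conn v oW Wx sW (uW x Wx) (sg w).
  have E2 : nabla x v (fun y => s y *m (g y *m w)) = s x *m (g x *m (A' *m w)).
    rewrite mulmxA gE // -LA -vE.
    apply: (conn_local conn v oW Wx); last by move=> y Wy; rewrite mulmxA gE.
    exact: smooth_field_frame oW sW (sg w).
  have E3 := derive_mulmx_cst w v dg.
  have E4 : mderiv x v (fun y => g y *m w) = D *m w by exact: E3.
  rewrite E4 E2 in E1; rewrite -mulmxA mulmxDl -mulmxA.
  by apply: (can_inj (mulKmx (uW x Wx))).
exists (g x *m B' *m (g x)^T) => /=.
  rewrite /coset_mod /=.
  have -> : g x *m B' *m (g x)^T - A = g x *m (B' - A') *m (g x)^T + D *m (g x)^T.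
    rewrite mulmxBr mulmxBl A'E mulmxDl -mulmxA.
    have [gg _ _] := unitary_group_tr (gU x Wx).
    rewrite -(mulmxA A) gg mulmx1 mulmxA opprD.
    by rewrite [- (D *m _) + _]addrC -addrA subrK.
  by apply: unitary_algebraD => //; apply: unitary_algebra_Ad AB'; exact: gU.
rewrite /Ad -(gE x Wx).
rewrite (invmxM (uW x Wx) ug) Vg !mulmxA //.
Qed.

(** The comparison of cosets after conjugation by a frame is a comparison of
    matrices modulo the structure algebra. *)
Lemma Lam_coset I0 x U s u : U x -> local_section P U s ->
  inner_torsion unitary_algebra nabla P x (s x *m u) =
    Ad (s x) @` coset_mod unitary_algebra I0 ->
  unitary_algebra (Lam nabla s x (s x *m u) - I0).
Proof.
move=> Ux sS; rewrite (inner_torsion_coset u Ux sS) => /seteqP[/(_ (Ad (s x)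
  (Lam nabla s x (s x *m u)))) + _].
case; first by exists (Lam nabla s x (s x *m u)) => //; rewrite /coset_mod /= subrr;
  exact: unitary_algebra0.
by move=> B BI /(Ad_inj (section_unit sS Ux)) <-.
Qed.

End InnerTorsion.
End Sections.

(** * Structure equations of a homogeneous structure *)

Section LinearDerivative.
Context {R : realType} {E : normedModType R} {m p q : nat}.
Variable phi : 'cV[R]_m -> 'M[R]_(p, q).
Hypothesis phi_linear :
  forall (a : R) u v, phi (a *: u + v) = a *: phi u + phi v.

Let A (w : 'cV[R]_q) : 'M[R]_(p, m) := lmx (fun u => phi u *m w).

Let AE u w : phi u *m w = A w *m u.
Proof.
by rewrite -lmxE // => a u1 u2; rewrite phi_linear mulmxDl -scalemxAl.
Qed.

Lemma differentiable_linmap (f : E -> 'cV[R]_m) z : differentiable f z ->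
  differentiable (fun y => phi (f y)) z.
Proof.
move=> df; apply/differentiable_mxP => i j.
have -> : (fun y => phi (f y) i j) = (fun y => (A (delta_mx j 0) *m f y) i 0).
  by apply/funext => y; rewrite -AE -colE mxE.
have dc : differentiable (fun=> A (delta_mx j 0)) z by exact: differentiable_cst.
exact: (differentiable_mxP _ z).1 (differentiable_mulmx dc df) i 0.
Qed.

Lemma derive_linmap (f : E -> 'cV[R]_m) z v : differentiable f z ->
  'D_v (fun y => phi (f y)) z = phi ('D_v f z).
Proof.
move=> df; apply: mx_ext => w.
have E1 := derive_mulmx_cst w v (differentiable_linmap df).
have E2 := derive_cst_mulmx (A w) v df.
have E3 : (fun y => phi (f y) *m w) = (fun y => A w *m f y).
  by apply/funext => y; rewrite AE.
apply: etrans (esym E1) _; rewrite E3; apply: etrans E2 (esym (AE _ _)).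
Qed.

Lemma smooth_linmap (O : set E) (f : E -> 'cV[R]_m) : open O -> smooth O f ->
  smooth O (fun y => phi (f y)).
Proof.
move=> oO sf; apply/(smooth_mxP _ oO) => i j.
have sA := smooth_mulmx oO (smooth_cst O (A (delta_mx j 0))) sf.
apply: smooth_eq oO _ ((smooth_mxP _ oO).1 sA i 0) => y _.
by rewrite -AE -colE mxE.
Qed.

End LinearDerivative.

Section SmoothLocal.
Context {R : realType}.

(** Derivatives are taken at single points, so regularity is a local condition. *)
Lemma Ck_local (E F : normedModType R) k (U : set E) (f : E -> F) :
  (forall x, U x -> exists2 W, W x & Ck k W f) -> Ck k U f.
Proof.
elim: k f => [|k IH] f Uf.
  by move=> x Ux; have [W Wx fW] := Uf x Ux; exact: fW x Wx.
split=> [x Ux|v]; first by have [W Wx [fW _]] := Uf x Ux; exact: fW.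
by apply: IH => x Ux; have [W Wx [_ fW]] := Uf x Ux; exists W => //; exact: fW.
Qed.

Lemma smooth_field_local N (M : manifold R N) (U : set M) (X : vfield M) :
  (forall x, U x -> exists2 W, W x & smooth_field W X) -> smooth_field U X.
Proof.
move=> Uf c ac k; apply: Ck_local => z /image_inP[dz Uz zE].
have [W Wz sW] := Uf _ Uz; exists (image_in c W); last exact: sW.
by apply/image_inP.
Qed.

End SmoothLocal.

Lemma mx_ext_delta (R : realType) p q (A B : 'M[R]_(p, q)) :
  (forall j, A *m delta_mx j (0 : 'I_1) = B *m delta_mx j 0) -> A = B.
Proof.
move=> AB; apply/matrixP => i j.
by have /colP/(_ i) := AB j; rewrite -!colE !mxE.
Qed.

Lemma Lam_col (R : realType) N (M : manifold R N) (nabla : cov_deriv M) s x v j :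
  Lam nabla s x v *m delta_mx j (0 : 'I_1)
    = invmx (s x) *m nabla x v (fun y => s y *m delta_mx j 0).
Proof. exact: lmx_col. Qed.

(** The first Bianchi identity of a symmetric connection. *)
Lemma first_bianchi (R : realType) N (M : manifold R N) (nabla : cov_deriv M) x
    (u v w : 'cV[R]_N) : affine_connection nabla ->
  (forall y u v, torsion_at nabla y u v = 0) ->
  curvature_at nabla x u v w + curvature_at nabla x v w u
    + curvature_at nabla x w u v = 0.
Proof.
move=> conn T0; pose N2 a b y := nabla y (extend x a y) (extend x b).
have dx := mem_chart_at x; have oW := chart_dom_open (chart_at x).
have sN a b : smooth_field (chart_dom (chart_at x)) (N2 a b).
  by apply: (conn_smooth conn oW); exact: smooth_extend.
have NC a b c : nabla x c (N2 a b) = nabla x c (N2 b a).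
  apply: (conn_local conn c oW dx (sN a b)) => y dy.
  by apply/eqP; rewrite -subr_eq0 /N2 torsion_extend // T0.
have cE a b c : curvature_at nabla x a b c = nabla x a (N2 b c) - nabla x b (N2 a c).
  rewrite /curvature_at /curvature lie_bracket_extend.
  by rewrite (nabla_dir0 conn oW dx (smooth_extend x c)) subr0 !extend_id.
rewrite !cE (NC u v) (NC v w) (NC w u).
move: (nabla x u _) (nabla x v _) (nabla x w _) => a1 a2 a3.
by apply/colP => i; rewrite !mxE; ring.
Qed.

Section Homogeneous.
Context {R : realType} {n : nat} (M : manifold R (n + n + 1)).
Local Notation V := 'cV[R]_(n + n + 1).
Local Notation gl := 'M[R]_(n + n + 1).
Variables (nabla : cov_deriv M) (P : M -> set gl).
Hypotheses (conn : affine_connection nabla) (P_str : G_structure unitary_group P).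
Variables (t1 t2 t3 a b al be ga de : R).
Local Notation T := (@tor R n t1 t2 t3).
Local Notation TM := (@tormx R n t1 t2 t3).
Local Notation la := (@lam R n a b al be ga de).
Hypothesis torE : forall x p, P x p -> forall u v : V,
  torsion_at nabla x (p *m u) (p *m v) = p *m T u v.
Hypothesis innE : forall x p, P x p -> forall u : V,
  inner_torsion unitary_algebra nabla P x (p *m u)
    = Ad p @` coset_mod unitary_algebra (la u).

(** The e-component of the first structure equation: [A] and [B] may be replaced
    with [lam], as the structure algebra has no e-component.  The symmetric terms
    of the e-component of [lam] cancel. *)
Lemma vertical_structure1 (p q c d : V) (A B : gl) :
  (p + A *m d) - (q + B *m c) = T c d ->
  unitary_algebra (A - la c) -> unitary_algebra (B - la d) ->
  ec p - ec q = (t3 - 2 * de) * om c d.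
Proof.
move=> S1 I1 I2.
have eA w : ec (A *m w) = ec (la c *m w).
  by rewrite -[A](subrK (la c)) mulmxDl ecD skew_ec // add0r.
have eB w : ec (B *m w) = ec (la d *m w).
  by rewrite -[B](subrK (la d)) mulmxDl ecD skew_ec // add0r.
have := congr1 ec S1; rewrite ec_tor ecD ecN !ecD eA eB !ec_lam.
rewrite (omC d c) (dotC d c) => E1.
have -> : ec p = ec p + (ga * (dot c d - ec c * ec d) + de * om c d
    + b * (ec c * ec d)) - (ec q + (ga * (dot c d - ec d * ec c) + de * - om c d
    + b * (ec d * ec c))) - 2 * de * om c d + ec q by ring.
by rewrite E1; ring.
Qed.

Section Frame.
Variables (x : M) (U : set M) (s : M -> gl).
Hypotheses (Ux : U x) (sS : local_section P U s).

Let oU : open U. Proof. by case: sS. Qed.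
Let sP y : U y -> P y (s y). Proof. by case: sS => _ + _; apply. Qed.
Let ss : smooth_frame U s. Proof. by case: sS. Qed.
Let su y : U y -> s y \in unitmx.
Proof. by move=> Uy; have := section_unit P_str sS Uy; exact. Qed.

Local Notation pt z := (chart_inv (chart_at x) z).
Local Notation O := (frame_dom x U).
Local Notation F := (coframe x s).
Local Notation L := (conn_form nabla x s).

Lemma pt_in z : O z -> U (pt z). Proof. by case/image_inP. Qed.

Lemma frame_structure1 z u v : O z ->
  ('D_u F z *m v + L u z *m (F z *m v)) - ('D_v F z *m u + L v z *m (F z *m u))
  = T (F z *m u) (F z *m v).
Proof.
move=> Oz; have Uz := pt_in Oz.
have E1 := structure1 conn oU ss su u v Oz.
have E2 := torE (sP Uz) (F z *m u) (F z *m v).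
exact: can_inj (mulKmx (su Uz)) _ _ (etrans E1 E2).
Qed.

Lemma frame_inner z u : O z -> unitary_algebra (L u z - la (F z *m u)).
Proof.
move=> Oz; have Uz := pt_in Oz; rewrite (conn_formE nabla su u Oz).
apply: (Lam_coset P_str conn Uz sS); exact: innE (sP Uz) _.
Qed.

Let Oz := mem_chart_pt Ux : O (chart_pt x).

Lemma derive_ec (f : V -> V) z u : differentiable f z ->
  'D_u (fun y => ec (f y)) z = ec ('D_u f z).
Proof.
move=> df; have E1 := derive_cst_mulmx ((@e0 R n)^T) u df.
have dc : differentiable (fun=> (@e0 R n)^T) z by exact: differentiable_cst.
have d1 := diff_derivable (v := u) (differentiable_mulmx dc df).
have E2 := derive_mxE 0 0 d1.
exact: etrans (esym E2) (congr1 (fun A : 'M[R]_1 => A 0 0) E1).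
Qed.

Let dF : differentiable F (chart_pt x).
Proof. exact: smooth_differentiable (smooth_coframe x oU ss su) Oz. Qed.

Let dL v : differentiable (L v) (chart_pt x).
Proof. exact: smooth_differentiable (smooth_conn_form conn x oU ss su v) Oz. Qed.

Lemma derive_shift (phi : V -> gl) :
  (forall (c : R) u v, phi (c *: u + v) = c *: phi u + phi v) -> forall u v,
  'D_u (fun z => L v z - phi (F z *m v)) (chart_pt x)
    = 'D_u (L v) (chart_pt x) - phi ('D_u F (chart_pt x) *m v).
Proof.
move=> lphi u v; have dw : differentiable (fun=> v) (chart_pt x).
  exact: differentiable_cst.
have d1 := differentiable_mulmx dF dw.
have d2 := differentiable_linmap lphi d1.
have E1 := deriveB (diff_derivable (v := u) (dL v)) (diff_derivable (v := u) d2).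
have E2 := derive_linmap lphi u d1.
have E3 := congr1 phi (derive_mulmx_cst v u dF).
exact: etrans E1 (congr1 (fun A => 'D_u (L v) (chart_pt x) - A) (etrans E2 E3)).
Qed.

Lemma differentiable_shift (phi : V -> gl) :
  (forall (c : R) u v, phi (c *: u + v) = c *: phi u + phi v) -> forall v,
  differentiable (fun z => L v z - phi (F z *m v)) (chart_pt x).
Proof.
move=> lphi v; have dw : differentiable (fun=> v) (chart_pt x).
  exact: differentiable_cst.
exact: differentiableB (dL v) (differentiable_linmap lphi (differentiable_mulmx dF dw)).
Qed.

(** The u(n)-part of the connection matrices takes values in a linear subspace,
    and so do its derivatives. *)
Lemma derive_frame_inner u v :
  unitary_algebra ('D_u (L v) (chart_pt x) - la ('D_u F (chart_pt x) *m v)).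
Proof.
have lla := @lam_linear R n a b al be ga de.
have E1 := derive_unitary_algebra u (open_frame_dom (x := x) oU) Oz
  (differentiable_shift lla v) (fun z Iz => frame_inner v Iz).
by rewrite -(derive_shift lla u v).
Qed.

Section ContactForm.
Variables (xi : vfield M) (h : M -> V -> V -> R) (J : M -> V -> V).
Variables (eta : M -> V -> R) (omega : M -> V -> V -> R).
Hypothesis geo : geometric_data P xi h J eta omega.

Lemma eta_frame y (p : gl) (w : V) : P y p -> eta y (p *m w) = ec w.
Proof.
move=> Pp; rewrite [in LHS](hor_e0 w) mulmxDr -scalemxAr -(geo_xi geo Pp).
rewrite addrC (geo_eta_linear geo) (geo_eta_xi geo) mulr1.
rewrite (geo_eta_hor geo) ?addr0 //.
by exists p, (usubmx w).
Qed.

(** In a frame, [eta] is the vertical component of the coframe, so the first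
    structure equation computes its exterior derivative. *)
Lemma ext_deriv_frame u v : ext_deriv_at eta x u v =
  (t3 - 2 * de) * om (invmx (s x) *m u) (invmx (s x) *m v).
Proof.
have D w w' : dir_deriv x w (fun y => eta y (extend x w' y))
    = ec ('D_w F (chart_pt x) *m w').
  have E1 z : O z -> ((fun y => eta y (extend x w' y)) \o
      chart_inv (chart_at x)) z = ec (F z *m w').
    by move=> Oz'; rewrite /= (extend_coframe su) // eta_frame //; apply/sP/pt_in.
  have dw : differentiable (fun=> w') (chart_pt x) by exact: differentiable_cst.
  have E2 := derive_ec w (differentiable_mulmx dF dw).
  have E3 := derive_mulmx_cst w' w dF.
  have E4 := open_eq_derive w (open_frame_dom (x := x) oU) Oz E1.
  have E5 := etrans E4 (etrans E2 (congr1 ec E3)).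
  exact: E5.
have eta0 : eta x 0 = 0.
  by have := eta_frame 0 (sP Ux); rewrite mulmx0 /ec dot0r.
rewrite /ext_deriv_at /ext_deriv lie_bracket_extend eta0 subr0 !extend_id !D.
have S1 := frame_structure1 u v Oz.
have I1 := frame_inner u Oz; have I2 := frame_inner v Oz.
by rewrite -(coframe_pt x s); exact: vertical_structure1 S1 I1 I2.
Qed.

End ContactForm.

Section Symmetrized.
Local Notation nablas := (symmetrized nabla).
Hypothesis conns : affine_connection nablas.
Local Notation Ls := (conn_form nablas x s).

Lemma Lam_symmetrized y u : U y ->
  Lam nablas s y (s y *m u) = Lam nabla s y (s y *m u) - 2^-1 *: TM u.
Proof.
move=> Uy; apply: mx_ext_delta => j; rewrite mulmxBl !Lam_col /symmetrized.
rewrite (torE (sP Uy)) mulmxBr -scalemxAr mulKmx ?su //.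
by rewrite -scalemxAl tormxE.
Qed.

Lemma conn_form_symmetrized z u : O z -> Ls u z = L u z - 2^-1 *: TM (F z *m u).
Proof.
move=> Oz'; rewrite (conn_formE nabla su u Oz') (conn_formE nablas su u Oz').
exact/Lam_symmetrized/pt_in.
Qed.

End Symmetrized.
End Frame.
End Homogeneous.

(** * The symmetrized connection *)

Section CurvatureModulo.
Context {R : realType} {n : nat}.
Local Notation V := 'cV[R]_(n + n + 1).
Local Notation gl := 'M[R]_(n + n + 1).
Variables (t1 t2 t3 a b al be ga de : R).
Local Notation T := (@tor R n t1 t2 t3).
Local Notation TM := (@tormx R n t1 t2 t3).
Local Notation la := (@lam R n a b al be ga de).

Section LinearMap.
Variable phi : V -> gl.
Hypothesis lphi : forall (c : R) u v, phi (c *: u + v) = c *: phi u + phi v.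

Let phiD u v : phi (u + v) = phi u + phi v.
Proof. by have := lphi 1 u v; rewrite !scale1r. Qed.

Lemma linmapB u v : phi (u - v) = phi u - phi v.
Proof.
by have := lphi (-1) v u; rewrite !scaleN1r addrC => ->; rewrite addrC.
Qed.

(** A linear map applied to the first structure equation expresses its values on
    the differential of the coframe by algebraic terms. *)
Lemma linmap_structure (p q t x y x' y' : V) : (p + (x + y)) - (q + (x' + y')) = t ->
  phi p - phi q = phi t - (phi x + phi y) + (phi x' + phi y').
Proof.
move=> <-; rewrite (linmapB (p + (x + y))) !phiD.
move: (phi p) (phi q) (phi x) (phi y) (phi x') (phi y') => a1 a2 a3 a4 a5 a6.
by apply/matrixP => i j; rewrite !mxE; ring.
Qed.

End LinearMap.

Let lla := @lam_linear R n a b al be ga de.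
Let lTM := @tormx_linear R n t1 t2 t3.

Let mod_alg (LC LD G K dA dB LP LQ lT lcd ldc lGd lKc : gl) :
  G *m LD - LD *m G = lGd -> K *m LC - LC *m K = lKc ->
  LP - LQ = lT - (lcd + lGd) + (ldc + lKc) ->
  (dB - dA + ((LC + G) *m (LD + K) - (LD + K) *m (LC + G)))
    - (LC *m LD - LD *m LC - (lcd - ldc - lT))
  = (dB - LP) - (dA - LQ) + (G *m K - K *m G).
Proof.
move=> <- <- e3; have -> : LP = LP - LQ + LQ by rewrite subrK.
rewrite e3 !mulmxDl !mulmxDr.
move: (LC *m LD) (LD *m LC) (G *m LD) (LD *m G) (K *m LC) (LC *m K) (G *m K)
  (K *m G) => x1 x2 x3 x4 x5 x6 x7 x8.
by apply/matrixP => i j; rewrite !mxE; ring.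
Qed.

(** The value of the curvature in a frame where the connection matrices along
    [c] and [d] are [A] and [B] and have the derivatives [dA] and [dB]; the
    coframe satisfies the first structure equation.  The terms that mix [lam]
    with the structure algebra cancel because [lam] is equivariant. *)
Lemma curvature_split (p q c d : V) (A B dA dB : gl) :
  (p + A *m d) - (q + B *m c) = T c d ->
  unitary_algebra (A - la c) -> unitary_algebra (B - la d) ->
  (dB - dA + (A *m B - B *m A))
    - (la c *m la d - la d *m la c - la (la c *m d - la d *m c - T c d))
  = (dB - la p) - (dA - la q)
    + ((A - la c) *m (B - la d) - (B - la d) *m (A - la c)).
Proof.
move=> S1 IA IB.
have [G AE] : exists G, A = la c + G by exists (A - la c); rewrite addrC subrK.
have [K BE] : exists K, B = la d + K by exists (B - la d); rewrite addrC subrK.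
have GE : A - la c = G by rewrite AE addrAC subrr add0r.
have KE : B - la d = K by rewrite BE addrAC subrr add0r.
rewrite GE in IA *; rewrite KE in IB *; rewrite {GE KE}AE {}BE in S1 *.
have e1 : G *m la d - la d *m G = la (G *m d) := lam_skew _ _ _ _ _ _ d IA.
have e2 : K *m la c - la c *m K = la (K *m c) := lam_skew _ _ _ _ _ _ c IB.
rewrite (mulmxDl (la c)) (mulmxDl (la d)) in S1.
have e3 := linmap_structure lla S1.
have e4 : la (la c *m d - la d *m c - T c d) =
    la (la c *m d) - la (la d *m c) - la (T c d).
  exact: etrans (linmapB lla _ _) (congr1 (fun X => X - _) (linmapB lla _ _)).
by rewrite e4 (mod_alg dA dB e1 e2 e3).
Qed.

Lemma curvature_mod (p q c d : V) (A B dA dB : gl) :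
  (p + A *m d) - (q + B *m c) = T c d ->
  unitary_algebra (A - la c) -> unitary_algebra (B - la d) ->
  unitary_algebra (dB - la p) -> unitary_algebra (dA - la q) ->
  unitary_algebra ((dB - dA + (A *m B - B *m A))
    - (la c *m la d - la d *m la c - la (la c *m d - la d *m c - T c d))).
Proof.
move=> S1 IA IB IdB IdA; rewrite (curvature_split dA dB S1 IA IB).
apply: unitary_algebraD; first exact: unitary_algebraB.
exact: unitary_algebra_bracket.
Qed.

(** The effect on the curvature of subtracting half the torsion, which is
    invariant under the structure algebra. *)
Definition Rsym (R0 : V -> V -> gl) (c d : V) : gl :=
  R0 c d - 2^-1 *: TM (T c d - (la c *m d - la d *m c))
  - 2^-1 *: (la c *m TM d - TM d *m la c)
  + 2^-1 *: (la d *m TM c - TM c *m la d)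
  + 4^-1 *: (TM c *m TM d - TM d *m TM c).

Lemma tormx_skew (B : gl) u : unitary_algebra B ->
  B *m TM u - TM u *m B = TM (B *m u).
Proof.
move=> Bg; apply: mx_ext => w; rewrite mulmxBl -!mulmxA !tormxE tor_skew //.
by rewrite addrK.
Qed.

Let sym_alg (LC LD G K SC SD dA dB SP SQ sT scd sdc sGd sKc : gl) :
  G *m SD - SD *m G = sGd -> K *m SC - SC *m K = sKc ->
  SP - SQ = sT - (scd + sGd) + (sdc + sKc) ->
  (dB - 2^-1 *: SP) - (dA - 2^-1 *: SQ)
    + ((LC + G - 2^-1 *: SC) *m (LD + K - 2^-1 *: SD)
       - (LD + K - 2^-1 *: SD) *m (LC + G - 2^-1 *: SC))
  = (dB - dA + ((LC + G) *m (LD + K) - (LD + K) *m (LC + G)))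
    - 2^-1 *: (sT - (scd - sdc)) - 2^-1 *: (LC *m SD - SD *m LC)
    + 2^-1 *: (LD *m SC - SC *m LD) + 4^-1 *: (SC *m SD - SD *m SC).
Proof.
move=> <- <- e3; have -> : SP = SP - SQ + SQ by rewrite subrK.
rewrite e3 !(mulmxDl, mulNmx) !(mulmxDr, mulmxN) -!scalemxAl -!scalemxAr.
move: (LC *m LD) (LD *m LC) (G *m LD) (LD *m G) (K *m LC) (LC *m K) (G *m K)
  (K *m G) (LC *m SD) (SD *m LC) (G *m SD) (SD *m G) (LD *m SC) (SC *m LD)
  (K *m SC) (SC *m K) (SC *m SD) (SD *m SC)
  => x1 x2 x3 x4 x5 x6 x7 x8 y1 y2 y3 y4 y5 y6 y7 y8 z1 z2.
by apply/matrixP => i j; rewrite !mxE; field.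
Qed.

(** [lam] contributes the terms of [Rsym]; the u(n)-parts of the connection
    matrices drop out, as the torsion is invariant under them. *)
Lemma Rsym_frame (p q c d : V) (A B dA dB : gl) :
  (p + A *m d) - (q + B *m c) = T c d ->
  unitary_algebra (A - la c) -> unitary_algebra (B - la d) ->
  let As := A - 2^-1 *: TM c in let Bs := B - 2^-1 *: TM d in
  (dB - 2^-1 *: TM p) - (dA - 2^-1 *: TM q) + (As *m Bs - Bs *m As) =
  Rsym (fun _ _ => dB - dA + (A *m B - B *m A)) c d.
Proof.
move=> S1 IA IB /=.
have [G AE] : exists G, A = la c + G by exists (A - la c); rewrite addrC subrK.
have [K BE] : exists K, B = la d + K by exists (B - la d); rewrite addrC subrK.
rewrite {}AE addrAC subrr add0r in IA S1 *.
rewrite {}BE addrAC subrr add0r in IB S1 *.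
rewrite (mulmxDl (la c)) (mulmxDl (la d)) in S1.
have e3 := linmap_structure lTM S1.
have e4 : TM (T c d - (la c *m d - la d *m c)) =
    TM (T c d) - (TM (la c *m d) - TM (la d *m c)).
  exact: etrans (linmapB lTM _ _) (congr1 (fun X => _ - X) (linmapB lTM _ _)).
rewrite /Rsym e4; exact: sym_alg (tormx_skew d IA) (tormx_skew c IB) e3.
Qed.

Definition lams : V -> gl :=
  lam (a + t1 / 2) b (al - t1 / 2) (be - t2 / 2) ga (de - t3 / 2).

(** The difference consists of the multiple of [J] along [e] that the torsion
    contributes, which lies in u(n). *)
Lemma lams_sym u : unitary_algebra (la u - 2^-1 *: TM u - lams u).
Proof.
have -> : la u - 2^-1 *: TM u - lams u = (t2 / 2 * ec u) *: Jmx.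
  apply: mx_ext => w; rewrite !mulmxBl -!scalemxAl tormxE !lamE /lamf /tor.
  move: (prj u) (prj w) (Jmx *m u) (Jmx *m w) => p q x y.
  by apply/colP => i; rewrite !mxE; field.
exact: unitary_algebraZ unitary_algebra_J.
Qed.

End CurvatureModulo.

Section SymmetrizedConnection.
Context {R : realType} {n : nat} (M : manifold R (n + n + 1)).
Local Notation V := 'cV[R]_(n + n + 1).
Local Notation gl := 'M[R]_(n + n + 1).
Variables (nabla : cov_deriv M) (P : M -> set gl).
Hypotheses (conn : affine_connection nabla) (P_str : G_structure unitary_group P).
Variables (t1 t2 t3 a b al be ga de : R).
Local Notation T := (@tor R n t1 t2 t3).
Local Notation TM := (@tormx R n t1 t2 t3).
Local Notation la := (@lam R n a b al be ga de).
Local Notation las := (@lams R n t1 t2 t3 a b al be ga de).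
Hypothesis torE : forall x p, P x p -> forall u v : V,
  torsion_at nabla x (p *m u) (p *m v) = p *m T u v.
Hypothesis innE : forall x p, P x p -> forall u : V,
  inner_torsion unitary_algebra nabla P x (p *m u)
    = Ad p @` coset_mod unitary_algebra (la u).
Local Notation nablas := (symmetrized nabla).

Let torE' x p u v : P x p ->
  torsion_at nabla x u v = p *m T (invmx p *m u) (invmx p *m v).
Proof.
by move=> Pp; rewrite -(torE Pp) !mulKVmx // (Gstr_frame P_str Pp).
Qed.

Let frame_at x : exists p, P x p.
Proof.
by have [U [s [Ux [_ sP _]]]] := Gstr_section P_str x; exists (s x); exact: sP.
Qed.

Lemma symmetrized_connection : affine_connection nablas.
Proof.
split.
- move=> x U Y oU Ux sY c v w; have [p Pp] := frame_at x.
  rewrite /symmetrized (conn_linear conn oU Ux sY) !(torE' _ _ Pp).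
  have -> : p *m T (invmx p *m (c *: v + w)) (invmx p *m Y x) =
      c *: (p *m T (invmx p *m v) (invmx p *m Y x))
      + p *m T (invmx p *m w) (invmx p *m Y x).
    by rewrite (mulmxDr (invmx p)) -scalemxAr tor_linearl mulmxDr scalemxAr.
  move: (p *m _) (p *m _) => A B; by apply/colP => i; rewrite !mxE; ring.
- move=> x U Y Z v oU Ux sY sZ; have [p Pp] := frame_at x.
  rewrite /symmetrized (conn_additive conn v oU Ux sY sZ) !(torE' _ _ Pp).
  have -> : p *m T (invmx p *m v) (invmx p *m (Y x + Z x)) =
      p *m T (invmx p *m v) (invmx p *m Y x)
      + p *m T (invmx p *m v) (invmx p *m Z x).
    have := tor_linearr t1 t2 t3 1 (invmx p *m Y x) (invmx p *m Z x) (invmx p *m v).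
    by rewrite !scale1r -(mulmxDr (invmx p)) -(mulmxDr p) => ->.
  move: (p *m _) (p *m _) => A B; by apply/colP => i; rewrite !mxE; ring.
- move=> x U f Y v oU Ux sf sY; have [p Pp] := frame_at x.
  rewrite /symmetrized (conn_Leibniz conn v oU Ux sf sY) !(torE' _ _ Pp).
  have -> : T (invmx p *m v) (invmx p *m (f x *: Y x)) =
      f x *: T (invmx p *m v) (invmx p *m Y x).
    rewrite -[f x *: Y x]addr0 mulmxDr mulmx0 -scalemxAr tor_linearr.
    suff -> : T (invmx p *m v) 0 = 0 by rewrite addr0.
    have := tor_linearr t1 t2 t3 (-1) 0 0 (invmx p *m v).
    by rewrite scaler0 addr0 scaleN1r addNr.
  rewrite -scalemxAr; move: (p *m _) => A.
  by apply/colP => i; rewrite !mxE; ring.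
- move=> x U Y Z v oU Ux sY YZ.
  by rewrite /symmetrized (conn_local conn v oU Ux sY YZ) YZ.
- move=> U X Y oU sX sY; apply: smooth_field_local => x Ux.
  have [U' [s [U'x sS]]] := Gstr_section P_str x; have [oU' sP ss] := sS.
  pose W := U `&` U'; have oW : open W by exact: openI.
  exists W => //.
  have sW : smooth_frame W s by apply: smooth_frame_sub ss => y [].
  have uW y : W y -> s y \in unitmx.
    by case=> _ U'y; have := section_unit P_str sS U'y; exact.
  have XW : smooth_field W X by apply: smooth_field_sub sX => y [].
  have YW : smooth_field W Y by apply: smooth_field_sub sY => y [].
  have sN := conn_smooth conn oW XW YW.
  have sf := smooth_coefs oW sW uW XW; have sg := smooth_coefs oW sW uW YW.
  pose t y := TM (invmx (s y) *m X y) *m (invmx (s y) *m Y y).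
  have st : smooth_map W t.
    move=> c ac; have oI := open_image_in c oW.
    apply: (smooth_mulmx oI _ (sg c ac)).
    have := smooth_linmap (@tormx_linear R n t1 t2 t3) oI (sf c ac).
    exact.
  have s1 := smooth_fieldZ oW (smooth_function_cst W (- 2^-1))
    (smooth_field_frame oW sW st).
  apply: smooth_field_eq oW _ (smooth_fieldD oW sN s1) => y Wy.
  have Py : P y (s y) by apply: sP; case: Wy.
  by rewrite /symmetrized (torE' _ _ Py) /t tormxE scaleNr.
Qed.

(** The torsion tensor is skew, so that half of it counts twice. *)
Lemma symmetrized_torsion x u v : torsion_at nablas x u v = 0.
Proof.
have [p Pp] := frame_at x.
have E1 := torsion_atE nabla x u v.
rewrite torsion_atE /symmetrized !extend_id.
rewrite [torsion_at nabla x v u](torE' v u Pp) tor_anti mulmxN -(torE' u v Pp).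
rewrite E1; move: (nabla x u _) (nabla x v _) => A B.
by apply/colP => i; rewrite !mxE; field.
Qed.

Lemma symmetrized_inner x (p : gl) (u : V) : P x p ->
  inner_torsion unitary_algebra nablas P x (p *m u)
    = Ad p @` coset_mod unitary_algebra (las u).
Proof.
move=> Pp; have [U [s [Ux sS sx]]] := section_through P_str Pp.
rewrite -sx (inner_torsion_coset P_str symmetrized_connection u Ux sS).
congr (_ @` _); apply: coset_mod_eq.
rewrite (Lam_symmetrized P_str torE sS u Ux).
have Ps : P x (s x) by case: sS => _ + _; apply.
have I1 := Lam_coset P_str conn Ux sS (innE Ps u).
have aux (A l t r : gl) : A - t - r = (A - l) + (l - t - r).
  by apply/matrixP => i j; rewrite !mxE; ring.
rewrite (aux _ (la u)).
exact: unitary_algebraD I1 (lams_sym _ _ _ _ _ _ _ _ _ _).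
Qed.

Variable R0 : V -> V -> gl.
Hypothesis curE : forall x p, P x p -> forall u v w : V,
  curvature_at nabla x (p *m u) (p *m v) (p *m w) = p *m (R0 u v *m w).

Section AtFrame.
Variables (x : M) (U : set M) (s : M -> gl).
Hypotheses (Ux : U x) (sS : local_section P U s).
Local Notation L := (conn_form nabla x s).
Local Notation F := (coframe x s).

Let oU : open U. Proof. by case: sS. Qed.
Let Ps : P x (s x). Proof. by case: sS => _ + _; apply. Qed.
Let ss : smooth_frame U s. Proof. by case: sS. Qed.
Let su y : U y -> s y \in unitmx.
Proof. by move=> Uy; have := section_unit P_str sS Uy; exact. Qed.
Let Oz := mem_chart_pt Ux : frame_dom x U (chart_pt x).
Let Fu (u : V) : F (chart_pt x) *m (s x *m u) = u.
Proof. by rewrite coframe_pt mulKmx // su. Qed.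

Lemma curvature_frame u v : R0 u v =
  'D_(s x *m u) (L (s x *m v)) (chart_pt x) - 'D_(s x *m v) (L (s x *m u)) (chart_pt x)
  + (L (s x *m u) (chart_pt x) *m L (s x *m v) (chart_pt x)
     - L (s x *m v) (chart_pt x) *m L (s x *m u) (chart_pt x)).
Proof.
apply: mx_ext => w.
have E1 := structure2 conn oU Ux ss su (s x *m u) (s x *m v) (s x *m w).
rewrite (mulKmx (su Ux)) in E1.
exact: can_inj (mulKmx (su Ux)) _ _ (etrans (esym (curE Ps u v w)) E1).
Qed.

Let S1 u v := frame_structure1 conn P_str torE sS (s x *m u) (s x *m v) Oz.
Let I1 u := frame_inner conn P_str innE sS (s x *m u) Oz.

Lemma frame_curvature_mod u v : unitary_algebra (R0 u v -
  (la u *m la v - la v *m la u - la (la u *m v - la v *m u - T u v))).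
Proof.
rewrite curvature_frame.
have E1 := S1 u v; have J1 := I1 u; have J2 := I1 v.
rewrite !Fu in E1 J1 J2.
have D1 := derive_frame_inner conn P_str innE Ux sS (s x *m u) (s x *m v).
have D2 := derive_frame_inner conn P_str innE Ux sS (s x *m v) (s x *m u).
exact: curvature_mod E1 J1 J2 D1 D2.
Qed.

Lemma frame_symmetrized_curvature u v w :
  curvature_at nablas x (s x *m u) (s x *m v) (s x *m w)
    = s x *m (Rsym t1 t2 t3 a b al be ga de R0 u v *m w).
Proof.
rewrite (structure2 symmetrized_connection oU Ux ss su) (mulKmx (su Ux)).
have E1 := S1 u v; have J1 := I1 u; have J2 := I1 v.
rewrite !Fu in E1 J1 J2.
have lphi (c : R) w1 w2 : 2^-1 *: TM (c *: w1 + w2) =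
    c *: (2^-1 *: TM w1) + 2^-1 *: TM w2.
  by rewrite tormx_linear scalerDr !scalerA mulrC.
have LE u' z : frame_dom x U z ->
    conn_form nablas x s u' z = L u' z - 2^-1 *: TM (F z *m u').
  by move=> Oz'; have := conn_form_symmetrized P_str torE sS u' Oz'; exact.
have DE u' v' : 'D_u' (conn_form nablas x s v') (chart_pt x) =
    'D_u' (L v') (chart_pt x) - 2^-1 *: TM ('D_u' F (chart_pt x) *m v').
  have G1 := open_eq_derive u' (open_frame_dom (x := x) oU) Oz (LE v').
  have G2 := derive_shift conn P_str Ux sS (phi := fun w => 2^-1 *: TM w) lphi u' v'.
  exact: etrans G1 G2.
have E2 := Rsym_frame ('D_(s x *m v) (L (s x *m u)) (chart_pt x))
  ('D_(s x *m u) (L (s x *m v)) (chart_pt x)) E1 J1 J2.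
have E3 c d : Rsym t1 t2 t3 a b al be ga de R0 c d =
  Rsym t1 t2 t3 a b al be ga de (fun _ _ => R0 c d) c d by [].
have LE' u' : conn_form nablas x s (s x *m u') (chart_pt x) =
    L (s x *m u') (chart_pt x) - 2^-1 *: TM u'.
  by rewrite LE // Fu.
rewrite E3 curvature_frame.
have E4 := congr2 (fun a b => a - b + (conn_form nablas x s (s x *m u) (chart_pt x) *m
  conn_form nablas x s (s x *m v) (chart_pt x) - conn_form nablas x s (s x *m v) (chart_pt x) *m
  conn_form nablas x s (s x *m u) (chart_pt x)))
  (DE (s x *m u) (s x *m v)) (DE (s x *m v) (s x *m u)).
have E5 := congr2 (fun As Bs =>
  ('D_(s x *m u) (L (s x *m v)) (chart_pt x)
   - 2^-1 *: TM ('D_(s x *m u) F (chart_pt x) *m (s x *m v)))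
  - ('D_(s x *m v) (L (s x *m u)) (chart_pt x)
     - 2^-1 *: TM ('D_(s x *m v) F (chart_pt x) *m (s x *m u)))
  + (As *m Bs - Bs *m As)) (LE' u) (LE' v).
have E6 := etrans E5 E2.
have E7 := etrans E4 E6.
have E8 := congr1 (fun A => s x *m (A *m w)) E7.
exact: E8.
Qed.

End AtFrame.

Lemma symmetrized_curvature x (p : gl) (u v w : V) : P x p ->
  curvature_at nablas x (p *m u) (p *m v) (p *m w)
    = p *m (Rsym t1 t2 t3 a b al be ga de R0 u v *m w).
Proof.
move=> Pp; have [U [s [Ux sS sx]]] := section_through P_str Pp.
by rewrite -sx; exact: frame_symmetrized_curvature Ux sS u v w.
Qed.

Lemma homogeneous_curvature_mod u v : unitary_algebra (R0 u v -
  (la u *m la v - la v *m la u - la (la u *m v - la v *m u - T u v))).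
Proof.
have [x _] := manifold_nonempty M; have [U [s [Ux sS]]] := Gstr_section P_str x.
exact: frame_curvature_mod Ux sS u v.
Qed.

(** Two frames of one fibre give the same curvature tensor. *)
Lemma homogeneous_curvature_unitary (g : gl) (u v w : V) : unitary_group g ->
  R0 (g *m u) (g *m v) *m (g *m w) = g *m (R0 u v *m w).
Proof.
move=> Ug; have [x _] := manifold_nonempty M; have [p Pp] := frame_at x.
have Ppg : P x (p *m g) by apply/(Gstr_orbit P_str _ Pp); exists g.
have up := Gstr_frame P_str Pp; apply: (can_inj (mulKmx up)).
have E1 := curE Ppg u v w; rewrite -!mulmxA (curE Pp) in E1.
exact: E1.
Qed.

Lemma homogeneous_bianchi (u v w : V) : (forall y u v, torsion_at nabla y u v = 0) ->
  R0 u v *m w + R0 v w *m u + R0 w u *m v = 0.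
Proof.
move=> T0; have [x _] := manifold_nonempty M; have [p Pp] := frame_at x.
have up := Gstr_frame P_str Pp; apply: (can_inj (mulKmx up)).
rewrite mulmx0 !mulmxDr -!(curE Pp).
exact: first_bianchi conn T0.
Qed.

End SymmetrizedConnection.

(** * Wedge powers and the contact condition *)

Section PermSum.
Context {W : nmodType} {m : nat}.

Lemma lift_perm_bij :
  bijective (fun p : 'I_m.+1 * 'S_m => lift_perm ord0 p.1 p.2).
Proof.
apply: inj_card_bij; last by rewrite card_prod !card_Sn card_ord factS.
move=> [j s] [k t] /= /permP E1.
have jk : j = k by have := E1 ord0; rewrite !lift_perm_id.
rewrite -jk in E1 *; congr (_, _); apply/permP => i.
by have := E1 (lift ord0 i); rewrite !lift_perm_lift => /lift_inj.
Qed.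

Lemma sum_perm_lift (G : 'S_m.+1 -> W) :
  \sum_s G s = \sum_(j < m.+1) \sum_(t : 'S_m) G (lift_perm ord0 j t).
Proof.
by rewrite (reindex _ (onW_bij _ lift_perm_bij)) pair_big.
Qed.

Lemma sign_lift_perm (R : pzRingType) (j : 'I_m.+1) (t : 'S_m) :
  (-1) ^+ (lift_perm ord0 j t) = (-1) ^+ j * (-1) ^+ t :> R.
Proof.
rewrite odd_lift_perm -[odd (ord0 : 'I_m.+1)]/false addFb.
by rewrite signr_addb signr_odd.
Qed.

End PermSum.

Section Wedge.
Context {R : realType} {N : nat}.
Local Notation V := 'cV[R]_N.

Definition alternating_form k (f : kform (R := R) (N := N) k) : Prop :=
  forall v (t : 'S_k), f (fun i => v (t i)) = (-1) ^+ t * f v.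

Lemma kform_eq k (f : kform (R := R) (N := N) k) v w :
  (forall i, v i = w i) -> f v = f w.
Proof. by move=> vw; congr f; apply/funext. Qed.

Lemma wedge_alternating k l (f : kform k) (g : kform l) :
  alternating_form (wedge (R := R) (N := N) f g).
Proof.
move=> v t; rewrite /wedge [RHS]mulrCA; congr (_ * _).
rewrite mulr_sumr [RHS](reindex_inj (mulIg t)) /=; apply: eq_bigr => s _.
have -> : f (fun i => v (t (s (lshift l i)))) =
    f (fun i => v ((s * t)%g (lshift l i))).
  by apply: kform_eq => i; rewrite permM.
have -> : g (fun j => v (t (s (rshift k j)))) =
    g (fun j => v ((s * t)%g (rshift k j))).
  by apply: kform_eq => i; rewrite permM.
rewrite odd_permM; move: (f _) (g _) => x y.
by case: (odd_perm s); case: (odd_perm t); rewrite /= ?expr0 ?expr1; ring.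
Qed.

Lemma wedge_power_alternating (f : kform 2) m :
  alternating_form (wedge_power (R := R) (N := N) f m).
Proof.
case: m => [|m]; last exact: wedge_alternating.
move=> v t; rewrite /= (_ : t = 1%g) ?odd_perm1 ?mulr1 //.
by apply/permP; case.
Qed.

Let fact_neq0 m : (m`!)%:R != 0 :> R.
Proof. by rewrite pnatr_eq0 -lt0n fact_gt0. Qed.

Lemma sum_perm_alternating l (g : kform l) v : alternating_form g ->
  \sum_(t : 'S_l) (-1) ^+ t * g (fun i => v (t i)) = (l`!)%:R * g v :> R.
Proof.
move=> ag; under eq_bigr do rewrite ag mulrA -signr_addb addbb mul1r.
by rewrite sumr_const card_Sn mulr_natl.
Qed.

(** Expansion along the first argument: permutations are grouped by the image of
    the first index, and alternation of [g] makes the contributions of the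
    remaining permutations equal. *)
Lemma wedge1E l (h : V -> R) (g : kform l) (v : 'I_l.+1 -> V) :
  alternating_form g -> wedge (kform1 h) g v =
  \sum_(j < l.+1) (-1) ^+ j * h (v j) * g (fun i => v (lift j i)).
Proof.
move=> ag; rewrite /wedge sum_perm_lift (_ : (1`! * l`!)%N = l`!) ?mul1n //.
apply: (mulfI (fact_neq0 l)); rewrite mulVKf // mulr_sumr.
apply: eq_bigr => j _; rewrite mulrCA -(sum_perm_alternating _ ag) mulr_sumr.
apply: eq_bigr => t _; rewrite sign_lift_perm /kform1.
rewrite (_ : lshift l (ord0 : 'I_1) = (ord0 : 'I_l.+1)); last exact/val_inj.
rewrite lift_perm_id -!mulrA; congr (_ * _); rewrite mulrCA; congr (_ * (_ * _)).
apply: kform_eq => i; rewrite -(lift_perm_lift ord0 j t i); congr (v (_ _)).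
exact/val_inj.
Qed.

Lemma wedge2E l (B : V -> V -> R) (g : kform l) (v : 'I_l.+2 -> V) :
  alternating_form g -> wedge (kform2 B) g v =
  2^-1 * \sum_(i < l.+2) \sum_(j < l.+1)
    (-1) ^+ (i + j) * B (v i) (v (lift i j)) * g (fun k => v (lift i (lift j k))).
Proof.
move=> ag; rewrite /wedge sum_perm_lift natrM invfM -mulrA; congr (_ * _).
apply: (mulfI (fact_neq0 l)); rewrite mulVKf // mulr_sumr.
apply: eq_bigr => i _; rewrite sum_perm_lift mulr_sumr; apply: eq_bigr => j _.
rewrite mulrCA -(sum_perm_alternating _ ag) mulr_sumr.
apply: eq_bigr => t _; rewrite !sign_lift_perm /kform2.
rewrite (_ : lshift l (ord0 : 'I_2) = (ord0 : 'I_l.+2)); last exact/val_inj.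
rewrite (_ : lshift l (ord_max : 'I_2) = lift ord0 (ord0 : 'I_l.+1) :> 'I_l.+2);
  last exact/val_inj.
rewrite lift_perm_lift !lift_perm_id exprD.
rewrite (_ : g _ = g (fun k => v (lift i (lift j (t k))))); last first.
  apply: kform_eq => k.
  rewrite (_ : rshift 2 k = lift ord0 (lift ord0 k) :> 'I_l.+2); last exact/val_inj.
  by rewrite !lift_perm_lift.
move: (g _) (B _ _) ((-1) ^+ i) ((-1) ^+ j) ((-1) ^+ t) => x1 x2 x3 x4 x5; ring.
Qed.

(** The values of a standard symplectic form on a symplectic basis indexed by
    consecutive pairs. *)
Definition symp (i j : nat) : R :=
  (~~ odd i && (j == i.+1))%:R - (~~ odd j && (i == j.+1))%:R.

Let skip (k i : nat) := bump k.*2 (bump k.*2 i).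

Lemma symp_skip k i j : symp (skip k i) (skip k j) = symp i j.
Proof.
have S x : skip k x = if (x < k.*2)%N then x else x.+2.
  rewrite /skip /bump; case: (ltnP x k.*2) => [xk|kx] /=.
    by rewrite add0n leqNgt xk.
  by rewrite add1n (leqW kx).
have E1 x y : ~~ odd (skip k x) && (skip k y == (skip k x).+1)
    = ~~ odd x && (y == x.+1).
  by rewrite !S; case: (ltnP x k.*2) => ?; case: (ltnP y k.*2) => ?; lia.
by rewrite /symp !E1.
Qed.

(** The partner of [i] has index [i./2.*2] once [i] is removed; the sign of the
    pair compensates for its orientation. *)
Lemma symp_partner m (i : 'I_m.+2) (j : 'I_m.+1) :
  (-1) ^+ (i + j) * symp i (lift i j) = (nat_of_ord j == i./2.*2)%:R.
Proof.
rewrite -signr_odd /symp /= /bump.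
have [jE|jE] := eqVneq (nat_of_ord j) i./2.*2; case oi : (odd i);
  case: (leqP i j) => ij; rewrite /= ?add1n ?add0n.
- by exfalso; lia.
- have -> : odd (i + j) by lia.
  have -> : odd j = false by lia.
  have -> : (nat_of_ord i == j.+1) by apply/eqP; lia.
  by rewrite /= expr1; ring.
- have -> : odd (i + j) = false by lia.
  have -> : (j.+1 == i.+1) by apply/eqP; lia.
  have -> : (nat_of_ord i == j.+2) = false by apply/eqP; lia.
  by rewrite andbF /= expr0; ring.
- by exfalso; lia.
- have -> : (nat_of_ord i == j.+2) = false by apply/eqP; lia.
  by rewrite andbF subrr mulr0.
- have -> : ~~ odd j && (nat_of_ord i == j.+1) = false.
    by apply/negbTE/negP => /andP[? /eqP]; lia.
  by rewrite subrr mulr0.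
- have -> : (j.+1 == i.+1) = false by apply/eqP; lia.
  have -> : (nat_of_ord i == j.+2) = false by apply/eqP; lia.
  by rewrite andbF subrr mulr0.
- have -> : (nat_of_ord j == i.+1) = false by apply/eqP; lia.
  have -> : ~~ odd j && (nat_of_ord i == j.+1) = false.
    by apply/negbTE/negP => /andP[? /eqP]; lia.
  by rewrite subrr mulr0.
Qed.

(** In the double sum of [wedge2E] each of the [2 * (m + 1)] indices has exactly
    one partner, and removing a pair leaves a symplectic basis of the same shape;
    so each step contributes the factor [c * (m + 1)]. *)
Lemma wedge_power_symplectic (B : V -> V -> R) (c : R) m (v : 'I_(m * 2) -> V) :
  (forall i j, B (v i) (v j) = c * symp i j) ->
  wedge_power (kform2 B) m v = c ^+ m * (m`!)%:R.
Proof.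
elim: m v => [|m IH] v Bv; first by rewrite /= mulr1.
have ag := @wedge_power_alternating (kform2 B) m.
rewrite [LHS](wedge2E B v ag).
have termE (i : 'I_(m * 2).+2) (j : 'I_(m * 2).+1) :
    (-1) ^+ (i + j) * B (v i) (v (lift i j))
      * wedge_power (kform2 B) m (fun k => v (lift i (lift j k)))
    = (nat_of_ord j == i./2.*2)%:R * (c * (c ^+ m * (m`!)%:R)).
  rewrite Bv mulrCA symp_partner; have [jE|_] := eqVneq; last by rewrite !(mulr0, mul0r).
  rewrite mulr1 mul1r IH // => k l; rewrite Bv; congr (_ * _).
  have liftE (x : 'I_(m * 2)) : nat_of_ord (lift i (lift j x)) = skip i./2 x.
    rewrite /= jE /skip /bump; case: (leqP i./2.*2 x) => ix.
      have -> : (i <= true + x)%N by rewrite add1n; lia.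
      by have -> : (i./2.*2 <= true + x)%N by rewrite add1n; lia.
    rewrite !add0n; have -> : (i <= x)%N = false by lia.
    by have -> : (i./2.*2 <= x)%N = false by lia.
  by rewrite !liftE symp_skip.
have sumE (i : 'I_(m * 2).+2) : \sum_(j < (m * 2).+1)
    (nat_of_ord j == i./2.*2)%:R * (c * (c ^+ m * (m`!)%:R))
    = c * (c ^+ m * (m`!)%:R).
  have ltj : (i./2.*2 < (m * 2).+1)%N by have := ltn_ord i; lia.
  rewrite (bigD1 (Ordinal ltj)) //= eqxx mul1r big1 ?addr0 // => j jN.
  have [jE|] := eqVneq; last by rewrite mul0r.
  by case/eqP: jN; exact/val_inj.
rewrite (eq_bigr (fun=> c * (c ^+ m * (m`!)%:R))) => [|i _]; last first.
  by rewrite -[RHS](sumE i); apply: eq_bigr => j _; exact: termE.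
rewrite sumr_const card_ord exprS factS (natrM R m.+1 m`!).
move: (c ^+ m) (m`!%:R : R) => x y.
have -> : (m * 2).+2 = (m.+1 * 2)%N by [].
rewrite -[_ *+ (m.+1 * 2)]mulr_natl (natrM R m.+1 2).
by move: (m.+1%:R : R) => z; field.
Qed.

Lemma wedge_power_eq0 (B : V -> V -> R) m (v : 'I_(m * 2) -> V) :
  (forall u w, B u w = 0) -> (0 < m)%N -> wedge_power (kform2 B) m v = 0.
Proof.
case: m v => // m v B0 _; rewrite /= /wedge big1 ?mulr0 // => s _.
by rewrite /kform2 B0 mulr0 mul0r.
Qed.

End Wedge.

Section Contact.
Context {R : realType} {n : nat}.
Local Notation V := 'cV[R]_(n + n + 1).

Let half_lt (i : 'I_(n * 2)) : (i./2 < n)%N.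
Proof. by have := ltn_ord i; lia. Qed.

Let hX (k : 'I_n) : 'cV[R]_(n + n) := col_mx (delta_mx k 0) 0.

(** The symplectic basis of the horizontal space, as consecutive pairs [X], [J X]. *)
Let hvec (i : 'I_(n * 2)) : V :=
  let X := hX (Ordinal (half_lt i)) in
  if odd i then Jmx *m hor X else hor X.

Let h0_hX k l : h0 (hX k) (hX l) = (k == l)%:R.
Proof.
rewrite /h0 /hX tr_col_mx mul_row_col mulmx0 addr0 trmx_delta.
by rewrite mul_delta_mx_cond mulmxnE mxE eqxx.
Qed.

Let h0_JhX k l : h0 (J0 (hX k)) (hX l) = 0.
Proof.
rewrite /h0 /J0 /J0mx /hX mul_block_col !mul0mx !mulmx0 mul1mx add0r !addr0.
by rewrite tr_col_mx mul_row_col trmx0 mul0mx mulmx0 addr0 mxE.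
Qed.

Let om_hvec i j : om (hvec i) (hvec j) = symp i j.
Proof.
rewrite /hvec /symp; set k := Ordinal _; set l := Ordinal _.
have klE : (k == l) = (i./2 == j./2) by [].
case oi : (odd i); case oj : (odd j); rewrite /= ?subr0 ?sub0r.
- by rewrite om_Jl !ec_hor mul0r subr0 -dotJ -hor_J0 dot_hor h0_JhX.
- rewrite om_Jl !ec_hor mul0r subr0 dot_hor h0_hX klE; congr (- (_ : bool)%:R).
  by apply/eqP/eqP; lia.
- rewrite om_Jr !ec_hor mul0r subr0 dot_hor h0_hX klE; congr ((_ : bool)%:R).
  by apply/eqP/eqP; lia.
- rewrite om_hor /omega0 h0_JhX.
  have -> : (nat_of_ord j == i.+1) = false by apply/eqP; lia.
  have -> : (nat_of_ord i == j.+1) = false by apply/eqP; lia.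
  by rewrite subrr.
Qed.

(** On [e] followed by a symplectic basis of the horizontal space, only the first
    term of the expansion of [wedge1E] survives. *)
Lemma wedge_contact (p : 'M[R]_(n + n + 1)) (h : V -> R) (B : V -> V -> R) (c : R) :
  (forall w, h (p *m w) = ec w) ->
  (forall u v, B (p *m u) (p *m v) = c * om u v) ->
  exists v, wedge (kform1 h) (wedge_power (kform2 B) n) v = c ^+ n * (n`!)%:R.
Proof.
move=> hE BE.
pose v (i : 'I_(n * 2).+1) : V :=
  p *m (if unlift ord0 i is Some k then hvec k else e0).
have v0 : v ord0 = p *m e0 by rewrite /v unlift_none.
have vS k : v (lift ord0 k) = p *m hvec k by rewrite /v liftK.
exists v; rewrite (wedge1E _ _ (@wedge_power_alternating _ _ (kform2 B) n)).
rewrite (bigD1 ord0) //= expr0 mul1r v0 hE ec0 mul1r big1 ?addr0 => [|i iN]; last first.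
  case: (unliftP ord0 i) => [k ->|iE]; last by rewrite iE eqxx in iN.
  rewrite vS hE (_ : ec (hvec k) = 0) ?mulr0 ?mul0r //.
  by rewrite /hvec; case: (odd k); rewrite ?ec_J ?ec_hor.
apply: wedge_power_symplectic => i j.
have BE' : forall a b, B (v (lift ord0 a)) (v (lift ord0 b)) = c * symp (R := R) a b.
  by move=> a b; rewrite !vS BE om_hvec.
exact: BE'.
Qed.

End Contact.

(** * Unitarily invariant Kaehler curvature tensors *)

Section CurvatureTensors.
Context {R : realType} {m : nat} (J : 'M[R]_m).
Local Notation H := 'cV[R]_m.
Hypotheses (J_tr : J^T = - J) (J_sq : J *m J = - 1%:M).
Local Notation "'j' X" := (J *m X) (at level 9).

Let jj (X : H) : j (j X) = - X.
Proof. by rewrite mulmxA J_sq mulNmx mul1mx. Qed.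

Let dotj (X Y : H) : dot (j X) Y = - dot X (j Y).
Proof. by rewrite dot_mulmx J_tr mulNmx dotNr. Qed.

Let dotjj (X Y : H) : dot (j X) (j Y) = dot X Y.
Proof. by rewrite dotj jj dotNr opprK. Qed.

Let dotj_self (X : H) : dot (j X) X = 0.
Proof. by have := dotj X X; rewrite (dotC X); move: (dot _ _) => a; lra. Qed.

(** The unitary group is transitive on unit vectors: the complex reflection in
    the line spanned by [X - Y] with a suitable eigenvalue takes [X] to [Y]. *)
Lemma unitary_transitive (X Y : H) : dot X X = 1 -> dot Y Y = 1 ->
  exists g : 'M[R]_m, [/\ g^T *m g = 1%:M, g *m J = J *m g & g *m X = Y].
Proof.
move=> X1 Y1; have [<-|XY] := eqVneq X Y.
  by exists 1%:M; rewrite trmx1 !mul1mx mulmx1.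
have [W WE] : exists W, W = X - Y by exists (X - Y).
pose r := 1 - dot X Y; pose t := - dot (j Y) X.
have W0 : 0 < dot W W by rewrite dot_gt0 // WE subr_eq0.
have WW : dot W W = 2 * r.
  by rewrite WE /r !(dotDl, dotDr, dotNl, dotNr) X1 Y1 (dotC Y X); ring.
have WX : dot W X = r by rewrite WE /r dotDl dotNl X1 (dotC Y).
have jWX : dot (j W) X = t by rewrite WE /t mulmxBr dotDl dotNl dotj_self sub0r.
have r0 : 0 < r by rewrite WW in W0; lra.
have c0 : r ^+ 2 + t ^+ 2 != 0.
  by rewrite gt_eqF // ltr_wpDr ?sqr_ge0 // exprn_gt0.
(* The eigenvalue of the reflection on the line of [W] is [1 + 2 * r * (p + i q)]:
   [pq] says that its modulus is 1, and the value takes [X] to [X - W = Y]. *)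
pose p := - r / (r ^+ 2 + t ^+ 2); pose q := t / (r ^+ 2 + t ^+ 2).
have pq : 2 * p + (p ^+ 2 + q ^+ 2) * (2 * r) = 0 by rewrite /p /q; field.
pose gf U := U + (dot W U *: (p *: W + q *: j W)
  + dot (j W) U *: (p *: j W - q *: W)).
have gE U : lmx gf *m U = gf U.
  rewrite -lmxE // => a u v; rewrite /gf !(dotDr, dotZr).
  move: (p *: W + _) (p *: j W - _) => A B.
  by apply/colP => i; rewrite !mxE; ring.
exists (lmx gf); split.
- apply: mx_ext => U; apply: dot_ext => Z; rewrite mul1mx -mulmxA dotC.
  rewrite -{1}(trmxK (lmx gf)) -dot_mulmx trmxK !gE /gf.
  rewrite !(dotDl, dotDr, dotZl, dotZr, dotNl, dotNr) dotjj dotj_self.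
  rewrite !(dotC W (j W)) dotj_self WW !(dotC _ W) !(dotC _ (j W)).
  set a := dot W U; set b := dot W Z; set c := dot (j W) U; set d := dot (j W) Z.
  have -> : dot U Z = dot Z U + (2 * p + (p ^+ 2 + q ^+ 2) * (2 * r)) * (a * b + c * d).
    by rewrite pq mul0r addr0 dotC.
  by ring.
- apply: mx_ext => U; rewrite -!mulmxA !gE /gf.
  have e1 : dot W (j U) = - dot (j W) U by rewrite dotj opprK.
  have e2 : dot (j W) (j U) = dot W U by exact: dotjj.
  rewrite e1 e2 mulmxDr mulmxDr -!scalemxAr mulmxDr mulmxBr -!scalemxAr jj.
  move: (dot W U) (dot (j W) U) (j U) (j W) (W) => x y A B C.
  by apply/colP => i; rewrite !mxE; ring.
- rewrite gE /gf WX jWX.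
  have -> : r *: (p *: W + q *: j W) + t *: (p *: j W - q *: W) =
      (r * p - t * q) *: W + (r * q + t * p) *: j W.
    by move: (j W) (W) => A B; apply/colP => i; rewrite !mxE; ring.
  have -> : r * p - t * q = -1 by rewrite /p /q; field.
  have -> : r * q + t * p = 0 by rewrite /p /q; field.
  by rewrite scale0r addr0 scaleN1r WE opprB addrC subrK.
Qed.

Definition quadrilinear (Q : H -> H -> H -> H -> R) : Prop :=
  [/\ forall a X X' Y Z W, Q (a *: X + X') Y Z W = a * Q X Y Z W + Q X' Y Z W,
      forall a X X' Y Z W, Q Y (a *: X + X') Z W = a * Q Y X Z W + Q Y X' Z W,
      forall a X X' Y Z W, Q Y Z (a *: X + X') W = a * Q Y Z X W + Q Y Z X' W &
      forall a X X' Y Z W, Q Y Z W (a *: X + X') = a * Q Y Z W X + Q Y Z W X'].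

(** The symmetries of the curvature tensor of a Kaehler metric. *)
Record kaehler_tensor (Q : H -> H -> H -> H -> R) : Prop := {
  kt_lin : quadrilinear Q ;
  kt_anti : forall X Y Z W, Q X Y Z W = - Q Y X Z W ;
  kt_skew : forall X Y Z W, Q X Y Z W = - Q X Y W Z ;
  kt_bianchi : forall X Y Z W, Q X Y Z W + Q Y Z X W + Q Z X Y W = 0 ;
  kt_J : forall X Y Z W, Q X Y (j Z) (j W) = Q X Y Z W }.

Section Tensor.
Variable Q : H -> H -> H -> H -> R.
Hypothesis K : kaehler_tensor Q.

Let D1 X X' Y Z W : Q (X + X') Y Z W = Q X Y Z W + Q X' Y Z W.
Proof. by case: (kt_lin K) => L _ _ _; have := L 1 X X' Y Z W; rewrite scale1r mul1r. Qed.
Let D2 X X' Y Z W : Q Y (X + X') Z W = Q Y X Z W + Q Y X' Z W.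
Proof. by case: (kt_lin K) => _ L _ _; have := L 1 X X' Y Z W; rewrite scale1r mul1r. Qed.
Let D3 X X' Y Z W : Q Y Z (X + X') W = Q Y Z X W + Q Y Z X' W.
Proof. by case: (kt_lin K) => _ _ L _; have := L 1 X X' Y Z W; rewrite scale1r mul1r. Qed.
Let D4 X X' Y Z W : Q Y Z W (X + X') = Q Y Z W X + Q Y Z W X'.
Proof. by case: (kt_lin K) => _ _ _ L; have := L 1 X X' Y Z W; rewrite scale1r mul1r. Qed.
Let N4 X Y Z W : Q Y Z W (- X) = - Q Y Z W X.
Proof.
case: (kt_lin K) => _ _ _ L; have := L 1 X (- X) Y Z W; rewrite scale1r subrr mul1r.
have := L 1 0 0 Y Z W; rewrite scale1r addr0 mul1r.
by move: (Q Y Z W X) (Q Y Z W (- X)) (Q Y Z W 0) => x y z; lra.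
Qed.
Let N3 X Y Z W : Q Y Z (- X) W = - Q Y Z X W.
Proof. by rewrite (kt_skew K) N4 -(kt_skew K). Qed.

(** The four Bianchi identities on cyclic shifts of the arguments combine
    to pair symmetry. *)
Lemma kt_pair X Y Z W : Q X Y Z W = Q Z W X Y.
Proof.
have := kt_bianchi K X Y Z W; have := kt_bianchi K Y Z W X.
have := kt_bianchi K Z W X Y; have := kt_bianchi K W X Y Z.
have A := kt_anti K; have S := kt_skew K.
have e1 : Q Y X W Z = Q X Y Z W by rewrite A S opprK.
have e2 : Q Y X Z W = - Q X Y Z W by rewrite A.
have e3 : Q X Y W Z = - Q X Y Z W by rewrite S.
have e4 : Q W Z Y X = Q Z W X Y by rewrite A S opprK.
have e5 : Q W Z X Y = - Q Z W X Y by rewrite A.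
have e6 : Q Z W Y X = - Q Z W X Y by rewrite S.
have e7 : Q Z Y X W = - Q Y Z X W by rewrite A.
have e8 : Q Y Z W X = - Q Y Z X W by rewrite S.
have e9 : Q Z Y W X = Q Y Z X W by rewrite A S opprK.
have f1 : Q W X Z Y = - Q W X Y Z by rewrite S.
have f2 : Q X W Y Z = - Q W X Y Z by rewrite A.
have f3 : Q X W Z Y = Q W X Y Z by rewrite A S opprK.
have f4 : Q X Z Y W = - Q Z X Y W by rewrite A.
have f5 : Q Z X W Y = - Q Z X Y W by rewrite S.
have f6 : Q X Z W Y = Q Z X Y W by rewrite A S opprK.
have f7 : Q W Y X Z = - Q Y W X Z by rewrite A.
have f8 : Q Y W Z X = - Q Y W X Z by rewrite S.
have f9 : Q W Y Z X = Q Y W X Z by rewrite A S opprK.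
rewrite ?(e1, e2, e3, e4, e5, e6, e7, e8, e9, f1, f2, f3, f4, f5, f6, f7, f8, f9).
by lra.
Qed.

Let N1 X Y Z W : Q (- X) Y Z W = - Q X Y Z W.
Proof. by rewrite kt_pair N3 -kt_pair. Qed.
Let Jl X Y Z W : Q (j X) (j Y) Z W = Q X Y Z W.
Proof. by rewrite kt_pair (kt_J K) kt_pair. Qed.

(** Polarization at [X + Y] and [X - Y] gives one linear relation between
    [Q X (jX) Y (jY)] and [Q X (jY) X (jY)]; the first Bianchi identity gives
    another one, so that all sectional curvatures vanish, and these determine
    an algebraic curvature tensor. *)
Lemma kaehler_tensor_eq0 : (forall X, Q X (j X) X (j X) = 0) ->
  forall X Y Z W, Q X Y Z W = 0.
Proof.
move=> Q0; pose S X Y Z W := Q X (j Y) Z (j W).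
have SC X Y Z W : S X Y Z W = S Y X Z W.
  by rewrite /S -Jl jj (kt_anti K) kt_pair N3 -kt_pair opprK.
have Sp X Y Z W : S X Y Z W = S Z W X Y by exact: kt_pair.
have SC' X Y Z W : S X Y Z W = S X Y W Z by rewrite Sp SC Sp.
have SD X X' Y Z W : S (X + X') Y Z W = S X Y Z W + S X' Y Z W by exact: D1.
have SN X Y Z W : S Y Z W (- X) = - S Y Z W X by rewrite /S mulmxN N4.
have SD2 X X' Y Z W : S Y (X + X') Z W = S Y X Z W + S Y X' Z W.
  by rewrite SC SD !(SC Y).
have SD3 X X' Y Z W : S Y Z (X + X') W = S Y Z X W + S Y Z X' W.
  by rewrite Sp SD !(Sp Y).
have SD4 X X' Y Z W : S Y Z W (X + X') = S Y Z W X + S Y Z W X'.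
  by rewrite SC' SD3 !(SC' Y Z W).
have SN3 X Y Z W : S Y Z (- X) W = - S Y Z X W by rewrite SC' SN SC'.
have SN1 X Y Z W : S (- X) Y Z W = - S X Y Z W by rewrite Sp SN3 Sp.
have SN2 X Y Z W : S Y (- X) Z W = - S Y X Z W by rewrite SC SN1 SC.
have S0 X : S X X X X = 0 by exact: Q0.
have pol X Y : S X X Y Y + 2 * S X Y X Y = 0.
  have := S0 (X + Y); have := S0 (X - Y).
  rewrite !(SD, SD2, SD3, SD4, SN, SN3, SN2, SN1) !S0.
  have -> : S Y Y X X = S X X Y Y by exact: Sp.
  have -> : S X Y Y X = S X Y X Y by exact: SC'.
  have -> : S Y X X Y = S X Y X Y by exact: SC.
  have -> : S Y X Y X = S X Y X Y by rewrite SC SC'.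
  by lra.
have sec X Y : Q X Y X Y = 0.
  have := pol X Y; have := pol X (j Y); rewrite /S jj.
  have -> : Q X (- Y) X (- Y) = Q X Y X Y by rewrite N4 kt_pair N4 opprK.
  have -> : Q X (j X) (j Y) (- Y) = Q X (j X) Y (j Y).
    by rewrite N4 -(kt_skew K).
  have := kt_bianchi K X (j X) Y (j Y).
  have -> : Q (j X) Y X (j Y) = - Q X (j Y) X (j Y).
    by rewrite -Jl jj N1.
  have -> : Q Y X (j X) (j Y) = - Q X Y X Y by rewrite (kt_J K) (kt_anti K).
  by lra.
have sec2 X Y W : Q X Y X W = 0.
  have := sec X (Y + W); rewrite !(D2, D4) !sec (kt_pair X W X Y); lra.
have cyc X Y Z W : Q X Y Z W = Q Y Z X W.
  have := sec2 (X + Z) Y W; rewrite !(D1, D3) !sec2 (kt_anti K Y Z); lra.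
move=> X Y Z W; have := kt_bianchi K X Y Z W.
by rewrite (cyc X Y) (cyc Y Z); lra.
Qed.

End Tensor.

(** The curvature of constant holomorphic sectional curvature 1, paired with a
    fourth vector ([Kcurv_form]). *)
Definition kaehler_form (X Y Z W : H) : R :=
  4^-1 * (dot Y Z * dot X W - dot X Z * dot Y W + dot (j Y) Z * dot (j X) W
          - dot (j X) Z * dot (j Y) W - 2 * dot (j X) Y * dot (j Z) W).

Lemma kaehler_form_tensor : kaehler_tensor kaehler_form.
Proof.
split; rewrite /kaehler_form.
- by split=> a X X' Y Z W;
    rewrite !(mulmxDr, dotDl, dotDr, dotZl, dotZr) -?scalemxAr ?(dotZl, dotZr); ring.
- move=> X Y Z W; rewrite (dotj Y X) (dotC Y (j X)); ring.
- move=> X Y Z W; rewrite (dotj W Z) (dotC W (j Z)); ring.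
- have sw A B : dot (j A) B = - dot (j B) A by rewrite dotj dotC.
  move=> X Y Z W; rewrite (dotC Y X) (dotC Z X) (dotC Z Y).
  by rewrite (sw Y X) (sw X Z) (sw Z Y); ring.
- have sw A B : dot A (j B) = - dot (j A) B by rewrite dotj opprK.
  by move=> X Y Z W; rewrite !dotjj !sw; ring.
Qed.

(** By [unitary_transitive] the invariant quartic form [Q X (J X) X (J X)] is a
    multiple of the fourth power of the norm.  Subtracting the multiple of
    [kaehler_form] with the same quartic form leaves zero by
    [kaehler_tensor_eq0]. *)
Lemma kaehler_tensor_invariant (Q : H -> H -> H -> H -> R) : (0 < m)%N ->
    kaehler_tensor Q ->
    (forall g, g^T *m g = 1%:M -> g *m J = J *m g ->
      forall X Y Z W, Q (g *m X) (g *m Y) (g *m Z) (g *m W) = Q X Y Z W) ->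
  exists kappa : R, forall X Y Z W, Q X Y Z W = kappa * kaehler_form X Y Z W.
Proof.
move=> m0 KQ inv; pose E : H := delta_mx (Ordinal m0) 0.
have E1 : dot E E = 1.
  rewrite /dot mxE (bigD1 (Ordinal m0)) //= big1 => [|i ni].
    by rewrite !mxE !eqxx mul1r addr0.
  by rewrite !mxE (negbTE ni) mul0r.
case: (kt_lin KQ) => L1 L2 L3 L4; case: (kt_lin kaehler_form_tensor) => K1 K2 K3 K4.
exists (- Q E (j E) E (j E)); set k := - _ => X Y Z W.
apply/eqP; rewrite -subr_eq0; apply/eqP.
apply: (kaehler_tensor_eq0 (Q := fun X Y Z W => Q X Y Z W - k * kaehler_form X Y Z W)).
  split.
  - split=> a U U' A B C; rewrite ?(L1, L2, L3, L4) ?(K1, K2, K3, K4); ring.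
  - by move=> A B C D; rewrite (kt_anti KQ) (kt_anti kaehler_form_tensor); ring.
  - by move=> A B C D; rewrite (kt_skew KQ) (kt_skew kaehler_form_tensor); ring.
  - move=> A B C D; have := kt_bianchi KQ A B C D.
    have := kt_bianchi kaehler_form_tensor A B C D.
    move: (kaehler_form _ _ _ _) (kaehler_form _ _ _ _) (kaehler_form _ _ _ _).
    move: (Q _ _ _ _) (Q _ _ _ _) (Q _ _ _ _) => x y z x' y' z' e1 e2.
    have -> : z - k * z' + (y - k * y') + (x - k * x') =
      (z + y + x) - k * (z' + y' + x') by ring.
    by rewrite e1 e2 mulr0 subr0.
  - by move=> A B C D; rewrite (kt_J KQ) (kt_J kaehler_form_tensor).
move=> {X Y Z W} X.
have -> : kaehler_form X (j X) X (j X) = - dot X X ^+ 2.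
  rewrite /kaehler_form !dotjj !jj !dotNl dotj_self !(dotC _ (j X)) dotj_self; by field.
have [->|X0] := eqVneq X 0.
  have Q0 A B C : Q 0 A B C = 0.
    by have := L1 (-1) 0 0 A B C; rewrite scaler0 addr0; lra.
  by rewrite Q0 dot0l; ring.
pose r := Num.sqrt (dot X X).
have r0 : r != 0 by rewrite sqrtr_eq0 -ltNge dot_gt0.
have r2 : dot X X = r ^+ 2 by rewrite sqr_sqrtr // ltW // dot_gt0.
have X'1 : dot (r^-1 *: X) (r^-1 *: X) = 1.
  by rewrite dotZl dotZr r2; field.
have [g [gg gJ gE]] := unitary_transitive E1 X'1.
have XE : X = r *: (g *m E) + 0 by rewrite gE scalerA divff // scale1r addr0.
have Z1 a A B C D : Q (a *: A) B C D = a * Q A B C D.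
  have := L1 a A 0 B C D; have := L1 1 0 0 B C D; rewrite scale1r addr0 mul1r addr0.
  by move=> e ->; lra.
have Z2 a A B C D : Q B (a *: A) C D = a * Q B A C D.
  by rewrite (kt_anti KQ) Z1 (kt_anti KQ A); ring.
have Z4 a A B C D : Q B C D (a *: A) = a * Q B C D A.
  have := L4 a A 0 B C D; have := L4 1 0 0 B C D; rewrite scale1r addr0 mul1r addr0.
  by move=> e ->; lra.
have Z3 a A B C D : Q B C (a *: A) D = a * Q B C A D.
  by rewrite (kt_skew KQ) Z4 (kt_skew KQ _ _ D); ring.
rewrite r2 XE addr0 -!scalemxAr Z1 Z2 Z3 Z4.
have -> : j (g *m E) = g *m (j E) by rewrite !mulmxA gJ.
by rewrite inv // /k; ring.
Qed.

End CurvatureTensors.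

Section KaehlerCurvature.
Context {R : realType} {n : nat}.
Local Notation H := 'cV[R]_(n + n).

Lemma Kcurv_form (X Y Z W : H) : dot (Kcurv X Y Z) W = kaehler_form J0mx X Y Z W.
Proof.
rewrite /Kcurv /kaehler_form /omega0 /J0.
by rewrite dotZl !(dotDl, dotNl, dotZl).
Qed.

Lemma invariant_kaehler_curvature (B : H -> H -> 'M[R]_(n + n)) : (0 < n)%N ->
    alternating_bilinear B ->
    (forall X Y, (B X Y)^T = - B X Y) ->
    (forall X Y, B X Y *m J0mx = J0mx *m B X Y) ->
    (forall X Y Z, B X Y *m Z + B Y Z *m X + B Z X *m Y = 0 :> H) ->
    (forall g, g^T *m g = 1%:M -> g *m J0mx = J0mx *m g ->
      forall X Y (Z : H), B (g *m X) (g *m Y) *m (g *m Z) = g *m (B X Y *m Z)) ->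
  exists kappa : R, forall X Y (Z : H), B X Y *m Z = kappa *: Kcurv X Y Z.
Proof.
move=> n0 altB skewB BJ bi inv.
have [B1 B2 B3] := altB.
have [|||kappa kE] := @kaehler_tensor_invariant _ _ _ J0mx_tr J0mx_sq
    (fun X Y Z W => dot (B X Y *m Z) W).
- by rewrite addn_gt0 n0.
- split.
  + by split=> a X X' Y Z W;
      rewrite ?(B1, B2) ?(mulmxDl, mulmxDr) -?(scalemxAl, scalemxAr)
      !(dotDl, dotDr, dotZl, dotZr).
  + by move=> X Y Z W; rewrite (alternating_anti altB) mulNmx dotNl.
  + by move=> X Y Z W; rewrite dot_mulmx skewB mulNmx dotNr dotC.
  + by move=> X Y Z W; rewrite -!dotDl bi dot0l.
  + move=> X Y Z W; rewrite mulmxA BJ -mulmxA dot_mulmx J0mx_tr mulNmx mulmxA.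
    by rewrite J0mx_sq mulNmx mul1mx opprK.
- by move=> g gg gJ X Y Z W; rewrite inv // dot_mulmx mulmxA gg mul1mx.
exists kappa => X Y Z; apply: dot_ext => W.
by rewrite dotZl Kcurv_form.
Qed.

End KaehlerCurvature.

(** * The curvature of a torsion-free homogeneous structure *)

Section TorsionFreeCurvature.
Context {R : realType} {n : nat}.
Local Notation V := 'cV[R]_(n + n + 1).
Local Notation gl := 'M[R]_(n + n + 1).
Local Notation H := 'cV[R]_(n + n).
Local Notation ee := (@e0 R n).
Variables (a b al be ga de : R).
Local Notation la := (@lam R n a b al be ga de).
Local Notation lc := (@lamcurv R n a b al be ga de).

Let zeroE := (mulr0, mul0r, mulr1, mulrN1, scale0r, subr0, oppr0, addr0, add0r,
  scale1r, scaler0).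
Let la_linear := @lam_linear R n a b al be ga de.

Let la0 : la 0 = 0.
Proof. by have := la_linear (-1) 0 0; rewrite scaler0 addr0 scaleN1r addNr. Qed.

Lemma lamcurvE u v (w : V) : lc u v *m w =
  la u *m (la v *m w) - la v *m (la u *m w) - la (la u *m v - la v *m u) *m w.
Proof. by rewrite /lamcurv !mulmxBl -!mulmxA. Qed.

Lemma lamcurv_anti u v : lc u v = - lc v u.
Proof.
have laN w : la (- w) = - la w.
  by have := la_linear (-1) w 0; rewrite !addr0 !scaleN1r la0 addr0.
rewrite /lamcurv -[la u *m v - _]opprB laN.
move: (la (_ - _)) (la u *m la v) (la v *m la u) => A B C.
by rewrite opprK !opprB addrC.
Qed.

Lemma lamcurv_linearl (c : R) u u' v : lc (c *: u + u') v = c *: lc u v + lc u' v.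
Proof.
have E : la (c *: u + u') *m v - la v *m (c *: u + u') =
    c *: (la u *m v - la v *m u) + (la u' *m v - la v *m u').
  rewrite la_linear mulmxDl mulmxDr -scalemxAl -scalemxAr.
  move: (la u *m v) (la u' *m v) (la v *m u) (la v *m u') => A B C D.
  by apply/colP => i; rewrite !mxE; ring.
rewrite /lamcurv E !la_linear mulmxDl mulmxDr -scalemxAl -scalemxAr.
move: (la _ *m la _) (la _ *m la _) (la _ *m la _) (la _ *m la _) => A B C D.
move: (la _) (la _) => A' B'.
by apply/matrixP => i j; rewrite !mxE; ring.
Qed.

Lemma lamcurv_alternating : alternating_bilinear lc.
Proof. exact: alternating_antisym lamcurv_anti lamcurv_linearl. Qed.

Lemma lamcurv_unitary (g : gl) u v (w : V) : unitary_group g ->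
  lc (g *m u) (g *m v) *m (g *m w) = g *m (lc u v *m w).
Proof.
move=> Ug; have E u' w' := lam_unitary a b al be ga de u' w' Ug.
have F u' v' (w' : V) : la (g *m u') *m (la (g *m v') *m (g *m w')) =
    g *m (la u' *m (la v' *m w')) by rewrite (E v') E.
have F' : la (la (g *m u) *m (g *m v) - la (g *m v) *m (g *m u)) *m (g *m w) =
    g *m (la (la u *m v - la v *m u) *m w).
  by rewrite (E u v) (E v u) -mulmxBr E.
by rewrite lamcurvE (F u v w) (F v u w) F' -!mulmxBr -lamcurvE.
Qed.

(** The horizontal block of the part of the curvature that comes from [lam].  For
    [al = a] it has the terms of [branch_block] other than the Kaehler term and
    the multiple of [J]. *)
Lemma lamcurv_hor X Y (Z : H) : lc (hor X) (hor Y) *m hor Z =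
  hor (h0 (ga *: Y + de *: J0 Y) Z *: (al *: X + be *: J0 X)
       - h0 (ga *: X + de *: J0 X) Z *: (al *: Y + be *: J0 Y)
       - (2 * a * de * omega0 X Y) *: Z).
Proof.
have hh (U W : H) : h0 (ga *: U + de *: J0 U) W = ga * h0 U W + de * omega0 U W.
  by rewrite -!dot_hor horD !horZ dotDl !dotZl hor_J0 -om_hor.
have E (U W : H) : la (hor U) *m hor W = (h0 (ga *: U + de *: J0 U) W) *: ee.
  rewrite lamE /lamf !ec_hor prj_hor dot_hor om_hor hh.
  by rewrite !zeroE.
have E' (U : H) : la (hor U) *m ee = hor (al *: U + be *: J0 U).
  rewrite lamE /lamf ec_hor ec0 prj_hor prj_e0 om_e0r dot_er ec_hor.
  rewrite !zeroE.
  by rewrite horD !horZ hor_J0.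
have E'' (c : R) (W : H) : la (c *: ee) *m hor W = (a * c) *: hor W.
  rewrite lamE /lamf ecZ ec0 ec_hor prj_hor prjZ prj_e0 omZl om_e0l dotZl.
  rewrite [dot ee _]ec_hor.
  by rewrite !zeroE.
have F1 (U W : H) : la (hor U) *m (la (hor W) *m hor Z) =
    h0 (ga *: W + de *: J0 W) Z *: hor (al *: U + be *: J0 U).
  by rewrite (E W Z) -scalemxAr E'.
have F2 : la (la (hor X) *m hor Y - la (hor Y) *m hor X) *m hor Z =
    (a * (h0 (ga *: X + de *: J0 X) Y - h0 (ga *: Y + de *: J0 Y) X)) *: hor Z.
  by rewrite (E X Y) (E Y X) -scalerBl E''.
rewrite lamcurvE (F1 X Y) (F1 Y X) F2 !hh.
rewrite -!horZ -!horN -!horD; congr hor.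
have -> : h0 Y X = h0 X Y by exact: dotC.
have -> : omega0 Y X = - omega0 X Y by rewrite -!om_hor omC.
move: (h0 X Y) (omega0 X Y) (h0 X Z) (h0 Y Z) (omega0 X Z) (omega0 Y Z) => p q r s t t'.
move: (al *: X + _) (al *: Y + _) => A B.
by apply/colP => i; rewrite !mxE; ring.
Qed.

Variable R0 : V -> V -> gl.
Hypothesis R0_alt : alternating_bilinear R0.
Hypothesis R0_mod : forall u v, unitary_algebra (R0 u v - lc u v).
Hypothesis R0_bianchi : forall u v w : V,
  R0 u v *m w + R0 v w *m u + R0 w u *m v = 0.
Hypothesis R0_unitary : forall (g : gl) u v (w : V), unitary_group g ->
  R0 (g *m u) (g *m v) *m (g *m w) = g *m (R0 u v *m w).
Hypothesis n_gt0 : (0 < n)%N.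

(** The vertical component of the first Bianchi identity on [X], [J X], [e].  The
    curvature may be replaced with [lamcurv], because u(n) has no e-component. *)
Lemma torsion_free_branch : de * (a - al) = 0.
Proof.
pose X : H := delta_mx (lshift n (Ordinal n_gt0)) 0.
pose u : V := hor X; pose v : V := Jmx *m u.
have uv : om u v = 1.
  rewrite /v om_Jr /u ec_hor mulr0 subr0 dot_hor /h0 mxE.
  rewrite (bigD1 (lshift n (Ordinal n_gt0))) //= big1 => [|i ni].
    by rewrite !mxE !eqxx mulr1 addr0.
  by rewrite !mxE (negbTE ni) mulr0.
have eu : ec u = 0 by exact: ec_hor.
have ev : ec v = 0 by exact: ec_J.
have vu : om v u = -1 by rewrite omC uv.
have dvu : dot v u = 0 by exact: om_self.
have duv : dot u v = 0 by rewrite dotC.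
have mod u' v' w' : ec (R0 u' v' *m w') = ec (lc u' v' *m w').
  have := skew_ec w' (R0_mod u' v'); rewrite mulmxBl ecD ecN.
  by move/eqP; rewrite subr_eq0 => /eqP.
have := congr1 ec (R0_bianchi u v ee).
rewrite !ecD !mod (_ : ec 0 = 0); last by rewrite /ec dot0r.
have Ju : Jmx *m u = v by [].
have Jv : Jmx *m v = - u by rewrite JJ prj_hor.
have pu : prj u = u by exact: prj_hor.
have pv : prj v = v by exact: prj_J.
have uu : dot u u = 1 by rewrite -uv om_Jr eu mul0r subr0.
have vv : dot v v = 1 by rewrite -uv.
have ov : om v v = 0 by exact: om_self.
have ou : om u u = 0 by exact: om_self.
have due : dot u ee = 0 by rewrite dot_er.
have dve : dot v ee = 0 by rewrite dot_er.
move: (u) (v) Ju Jv pu pv uu vv ov ou due dve eu ev uv vu duv dvu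
  => {mod} {}u {}v Ju Jv pu pv uu vv ov ou due dve eu ev uv vu duv dvu.
have V1 : la u *m ee = al *: u + be *: v.
  rewrite lamE /lamf Ju pu due om_e0r eu ec0 prj_e0.
  by rewrite !zeroE.
have V2 : la v *m ee = al *: v - be *: u.
  rewrite lamE /lamf Jv pv dve om_e0r ev ec0 prj_e0 scalerN.
  by rewrite !zeroE.
have V3 : la u *m v = de *: ee.
  rewrite lamE /lamf Ju pu pv duv uv eu ev.
  by rewrite !zeroE.
have V4 : la v *m u = - de *: ee.
  rewrite lamE /lamf pu pv dvu vu eu ev.
  by rewrite !zeroE.
have V5 : la u *m u = ga *: ee.
  rewrite lamE /lamf uu ou eu.
  by rewrite !zeroE.
have V6 : la v *m v = ga *: ee.
  rewrite lamE /lamf vv ov ev.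
  by rewrite !zeroE.
have V7 : la ee *m u = a *: u.
  rewrite lamE /lamf pu ec0 eu om_e0l [dot ee u]eu.
  by rewrite !zeroE.
have V8 : la ee *m v = a *: v.
  rewrite lamE /lamf pv ec0 ev om_e0l [dot ee v]ev.
  by rewrite !zeroE.
have V9 : la ee *m ee = b *: ee.
  rewrite lamE /lamf prj_e0 ec0 om_e0l Jmx_e0 dot_e0 mul1r subrr.
  by rewrite !zeroE.
have laL c1 c2 w1 w2 (w : V) : la (c1 *: w1 + c2 *: w2) *m w =
    c1 *: (la w1 *m w) + c2 *: (la w2 *m w).
  by rewrite la_linear -[c2 *: w2]addr0 la_linear la0 addr0 mulmxDl -!scalemxAl.
have e1 : ec (lc u v *m ee) = 2 * (al * de - be * ga) - 2 * de * b.
  have F1 : la u *m (la v *m ee) = (al * de - be * ga) *: ee.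
    by rewrite V2 mulmxBr -!scalemxAr V3 V5 !scalerA -scalerBl.
  have F2 : la v *m (la u *m ee) = (- al * de + be * ga) *: ee.
    by rewrite V1 mulmxDr -!scalemxAr V4 V6 !scalerA -scalerDl mulrN mulNr.
  have F3 : la (la u *m v - la v *m u) *m ee = (2 * de * b) *: ee.
    rewrite V3 V4 (_ : _ - _ = (2 * de) *: ee + 0 *: 0).
      by rewrite laL V9 la0 mul0mx scaler0 addr0 scalerA.
    by rewrite scale0r addr0 -scalerBl; congr (_ *: _); ring.
  by rewrite lamcurvE F1 F2 F3 !(ecD, ecN, ecZ) ec0; ring.
have e2 : ec (lc v ee *m u) = al * de + be * ga - 2 * a * de + de * b.
  have F1 : la v *m (la ee *m u) = (- a * de) *: ee.
    by rewrite V7 -scalemxAr V4 scalerA mulrN mulNr.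
  have F2 : la ee *m (la v *m u) = (- de * b) *: ee.
    by rewrite V4 -scalemxAr V9 scalerA.
  have F3 : la (la v *m ee - la ee *m v) *m u = ((a - al) * de - be * ga) *: ee.
    rewrite V2 V8 (_ : _ - _ = (al - a) *: v + (- be) *: u).
      by rewrite laL V4 V5 !scalerA -scalerDl; congr (_ *: _); ring.
    by apply/colP => i; rewrite !mxE; ring.
  by rewrite lamcurvE F1 F2 F3 !(ecD, ecN, ecZ) ec0; ring.
have e3 : ec (lc ee u *m v) = al * de + be * ga - 2 * a * de + de * b.
  have F1 : la ee *m (la u *m v) = (de * b) *: ee.
    by rewrite V3 -scalemxAr V9 scalerA.
  have F2 : la u *m (la ee *m v) = (a * de) *: ee.
    by rewrite V8 -scalemxAr V3 scalerA.
  have F3 : la (la ee *m u - la u *m ee) *m v = ((a - al) * de - be * ga) *: ee.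
    rewrite V7 V1 (_ : _ - _ = (a - al) *: u + (- be) *: v).
      by rewrite laL V3 V6 !scalerA -scalerDl; congr (_ *: _); ring.
    by apply/colP => i; rewrite !mxE; ring.
  by rewrite lamcurvE F1 F2 F3 !(ecD, ecN, ecZ) ec0; ring.
by rewrite e1 e2 e3; lra.
Qed.

(** What remains of the horizontal curvature when the terms in the classification
    other than the Kaehler term are removed. *)
Definition kaehler_part (X Y : H) : 'M[R]_(n + n) :=
  ulsubmx (R0 (hor X) (hor Y) - lc (hor X) (hor Y))
  + (2 * be * de * omega0 X Y) *: J0mx.

Let partE X Y (Z : H) : hor (ulsubmx (R0 (hor X) (hor Y) - lc (hor X) (hor Y)) *m Z)
  = (R0 (hor X) (hor Y) - lc (hor X) (hor Y)) *m hor Z.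
Proof.
have [B [_ _ BE]] := R0_mod (hor X) (hor Y).
by rewrite BE block_mxKul mul_block_col !mul0mx !addr0.
Qed.

(** In the branch [a = alpha] the curvature differs from its part determined by
    the inner torsion by an invariant Kaehler curvature tensor. *)
Lemma torsion_free_kaehler : al = a ->
  exists kappa, Kaehler_parameter R0 a be ga de kappa.
Proof.
move=> alE; have [R1 R2 R3] := R0_alt; have [l1 l2 l3] := lamcurv_alternating.
have omD (c : R) (X Y Z : H) : omega0 (c *: X + Y) Z = c * omega0 X Z + omega0 Y Z.
  by rewrite -!om_hor horD horZ omDl omZl.
have omA (X Y : H) : omega0 X Y = - omega0 Y X by rewrite -!om_hor omC.
have sk (X Y : H) : exists B, [/\ B^T = - B, B *m J0mx = J0mx *m B &
    ulsubmx (R0 (hor X) (hor Y) - lc (hor X) (hor Y)) = B].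
  have [B [B1 B2 BE]] := R0_mod (hor X) (hor Y).
  by exists B; split => //; rewrite BE block_mxKul.
have hh (U W : H) : h0 (ga *: U + de *: J0 U) W = ga * h0 U W + de * omega0 U W.
  by rewrite -!dot_hor horD !horZ dotDl !dotZl hor_J0 -om_hor.
have hC (X Y : H) : h0 X Y = h0 Y X by exact: dotC.
have hor_inj (X Y : H) : hor X = hor Y :> V -> X = Y by case/eq_col_mx.
have usub (A : gl) (Z : H) : ulsubmx A *m Z = usubmx (A *m hor Z).
  by rewrite -{2}(submxK A) mul_block_col !mulmx0 !addr0 col_mxKu.
have kpE X Y (Z : H) : kaehler_part X Y *m Z =
    usubmx (R0 (hor X) (hor Y) *m hor Z)
    - (h0 (ga *: Y + de *: J0 Y) Z *: (al *: X + be *: J0 X)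
       - h0 (ga *: X + de *: J0 X) Z *: (al *: Y + be *: J0 Y)
       - (2 * a * de * omega0 X Y) *: Z)
    + (2 * be * de * omega0 X Y) *: J0 Z.
  rewrite /kaehler_part mulmxDl usub mulmxBl linearB /= lamcurv_hor /hor col_mxKu.
  by rewrite -scalemxAl.
have [|||||kappa kE] := @invariant_kaehler_curvature _ _ kaehler_part n_gt0.
- have ulP (c : R) (A B : gl) : ulsubmx (c *: A + B) = c *: ulsubmx A + ulsubmx B.
    by apply/matrixP => i j; rewrite !mxE.
  have L (c : R) X X' Y : kaehler_part (c *: X + X') Y =
      c *: kaehler_part X Y + kaehler_part X' Y.
    rewrite /kaehler_part horD horZ R1 l1 omD.
    have -> : c *: R0 (hor X) (hor Y) + R0 (hor X') (hor Y)
        - (c *: lc (hor X) (hor Y) + lc (hor X') (hor Y)) =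
      c *: (R0 (hor X) (hor Y) - lc (hor X) (hor Y))
        + (R0 (hor X') (hor Y) - lc (hor X') (hor Y)).
      move: (R0 _ _) (R0 _ _) (lc _ _) (lc _ _) => A B C D.
      by apply/matrixP => i j; rewrite !mxE; ring.
    move: (R0 (hor X) (hor Y) - lc (hor X) (hor Y)) => A.
    move: (R0 (hor X') (hor Y) - lc (hor X') (hor Y)) => B.
    rewrite (ulP c A B); move: (ulsubmx A) (ulsubmx B) => {}A {}B.
    by apply/matrixP => i j; rewrite !mxE; ring.
  have A X Y : kaehler_part X Y = - kaehler_part Y X.
    rewrite /kaehler_part (alternating_anti R0_alt) lamcurv_anti omA -opprD.
    move: (R0 _ _ - _) => B.
    by apply/matrixP => i j; rewrite !mxE; ring.
  exact: alternating_antisym A L.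
- move=> X Y; have [B [B1 _ BE]] := sk X Y.
  rewrite /kaehler_part BE; have /matrixP B' := B1; have /matrixP J' := @J0mx_tr R n.
  apply/matrixP => i j; have := B' i j; have := J' i j.
  by rewrite !mxE => -> ->; ring.
- move=> X Y; have [B [_ B2 BE]] := sk X Y.
  by rewrite /kaehler_part BE mulmxDl mulmxDr B2 -scalemxAl -scalemxAr.
- have uD (x y z : V) : x + y + z = 0 -> usubmx x + usubmx y + usubmx z = 0.
    by move=> /(congr1 usubmx); rewrite !linearD linear0.
  move=> X Y Z; rewrite !kpE !hh alE.
  have := uD _ _ _ (R0_bianchi (hor X) (hor Y) (hor Z)).
  rewrite (hC Z Y) (hC X Z) (hC Y X) (omA Z Y) (omA X Z) (omA Y X).
  move: (usubmx _) (usubmx _) (usubmx _) => r1 r2 r3 rE.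
  have -> : r1 = - (r3 + r2) by apply/eqP; rewrite -addr_eq0 addrC rE.
  move: (J0 X) (J0 Y) (J0 Z) => x y z.
  by apply/colP => i; rewrite !mxE; ring.
- move=> g gg gJ X Y Z.
  pose G : gl := block_mx g 0 0 1%:M.
  have UG : unitary_group G by exists g.
  have GE W : hor (g *m W) = G *m hor W.
    by rewrite /G mul_block_col !mulmx0 !mul0mx !addr0.
  have kpH X' Y' (Z' : H) : hor (kaehler_part X' Y' *m Z') =
      (R0 (hor X') (hor Y') *m hor Z' - lc (hor X') (hor Y') *m hor Z')
      + (2 * be * de * omega0 X' Y') *: (Jmx *m hor Z').
    by rewrite /kaehler_part mulmxDl horD partE mulmxBl -scalemxAl horZ hor_J0.
  have oE : omega0 (g *m X) (g *m Y) = omega0 X Y.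
    by rewrite -!om_hor (GE X) (GE Y) (unitary_om _ _ UG).
  apply: hor_inj; rewrite (kpH (g *m X)) oE (GE X) (GE Y) (GE Z).
  rewrite (R0_unitary (hor X) (hor Y) (hor Z) UG).
  rewrite (lamcurv_unitary (hor X) (hor Y) (hor Z) UG) (unitary_J (hor Z) UG).
  by rewrite (GE (kaehler_part X Y *m Z)) kpH scalemxAr -mulmxBr -mulmxDr.
exists kappa => X Y Z; have := kpE X Y Z; rewrite kE usub alE /branch_block.
move: (usubmx _) (Kcurv _ _ _) (J0 Z) (a *: X + _) (a *: Y + _) => r K z A B E.
by apply/colP => i; have /colP/(_ i) := E; rewrite !mxE; lra.
Qed.

End TorsionFreeCurvature.

(** * The metric of constant holomorphic curvature *)

Section KaehlerGauge.
Context {R : realType} {m : nat} (J : 'M[R]_m).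
Local Notation H := 'cV[R]_m.
Hypotheses (J_tr : J^T = - J) (J_sq : J *m J = - 1%:M).
Local Notation "'j' X" := (J *m X) (at level 9).
Variable k : R.
Implicit Types (w u v Z : H).

(** [kcoframe w] is a unitary coframe of the metric of constant holomorphic
    sectional curvature [16 * k], and [kconn w] is the connection matrix of its
    Levi-Civita connection, in coordinates that restrict to stereographic
    coordinates on totally real linear subspaces; all coefficients are rational
    functions.  [dkscale], [dkcoframe] and [dkconn] are the derivatives in the
    direction [v]. *)
Definition kscale w : R := (1 + k * dot w w)^-1.

Definition kcoframe w u : H :=
  kscale w *: u - (2 * k * dot (j w) u * kscale w ^+ 2) *: j w.

Definition kconn w u Z : H := (2 * k * kscale w) *:
  (dot u Z *: w + dot (j u) Z *: j w - dot w Z *: u - dot (j w) Z *: j u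
   + (2 * k * kscale w * dot (j w) u) *: (dot w Z *: j w - dot (j w) Z *: w)
   - (2 * kscale w * dot (j w) u) *: j Z).

Definition dkscale w v : R := - 2 * k * dot w v * kscale w ^+ 2.

Definition dkcoframe w v u : H := dkscale w v *: u
  - (2 * k * (dot (j v) u * kscale w ^+ 2
              + 2 * dot (j w) u * kscale w * dkscale w v)) *: j w
  - (2 * k * dot (j w) u * kscale w ^+ 2) *: j v.

Definition dkconn w v u Z : H := (2 * k * dkscale w v) *:
  (dot u Z *: w + dot (j u) Z *: j w - dot w Z *: u - dot (j w) Z *: j u
   + (2 * k * kscale w * dot (j w) u) *: (dot w Z *: j w - dot (j w) Z *: w)
   - (2 * kscale w * dot (j w) u) *: j Z)
  + (2 * k * kscale w) *:
  (dot u Z *: v + dot (j u) Z *: j v - dot v Z *: u - dot (j v) Z *: j u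
   + (2 * k * (dkscale w v * dot (j w) u + kscale w * dot (j v) u)) *:
       (dot w Z *: j w - dot (j w) Z *: w)
   + (2 * k * kscale w * dot (j w) u) *:
       (dot v Z *: j w + dot w Z *: j v - dot (j v) Z *: w - dot (j w) Z *: v)
   - (2 * (dkscale w v * dot (j w) u + kscale w * dot (j v) u)) *: j Z).

Let jj (X : H) : j (j X) = - X.
Proof. by rewrite mulmxA J_sq mulNmx mul1mx. Qed.
Let sw (X Y : H) : dot X (j Y) = - dot (j X) Y.
Proof. by rewrite dot_mulmx J_tr mulNmx dotNr opprK. Qed.
Let jC (X Y : H) : dot (j X) Y = - dot (j Y) X.
Proof. by rewrite -sw dotC. Qed.
Let dotjj (X Y : H) : dot (j X) (j Y) = dot X Y.
Proof. by rewrite sw jj dotNl opprK. Qed.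
Let j_self (X : H) : dot (j X) X = 0.
Proof. by have := jC X X; move: (dot _ _) => a; lra. Qed.

Let dotE := (@dotDl R m, @dotDr R m, @dotZl R m, @dotZr R m, @dotNl R m, @dotNr R m).
Let jZ c (X : H) : j (c *: X) = c *: j X.
Proof. by rewrite scalemxAr. Qed.
Let jE := (@mulmxDr _ _ _ 1 J, @mulmxN _ _ _ 1 J, jZ).
Let nE := (dotjj, jj, sw, @dotNl R m, @dotNr R m, j_self,
  @mulmxN _ _ _ 1 J).

Lemma kcoframe_linear w (c : R) (u v : H) :
  kcoframe w (c *: u + v) = c *: kcoframe w u + kcoframe w v.
Proof.
rewrite /kcoframe dotDr dotZr; move: (J *m w) (kscale _) => p q.
by apply/colP => i; rewrite !mxE; ring.
Qed.

Lemma kconn_linearr w u (c : R) (X Y : H) :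
  kconn w u (c *: X + Y) = c *: kconn w u X + kconn w u Y.
Proof.
rewrite /kconn !(dotDr, dotZr) mulmxDr -(scalemxAr c).
move: (J *m w) (J *m u) (J *m X) (J *m Y) (kscale w) => p q r t x.
move: (dot _ _) (dot _ _) (dot _ _) (dot _ _) => d1 d2 d3 d4.
by apply/colP => i; rewrite !mxE; ring.
Qed.

Lemma kconn_linearl w (Z : H) (c : R) (u v : H) :
  kconn w (c *: u + v) Z = c *: kconn w u Z + kconn w v Z.
Proof.
rewrite /kconn !(mulmxDr, dotDr, dotZr, dotDl, dotZl) -!(scalemxAr c) !(dotDl, dotZl).
move: (J *m w) (J *m u) (J *m v) (J *m Z) (kscale w) => p q r t x.
by apply/colP => i; rewrite !mxE; ring.
Qed.

(** The first structure equation without torsion. *)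
Lemma kcoframe_torsion w u v : 1 + k * dot w w != 0 ->
  dkcoframe w u v - dkcoframe w v u
    + (kconn w u (kcoframe w v) - kconn w v (kcoframe w u)) = 0.
Proof.
move=> q0; apply: dot_ext => W; rewrite dot0l.
rewrite /dkcoframe /kconn /dkscale /kcoframe !jE !dotE !nE.
rewrite !(dotC u w) !(dotC v w) !(dotC v u) !(jC u w) !(jC v w) !(jC v u).
rewrite /kscale; move: q0.
move: (dot w w) (dot w u) (dot w v) (dot u v) (dot (j w) u) (dot (j w) v) (dot (j u) v)
 (dot w W) (dot u W) (dot v W) (dot (j w) W) (dot (j u) W) (dot (j v) W)
 => ww wu wv uv jwu jwv juv wW uW vW jwW juW jvW q0.
by field.
Qed.

(** The Kaehler form is exact, with the primitive
    [u |-> dot (J w) u * kscale w ^+ 2 / 2]. *)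
Lemma kcoframe_area w u v :
  (dot (j u) v * kscale w ^+ 2 + 2 * dot (j w) v * kscale w * dkscale w u)
  - (dot (j v) u * kscale w ^+ 2 + 2 * dot (j w) u * kscale w * dkscale w v)
  = 2 * dot (j (kcoframe w u)) (kcoframe w v).
Proof.
rewrite /kcoframe /dkscale !jE !dotE !nE ?(jC u w) ?(jC v u) ?(dotC u w).
by ring.
Qed.

(** The coframe is a multiple of the identity plus a map of rank one along [J w],
    so that only the component along [J w] matters; it is multiplied by
    [kscale w ^+ 2 * (1 - k |w|^2)]. *)
Lemma kcoframe_inj w u : 1 + k * dot w w != 0 -> 1 - k * dot w w != 0 ->
  kcoframe w u = 0 -> u = 0.
Proof.
move=> q0 q1 E; have q0' : kscale w != 0 by rewrite invr_eq0.
have := congr1 (dot (j w)) E.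
rewrite /kcoframe !dotE !nE dot0r => E1.
have : (1 - k * dot w w) * dot (j w) u = 0.
  have -> : (1 - k * dot w w) * dot (j w) u = (1 + k * dot w w) ^+ 2 *
     (kscale w * dot (j w) u - 2 * k * dot (j w) u * kscale w ^+ 2 * dot w w).
    by rewrite /kscale; field.
  by move: E1; rewrite ?mulrN => ->; rewrite mulr0.
move/eqP; rewrite mulf_eq0 (negbTE q1) /= => /eqP E2.
move: E; rewrite /kcoframe E2 !(mulr0, mul0r) scale0r subr0 => /eqP.
by rewrite scaler_eq0 (negbTE q0') /= => /eqP.
Qed.

Lemma kconn_skew w u Z W : dot (kconn w u Z) W = - dot Z (kconn w u W).
Proof.
rewrite /kconn !dotE !nE !(dotC Z w) !(dotC Z u) !(jC Z w) !(jC Z u).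
by rewrite ?(jC W Z); ring.
Qed.

Lemma kconn_J w u Z : kconn w u (j Z) = j (kconn w u Z).
Proof.
rewrite /kconn !jE !jj !nE.
move: (j w) (j u) (j Z) => a b c.
by apply/colP => i; rewrite !mxE; ring.
Qed.

Let kconn_comb w u Z : kconn w u Z =
  (2 * k * kscale w * (dot u Z - 2 * k * kscale w * dot (j w) u * dot (j w) Z)) *: w
  + (2 * k * kscale w * (dot (j u) Z + 2 * k * kscale w * dot (j w) u * dot w Z)) *: j w
  + (- (2 * k * kscale w * dot w Z)) *: u
  + (- (2 * k * kscale w * dot (j w) Z)) *: j u
  + (- (4 * k * kscale w ^+ 2 * dot (j w) u)) *: j Z.
Proof.
rewrite /kconn; move: (j w) (j u) (j Z) (dot _ _) (dot _ _) (dot _ _) (dot _ _) (dot _ _)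
  => jw ju jZ' a b c d e.
by apply/colP => i; rewrite !mxE; ring.
Qed.

Let dot_comb a b c d e a' b' c' d' e' w u v X Y :
  dot (a *: w + b *: j w + c *: v + d *: j v + e *: j X)
      (a' *: w + b' *: j w + c' *: u + d' *: j u + e' *: j Y) =
  (a * a' + b * b') * dot w w
  + (a * c' + b * d') * dot w u + (b * c' - a * d') * dot (j w) u
  + b * e' * dot w Y - a * e' * dot (j w) Y
  + (c * a' + d * b') * dot w v + (c * b' - d * a') * dot (j w) v
  + (c * c' + d * d') * dot v u + (d * c' - c * d') * dot (j v) u
  + d * e' * dot v Y - c * e' * dot (j v) Y
  + e * b' * dot w X - e * a' * dot (j w) X
  + e * d' * dot u X - e * c' * dot (j u) X + e * e' * dot X Y.
Proof.
rewrite !dotE !nE (dotC v w) (dotC X w) (dotC X u) (jC v w) (jC X w) (jC X u).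
by ring.
Qed.

Let dot_kcoframe w u Z : dot (kcoframe w u) Z =
  kscale w * dot u Z - 2 * k * dot (j w) u * kscale w ^+ 2 * dot (j w) Z.
Proof. by rewrite /kcoframe !dotE. Qed.

Let dot_jkcoframe w u Z : dot (j (kcoframe w u)) Z =
  kscale w * dot (j u) Z + 2 * k * dot (j w) u * kscale w ^+ 2 * dot w Z.
Proof. by rewrite /kcoframe !jE !jj !dotE; ring. Qed.

(** The second structure equation with curvature of constant holomorphic
    sectional curvature: after pairing with [W] it is an identity of rational
    functions of the inner products among the vectors and their images under
    [J]. *)
Lemma kconn_curv w u v Z W : 1 + k * dot w w != 0 ->
  dot (dkconn w u v Z - dkconn w v u Z
       + (kconn w u (kconn w v Z) - kconn w v (kconn w u Z))) W
  = 16 * k * kaehler_form J (kcoframe w u) (kcoframe w v) Z W.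
Proof.
move=> q0; rewrite dotDl (dotDl (kconn w u (kconn w v Z))).
rewrite (dotNl (kconn w v (kconn w u Z))).
rewrite (kconn_skew w u (kconn w v Z)) (kconn_skew w v (kconn w u Z)).
rewrite !kconn_comb !dot_comb.
rewrite /kaehler_form !dot_kcoframe !dot_jkcoframe.
rewrite (dotC (j u) (kcoframe w v)) (dotC w (kcoframe w v)) !dot_kcoframe.
rewrite (dotDl (dkconn w u v Z)) (dotNl (dkconn w v u Z)) /dkconn !dotE /dkscale !nE.
rewrite ?(dotC u w) ?(dotC v w) ?(dotC v u) ?(jC u w) ?(jC v w) ?(jC v u).
rewrite /kscale; move: q0.
move: (dot w w) (dot w u) (dot w v) (dot u v) (dot (j w) u) (dot (j w) v) (dot (j u) v)
 (dot w W) (dot u W) (dot v W) (dot (j w) W) (dot (j u) W) (dot (j v) W)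
 (dot w Z) (dot u Z) (dot v Z) (dot (j w) Z) (dot (j u) Z) (dot (j v) Z) (dot Z W)
 (dot (j Z) W)
 => ww wu wv uv jwu jwv juv wW uW vW jwW juW jvW wZ uZ vZ jwZ juZ jvZ ZW jZW q0.
by field.
Qed.

End KaehlerGauge.

Section DirectionalDerivative.
Context {R : realType} {E : normedModType R}.

(** Differentiability together with the value of the derivative, so that
    derivatives of formulas are computed by composing lemmas. *)
Definition has_derive (F : normedModType R) (f : E -> F) (z v : E) (d : F) : Prop :=
  differentiable f z /\ 'D_v f z = d.

Lemma has_derive_eq (F : normedModType R) (f : E -> F) z v d d' :
  has_derive f z v d -> d = d' -> has_derive f z v d'.
Proof. by move=> fd <-. Qed.

Lemma has_derive_cst (F : normedModType R) (a : F) z v : has_derive (fun=> a) z v 0.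
Proof. by split; [exact: differentiable_cst|exact: derive_cst]. Qed.

Lemma has_deriveD (F : normedModType R) (f g : E -> F) z v df dg :
  has_derive f z v df -> has_derive g z v dg ->
  has_derive (fun y => f y + g y) z v (df + dg).
Proof.
move=> [f1 f2] [g1 g2]; split; first exact: differentiableD.
have E1 := deriveD (diff_derivable (v := v) f1) (diff_derivable (v := v) g1).
exact: etrans E1 (congr2 _ f2 g2).
Qed.

Lemma has_deriveN (F : normedModType R) (f : E -> F) z v df :
  has_derive f z v df -> has_derive (fun y => - f y) z v (- df).
Proof.
move=> [f1 f2]; split; first exact: differentiableN.
have E1 := deriveN (diff_derivable (v := v) f1).
exact: etrans E1 (congr1 _ f2).
Qed.

Lemma has_deriveM (f g : E -> R) z v df dg :
  has_derive f z v df -> has_derive g z v dg ->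
  has_derive (fun y => f y * g y) z v (df * g z + f z * dg).
Proof.
move=> [f1 f2] [g1 g2]; split; first exact: differentiableM.
have E1 := deriveM (diff_derivable (v := v) f1) (diff_derivable (v := v) g1).
apply: etrans E1 _; rewrite f2 g2 addrC mulrC.
by congr (_ + _).
Qed.

Lemma has_deriveV (f : E -> R) z v df : f z != 0 ->
  has_derive f z v df -> has_derive (fun y => (f y)^-1) z v (- df * (f z)^-1 ^+ 2).
Proof.
move=> f0 [f1 f2]; split; first exact: differentiableV.
have E1 := deriveV f0 (diff_derivable (v := v) f1).
apply: etrans E1 _; rewrite f2 /GRing.scale /= exprVn.
by rewrite mulNr mulNr mulrC.
Qed.

Lemma has_derive_mulmx p q r (f : E -> 'M[R]_(p, q)) (g : E -> 'M[R]_(q, r)) z v df dg :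
  has_derive f z v df -> has_derive g z v dg ->
  has_derive (fun y => f y *m g y) z v (df *m g z + f z *m dg).
Proof.
move=> [f1 f2] [g1 g2]; split; first exact: differentiable_mulmx.
apply: etrans (derive_mulmx v f1 g1) _.
exact: (congr2 (fun a b => a *m g z + f z *m b) f2 g2).
Qed.

Lemma has_derive_mulmxl p q r (A : 'M[R]_(p, q)) (g : E -> 'M[R]_(q, r)) z v dg :
  has_derive g z v dg -> has_derive (fun y => A *m g y) z v (A *m dg).
Proof.
move=> gd; apply: has_derive_eq (has_derive_mulmx (has_derive_cst A z v) gd) _.
by rewrite mul0mx add0r.
Qed.

Lemma has_derive_entry p q (f : E -> 'M[R]_(p, q)) z v df i j :
  has_derive f z v df -> has_derive (fun y => f y i j) z v (df i j).
Proof.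
move=> [f1 f2]; split; first exact: (differentiable_mxP f z).1 f1 i j.
by rewrite -f2; apply: esym; apply: derive_mxE; exact: diff_derivable.
Qed.

Lemma has_derive_scale p q (g : E -> R) (f : E -> 'M[R]_(p, q)) z v dg df :
  has_derive g z v dg -> has_derive f z v df ->
  has_derive (fun y => g y *: f y) z v (dg *: f z + g z *: df).
Proof.
move=> gd fd.
have E1 i j : has_derive (fun y => (g y *: f y) i j) z v ((dg *: f z + g z *: df) i j).
  have -> : (fun y => (g y *: f y) i j) = (fun y => g y * f y i j).
    by apply/funext => y; rewrite mxE.
  by apply: has_derive_eq (has_deriveM gd (has_derive_entry i j fd)) _; rewrite !mxE.
have dgf : differentiable (fun y => g y *: f y) z.
  by apply/differentiable_mxP => i j; case: (E1 i j).
split; first exact: dgf.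
apply/matrixP => i j; have [_ <-] := E1 i j.
by apply: derive_mxE; exact: diff_derivable.
Qed.

Lemma has_derive_dot m (f g : E -> 'cV[R]_m) z v df dg :
  has_derive f z v df -> has_derive g z v dg ->
  has_derive (fun y => dot (f y) (g y)) z v (dot df (g z) + dot (f z) dg).
Proof.
move=> [f1 f2] gd.
have fd : has_derive (fun y => (f y)^T) z v df^T.
  split; first exact: differentiable_trmx.
  exact: etrans (derive_trmx v f1) (congr1 _ f2).
apply: has_derive_eq (has_derive_entry 0 0 (has_derive_mulmx fd gd)) _.
by rewrite /dot mxE.
Qed.

End DirectionalDerivative.

Lemma has_derive_id (R : realType) m (z v : 'cV[R]_m) : has_derive id z v v.
Proof. by split; [exact: ex_diff|exact: derive_id]. Qed.

Ltac has_derive_tac := repeat first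
  [ eassumption | apply: has_derive_cst | apply: has_derive_id
  | apply: has_deriveD | apply: has_deriveN | apply: has_deriveM
  | apply: has_derive_scale | apply: has_derive_dot | apply: has_derive_mulmxl ].

Section KaehlerGaugeDerivative.
Context {R : realType} {m N : nat} (J : 'M[R]_m) (A : 'M[R]_(m, N)) (k : R).
Variables (z v : 'cV[R]_N).
Local Notation w := (A *m z).
Hypothesis rho0 : 1 + k * dot w w != 0.

Lemma has_derive_kscale :
  has_derive (fun y => kscale k (A *m y)) z v (dkscale k w (A *m v)).
Proof.
apply: has_derive_eq; first by apply: has_deriveV; [exact: rho0|has_derive_tac].
by rewrite /dkscale /kscale (dotC (A *m v)); ring.
Qed.

Lemma has_derive_kcoframe u :
  has_derive (fun y => kcoframe J k (A *m y) u) z v (dkcoframe J k w (A *m v) u).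
Proof.
have Q := has_derive_kscale.
apply: has_derive_eq; first by rewrite /kcoframe; has_derive_tac.
rewrite /dkcoframe scaler0 addr0 dot0r.
move: (J *m w) (J *m _) (kscale k w) (dkscale k w _) => a b c d.
by apply/colP => i; rewrite !mxE; ring.
Qed.

Lemma has_derive_kconn u Z :
  has_derive (fun y => kconn J k (A *m y) u Z) z v (dkconn J k w (A *m v) u Z).
Proof.
have Q := has_derive_kscale.
apply: has_derive_eq; first by rewrite /kconn; has_derive_tac.
rewrite /dkconn !(scaler0, dot0r).
move: (w) (A *m v) (J *m w) (J *m (A *m v)) (kscale k w) (dkscale k w _) (J *m u) (J *m Z)
 => g h a b c d e f.
by apply/colP => i; rewrite !mxE; ring.
Qed.

End KaehlerGaugeDerivative.

(** * Connections on a ball *)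

Section RadialContinuity.
Context {R : realType} {E : normedModType R}.

Lemma affine_norm_continuous (c : R) : continuous (fun z : E => 1 + c * `|z|).
Proof.
move=> z; apply: cvgD; first exact: cvg_cst.
by apply: cvgM; [exact: cvg_cst|exact: norm_continuous].
Qed.

Lemma radial_continuous (c : R) (z : E) : 1 + c * `|z| != 0 ->
  {for z, continuous (fun z => (1 + c * `|z|)^-1 *: z)}.
Proof.
move=> z0; apply: cvgZ; last exact: cvg_id.
by apply: cvgV; [exact: z0|exact: affine_norm_continuous].
Qed.

End RadialContinuity.

Section VectorTopology.
Context {R : realType} {N : nat}.
Local Notation E := 'cV[R]_N.

Lemma rational_approximation (x : E) (r : R) : 0 < r ->
  exists q : 'cV[rat]_N, ball (map_mx ratr q : E) r x.
Proof.
move=> r0; have /choice[q qP] : forall i, exists q : rat,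
    x i 0 - r < ratr q < x i 0 + r.
  move=> i; have lt_r : x i 0 - r < x i 0 + r by lra.
  by have [q qP] := rat_in_itvoo lt_r; exists q; rewrite in_itv in qP.
exists (\col_i q i); split=> // i j; rewrite ord1 !mxE /ball /= ltr_distl.
by have /andP[q1 q2] := qP i; apply/andP; split; lra.
Qed.

(** Balls with rational centres and radii [1 / (m + 1)] form a basis. *)
Lemma column_second_countable : @second_countable E.
Proof.
pose B := range (fun p : 'cV[rat]_N * nat =>
  (ball (map_mx ratr p.1 : E) (p.2.+1%:R^-1 : R))°).
exists B; first by apply: card_le_trans (card_image_le _ _) _; exact: countableP.
split=> [_ [p _ <-]|x O /nbhs_ballP[_/posnumP[e] eO]]; first exact: open_interior.
have [//|m] := @ltr_add_invr R 0%R (e%:num / 2) _; rewrite add0r => me.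
have m0 : 0 < (m.+1%:R^-1 : R) by [].
have [q qx] := rational_approximation x m0.
exists (ball (map_mx ratr q : E) (m.+1%:R^-1 : R))°; first split.
- by exists (q, m).
- rewrite /interior; apply: open_nbhs_nbhs; split=> //.
  exact: (@ball_open R E).
move=> y /interior_subset qy; apply: eO.
rewrite [e%:num]splitr; apply: (@ball_triangle R E (map_mx ratr q)).
  by apply: (le_ball (ltW me)); exact: ball_sym.
exact: le_ball (ltW me) _ qy.
Qed.

End VectorTopology.

(** The ball [s * |w| < 1] as a manifold with one chart.  The carrier is the whole
    vector space, which a radial homeomorphism identifies with the ball; this
    equips the ball with a topology without passing to a subtype. *)
Section BallManifold.
Context {R : realType} {N : nat} (s : R).
Hypothesis s0 : 0 <= s.
Local Notation E := 'cV[R]_N.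

Definition open_ball : set E := [set w | s * `|w| < 1].
Definition to_ball (z : E) : E := (1 + s * `|z|)^-1 *: z.
Definition of_ball (w : E) : E := (1 - s * `|w|)^-1 *: w.

Let den0 (z : E) : 0 < 1 + s * `|z|.
Proof. by rewrite ltr_wpDr // mulr_ge0. Qed.

Let norm_to_ball z : 1 - s * `|to_ball z| = (1 + s * `|z|)^-1.
Proof.
rewrite normrZ gtr0_norm ?invr_gt0 //.
by field; rewrite gt_eqF.
Qed.

Lemma to_ballK z : of_ball (to_ball z) = z.
Proof.
by rewrite /of_ball norm_to_ball invrK scalerA divff ?scale1r // gt_eqF.
Qed.

Lemma of_ballK w : open_ball w -> to_ball (of_ball w) = w.
Proof.
rewrite /open_ball /= => w1; have w0 : 0 < 1 - s * `|w| by lra.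
rewrite /to_ball /of_ball normrZ gtr0_norm ?invr_gt0 // scalerA.
have -> : (1 + s * ((1 - s * `|w|)^-1 * `|w|))^-1 * (1 - s * `|w|)^-1 = 1.
  by field; rewrite gt_eqF //= (_ : _ + _ = 1) ?oner_eq0 //; ring.
by rewrite scale1r.
Qed.

Lemma to_ball_image : to_ball @` setT = open_ball.
Proof.
apply/seteqP; split=> [_ [z _ <-]|w Bw].
  rewrite /open_ball /= -subr_gt0 norm_to_ball invr_gt0 //.
by exists (of_ball w); rewrite ?of_ballK.
Qed.

Lemma open_open_ball : open open_ball.
Proof.
have -> : open_ball = (fun z : E => 1 + (- s) * `|z|) @^-1` [set t | 0 < t].
  by apply/seteqP; split=> w; rewrite /open_ball /= => ?; lra.
by apply: open_comp; [move=> z _; exact: affine_norm_continuous|exact: open_gt].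
Qed.

Let chart_open : open (to_ball @` setT).
Proof. by rewrite to_ball_image; exact: open_open_ball. Qed.

Let to_ball_continuous z : [set: E] z -> {for z, continuous to_ball}.
Proof.
by move=> _; apply: radial_continuous; rewrite gt_eqF.
Qed.

Let of_ball_continuous w : (to_ball @` setT) w -> {for w, continuous of_ball}.
Proof.
rewrite to_ball_image /open_ball /= => w1.
have -> : of_ball = (fun z => (1 + (- s) * `|z|)^-1 *: z).
  by apply/funext => z; rewrite mulNr.
by apply: radial_continuous; rewrite gt_eqF //; lra.
Qed.

Definition ball_chart : chart R N E := Chart openT chart_open
  (fun z _ => to_ballK z) to_ball_continuous of_ball_continuous.

Let ball_compatible c d : c = ball_chart -> d = ball_chart ->
  smooth (chart_map c @` (chart_dom c `&` chart_dom d)) (chart_map d \o chart_inv c).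
Proof.
move=> -> ->; rewrite /= setIT to_ball_image.
apply: smooth_eq open_open_ball _ (smooth_id _) => w Bw.
by rewrite /= of_ballK.
Qed.

Definition ball_manifold : manifold R N :=
  @Manifold R N E (fun c => c = ball_chart) (fun=> ball_chart) (fun=> erefl) (fun _ => I)
    ball_compatible (@norm_hausdorff R E) column_second_countable (ex_intro _ 0 I).

End BallManifold.

(** A connection on the ball, given by a coframe [F] and by connection matrices
    [L] with respect to the frame dual to it. *)
Section GaugeConnection.
Context {R : realType} {N : nat} (s : R).
Hypothesis s0 : 0 <= s.
Local Notation E := 'cV[R]_N.
Local Notation gl := 'M[R]_N.
Local Notation M := (ball_manifold (N := N) s0).
Local Notation c := (ball_chart (N := N) s0 : chart R N M).
Local Notation ball := (@open_ball R N s).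
Local Notation pt := (@of_ball R N s).
Local Notation co := (@to_ball R N s).
Implicit Types (x y : M) (z u v w : E).

Variables (F : E -> gl) (L : E -> E -> gl).
Hypotheses (F_unit : forall z, ball z -> F z \in unitmx) (F_smooth : smooth ball F).
Hypotheses (L_smooth : forall u, smooth ball (L u))
  (L_lin : forall z (a : R) u v, L (a *: u + v) z = a *: L u z + L v z).

Let oB : open ball. Proof. exact: open_open_ball. Qed.
Let ptK x : pt (co x) = x. Proof. exact: to_ballK. Qed.
Let coK z : ball z -> co (pt z) = z. Proof. exact: of_ballK. Qed.
Let coB x : ball (co x). Proof. by rewrite -to_ball_image //; exists x. Qed.

Let imageE (U : set M) : image_in c U = [set z | ball z /\ U (pt z)].
Proof.
apply/seteqP; split=> [_ [x [_ Ux] <-]|z [Bz Uz]] /=.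
  by rewrite ptK; split=> //; exact: coB.
by exists (pt z) => //; exact: coK.
Qed.

Let fieldE (X : vfield M) z : ball z -> field_in_chart c X z = X (pt z).
Proof. by move=> Bz; apply: coord_change_id. Qed.

Let oI (U : set M) : open U -> open (image_in c U).
Proof. exact: open_image_in. Qed.

Let Iz (U : set M) x : U x -> image_in c U (co x).
Proof. by move=> Ux; rewrite imageE /= ptK; split=> //; exact: coB. Qed.

Let IB (U : set M) : image_in c U `<=` ball.
Proof. by rewrite imageE => z []. Qed.

Lemma smooth_field_ball (U : set M) (X : vfield M) : open U ->
  smooth_field U X <-> smooth (image_in c U) (fun z => X (pt z)).
Proof.
move=> oU; split=> [sX|sX _ ->].
  by apply: smooth_eq (oI oU) _ (sX c erefl) => z /IB; exact: fieldE.
by apply: smooth_eq (oI oU) _ sX => z /IB Bz; rewrite fieldE.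
Qed.

Definition dual_frame x : gl := invmx (F (co x)).

Local Notation G Y := (fun y : E => F y *m Y (pt y)).

Definition gauge_connection : cov_deriv M := fun x v Y =>
  dual_frame x *m ('D_v (G Y) (co x) + L v (co x) *m (F (co x) *m Y x)).

Let smooth_G (U : set M) (Y : vfield M) : open U -> smooth_field U Y ->
  smooth (image_in c U) (G Y).
Proof.
move=> oU /(smooth_field_ball _ oU) sY.
exact: smooth_mulmx (oI oU) (smooth_sub (@IB U) F_smooth) sY.
Qed.

Let diff_G (U : set M) (Y : vfield M) x : open U -> U x -> smooth_field U Y ->
  differentiable (G Y) (co x).
Proof. move=> oU Ux sY; exact: smooth_differentiable (smooth_G oU sY) (Iz Ux). Qed.

Let gauge_linear x (U : set M) (Y : vfield M) : open U -> U x -> smooth_field U Y ->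
  forall (a : R) v w, gauge_connection x (a *: v + w) Y
    = a *: gauge_connection x v Y + gauge_connection x w Y.
Proof.
move=> oU Ux sY a v w; rewrite /gauge_connection.
have E1 := derive_linear (diff_G oU Ux sY) a v w.
rewrite E1 L_lin; move: ('D_v _ _) ('D_w _ _) => A B.
rewrite scalemxAr -mulmxDr; congr (_ *m _).
rewrite (mulmxDl (a *: L v _)) -scalemxAl.
move: (L v _ *m _) (L w _ *m _) => C D.
by apply/colP => i; rewrite !mxE; ring.
Qed.

Let gauge_additive x (U : set M) (Y Z : vfield M) v : open U -> U x ->
  smooth_field U Y -> smooth_field U Z ->
  gauge_connection x v (fun y => Y y + Z y)
    = gauge_connection x v Y + gauge_connection x v Z.
Proof.
move=> oU Ux sY sZ; rewrite /gauge_connection.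
have -> : G (fun y => Y y + Z y) = (fun y => F y *m Y (pt y) + F y *m Z (pt y)).
  by apply/funext => y; rewrite mulmxDr.
have E1 := deriveD (diff_derivable (v := v) (diff_G oU Ux sY))
  (diff_derivable (v := v) (diff_G oU Ux sZ)).
rewrite -mulmxDr (mulmxDr (F _)) (mulmxDr (L v _)).
have aux (a b p q : E) : (a + b) + (p + q) = (a + p) + (b + q) by rewrite addrACA.
exact: etrans (congr1 (fun A => dual_frame x *m (A + _)) E1)
  (congr1 (fun A => dual_frame x *m A) (aux _ _ _ _)).
Qed.

Let gauge_Leibniz x (U : set M) (f : M -> R) (Y : vfield M) v : open U -> U x ->
  smooth_function U f -> smooth_field U Y ->
  gauge_connection x v (fun y => f y *: Y y)
    = dir_deriv x v f *: Y x + f x *: gauge_connection x v Y.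
Proof.
move=> oU Ux sf sY; rewrite /gauge_connection.
have -> : G (fun y => f y *: Y y) = (fun y => f (pt y) *: (F y *m Y (pt y))).
  by apply/funext => y; rewrite scalemxAr.
have df : has_derive (f \o pt) (co x) v (dir_deriv x v f).
  by split=> //; exact: smooth_differentiable (sf c erefl) (Iz Ux).
have dG : has_derive (G Y) (co x) v ('D_v (G Y) (co x)).
  by split=> //; exact: diff_G oU Ux sY.
have [_ E1] := has_derive_scale df dG; move: E1; rewrite /= ptK.
move=> E1; apply: etrans (congr1 (fun A => dual_frame x *m (A + _)) E1) _.
move: ('D_v (G Y) (co x)) (dir_deriv x v f) => A d.
rewrite -!scalemxAr -addrA -scalerDr mulmxDr -!scalemxAr; congr (_ *: _ + _).
by rewrite mulKmx //; apply: F_unit; exact: coB.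
Qed.

Let gauge_local x (U : set M) (Y Z : vfield M) v : open U -> U x ->
  smooth_field U Y -> (forall y, U y -> Y y = Z y) ->
  gauge_connection x v Y = gauge_connection x v Z.
Proof.
move=> oU Ux _ YZ; rewrite /gauge_connection (YZ x Ux).
have YZ' y : image_in c U y -> (G Y) y = (G Z) y.
  by rewrite imageE => -[_ Uy]; rewrite (YZ _ Uy).
have E1 := open_eq_derive v (oI oU) (Iz Ux) YZ'.
have E2 := congr1 (fun A : E => dual_frame x *m (A + L v (co x) *m (F (co x) *m Z x))) E1.
exact: E2.
Qed.

Let gauge_smooth (U : set M) (X Y : vfield M) : open U ->
  smooth_field U X -> smooth_field U Y ->
  smooth_field U (fun x => gauge_connection x (X x) Y).
Proof.
move=> oU sX sY; apply/(smooth_field_ball _ oU).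
have oO := oI oU; have sG := smooth_G oU sY.
have sX' := (smooth_field_ball X oU).1 sX.
have sF := smooth_sub (@IB U) F_smooth.
have sFV : smooth (image_in c U) (fun y => invmx (F y)).
  by apply: smooth_invmx oO _ sF => y /IB; exact: F_unit.
have sD : smooth (image_in c U) (fun y => lmx (fun v => 'D_v (G Y) y)).
  apply/(smooth_mxP _ oO) => i j.
  have := (smooth_mxP _ oO).1 (smooth_derive (delta_mx j 0) sG) i 0.
  by apply: smooth_eq oO _ => y _; rewrite mxE.
have sL : smooth (image_in c U) (fun y => lmx (fun v => L v y *m (G Y) y)).
  apply/(smooth_mxP _ oO) => i j.
  have s1 := smooth_mulmx oO (smooth_sub (@IB U) (L_smooth (delta_mx j 0))) sG.
  have := (smooth_mxP _ oO).1 s1 i 0.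
  by apply: smooth_eq oO _ => y _; rewrite [in RHS]mxE.
have S := smooth_mulmx oO sFV (smoothD oO (smooth_mulmx oO sD sX')
  (smooth_mulmx oO sL sX')).
apply: smooth_eq oO _ S => y Iy; have By := IB Iy.
rewrite /gauge_connection /dual_frame coK //.
have dG := smooth_differentiable sG Iy.
have E1 := esym (lmxE (derive_linear dG) (X (pt y))).
have lL (a : R) u v : L (a *: u + v) y *m (G Y) y =
    a *: (L u y *m (G Y) y) + L v y *m (G Y) y.
  by rewrite L_lin mulmxDl -scalemxAl.
have E2 := esym (lmxE lL (X (pt y))).
have E3 := congr2 (fun A B : E => invmx (F y) *m (A + B)) E1 E2.
exact: E3.
Qed.

Lemma gauge_affine_connection : affine_connection gauge_connection.
Proof.
by split; [exact: gauge_linear|exact: gauge_additive|exact: gauge_Leibniz|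
  exact: gauge_local|exact: gauge_smooth].
Qed.

Lemma dual_frame_unit x : dual_frame x \in unitmx.
Proof. by rewrite unitmx_inv; apply: F_unit; exact: coB. Qed.

Lemma smooth_dual_frame : smooth_frame setT dual_frame.
Proof.
move=> w; apply/(smooth_field_ball _ openT).
have sB := @IB setT; have oO := oI openT.
have sFV : smooth (image_in c setT) (fun y => invmx (F y)).
  by apply: smooth_invmx oO _ (smooth_sub sB F_smooth) => y /sB; exact: F_unit.
apply: smooth_eq oO _ (smooth_mulmx oO sFV (smooth_cst _ w)) => y /sB By.
by rewrite /dual_frame coK.
Qed.

(** The connection is defined so that its connection matrices in [dual_frame] are
    the prescribed ones: the columns of the dual frame have constant components. *)
Lemma Lam_gauge x v : Lam gauge_connection dual_frame x v = L v (co x).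
Proof.
apply: mx_ext_delta => j; rewrite Lam_col; move: (delta_mx j 0) => w.
rewrite /gauge_connection mulKmx ?dual_frame_unit //.
have -> : F (co x) *m (dual_frame x *m w) = w.
  by rewrite mulKVmx //; apply: F_unit; exact: coB.
have -> : 'D_v (fun y : E => F y *m (dual_frame (pt y) *m w)) (co x) = 0.
  have E1 : 'D_v (fun=> w) (co x) = 0 by exact: derive_cst.
  rewrite -E1; apply: (open_eq_derive v oB (coB x)) => y By.
  by rewrite /dual_frame coK // mulKVmx //; exact: F_unit.
by rewrite add0r.
Qed.

Let extE x u y : extend x u y = u.
Proof. by apply: coord_change_id. Qed.

Let gFE x z : ball z -> coframe x dual_frame z = F z.
Proof.
move=> Bz; rewrite /coframe /ext_frame ccmx_id // mulmx1 /dual_frame invmxK.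
by rewrite /= coK.
Qed.

Let gLE' x u z : ball z -> conn_form gauge_connection x dual_frame u z = L u z.
Proof. by move=> Bz; rewrite /conn_form extE Lam_gauge /= coK. Qed.

Let sU y : setT y -> dual_frame y \in unitmx.
Proof. by move=> _; exact: dual_frame_unit. Qed.

Lemma gauge_torsion x u v : torsion_at gauge_connection x u v = dual_frame x *m
  (('D_u F (co x) *m v + L u (co x) *m (F (co x) *m v))
   - ('D_v F (co x) *m u + L v (co x) *m (F (co x) *m u))).
Proof.
have conn := gauge_affine_connection.
have Oz : frame_dom x setT (co x) := mem_chart_pt (I : setT x).
have E1 := structure1 conn openT smooth_dual_frame sU u v Oz.
have DE w : 'D_w (coframe x dual_frame) (co x) = 'D_w F (co x).
  by apply: (open_eq_derive w oB (coB x)) => y; exact: gFE.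
have Fz : coframe x dual_frame (co x) = F (co x) by exact: gFE (coB x).
have sF w : dual_frame x *m (coframe x dual_frame (co x) *m w) = w.
  by rewrite Fz mulKmx //; apply: F_unit; exact: coB.
pose f (a b l l' g : gl) := (a *m v + l *m (g *m v)) - (b *m u + l' *m (g *m u)).
have E2 := congr2 (fun a b => f a b (conn_form gauge_connection x dual_frame u (co x))
  (conn_form gauge_connection x dual_frame v (co x)) (coframe x dual_frame (co x))) (DE u) (DE v).
have E3 := congr2 (fun l l' => f ('D_u F (co x)) ('D_v F (co x)) l l'
  (coframe x dual_frame (co x))) (gLE' x u (coB x)) (gLE' x v (coB x)).
have E4 := congr1 (f ('D_u F (co x)) ('D_v F (co x)) (L u (co x)) (L v (co x))) Fz.
have T1 : torsion_at gauge_connection (pt (co x) : M)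
    (dual_frame (pt (co x)) *m (coframe x dual_frame (co x) *m u))
    (dual_frame (pt (co x)) *m (coframe x dual_frame (co x) *m v))
  = torsion_at gauge_connection x u v.
  have -> : pt (co x) = x by exact: ptK.
  have E0 := congr2 (fun a b => torsion_at gauge_connection x a b) (sF u) (sF v).
  exact: E0.
have E5 := congr1 (mulmx (dual_frame x)) (etrans E2 (etrans E3 E4)).
have E6 := congr1 (fun y => dual_frame y *m f ('D_u (coframe x dual_frame) (co x))
  ('D_v (coframe x dual_frame) (co x)) (conn_form gauge_connection x dual_frame u (co x))
  (conn_form gauge_connection x dual_frame v (co x)) (coframe x dual_frame (co x))) (ptK x).
have E7 := etrans (esym T1) (etrans (esym E1) (etrans E6 E5)).
exact: E7.
Qed.

Lemma gauge_curvature x u v w : curvature_at gauge_connection x u v w =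
  dual_frame x *m (('D_u (L v) (co x) - 'D_v (L u) (co x)
    + (L u (co x) *m L v (co x) - L v (co x) *m L u (co x))) *m (F (co x) *m w)).
Proof.
have conn := gauge_affine_connection.
have E1 := structure2 conn openT (I : setT x) smooth_dual_frame sU u v w.
have DE u' v' : 'D_u' (conn_form gauge_connection x dual_frame v') (chart_pt x)
    = 'D_u' (L v') (co x).
  by apply: (open_eq_derive u' oB (coB x)) => y; exact: gLE'.
pose f (a b p q : gl) := a - b + (p *m q - q *m p).
have E2 := congr2 (fun a b => f a b (conn_form gauge_connection x dual_frame u (chart_pt x))
  (conn_form gauge_connection x dual_frame v (chart_pt x))) (DE u v) (DE v u).
have E3 := congr2 (f ('D_u (L v) (co x)) ('D_v (L u) (co x)))
  (gLE' x u (coB x)) (gLE' x v (coB x)).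
have E4 : invmx (dual_frame x) = F (co x) by exact: invmxK.
apply: etrans E1 _; rewrite E4.
have E5 := congr1 (fun A => dual_frame x *m (A *m (F (co x) *m w))) (etrans E2 E3).
exact: E5.
Qed.

End GaugeConnection.

(** * Models with arbitrary Kaehler parameter *)

Lemma unitmx_inj (K : fieldType) m (A : 'M[K]_m) :
  (forall u : 'cV[K]_m, A *m u = 0 -> u = 0) -> A \in unitmx.
Proof.
move=> A0; rewrite -unitmx_tr -row_free_unit -kermx_eq0; apply/eqP/row_matrixP => i.
apply/trmx_inj; rewrite row0 trmx0; apply: A0.
by rewrite -[A in A *m _]trmxK -trmx_mul -row_mul mulmx_ker row0 trmx0.
Qed.

Lemma dot_le_norm (R : realType) m (u : 'cV[R]_m) (r : R) :
  (forall i, `|u i 0| <= r) -> dot u u <= m%:R * r ^+ 2.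
Proof.
move=> ur; have H i : u i 0 * u i 0 <= r ^+ 2.
  by rewrite -expr2 -real_normK ?num_real // lerXn2r ?nnegrE // (le_trans _ (ur i)).
have S : \sum_i u i 0 * u i 0 <= \sum_(i < m) r ^+ 2.
  by apply: ler_sum => i _; exact: H.
rewrite dotE (le_trans S) //.
by rewrite sumr_const card_ord mulr_natl.
Qed.

Section SmoothDot.
Context {R : realType} {E : normedModType R} {m : nat}.

Lemma smooth_dot (O : set E) (f g : E -> 'cV[R]_m) : open O ->
  smooth O f -> smooth O g -> smooth O (fun y => dot (f y) (g y)).
Proof.
move=> oO sf sg.
have := (smooth_mxP _ oO).1 (smooth_mulmx oO (smooth_trmx oO sf) sg) 0 0.
by apply: smooth_eq.
Qed.

Lemma smooth_sqr (O : set E) (f : E -> R) : open O ->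
  smooth O f -> smooth O (fun y => f y ^+ 2).
Proof. by move=> oO sf; exact: smoothM. Qed.

End SmoothDot.

Ltac smooth_tac := repeat first
  [ eassumption | apply: smooth_cst | apply: smoothD | apply: smoothN
  | apply: smooth_sqr | apply: smoothM | apply: smooth_scalemx
  | apply: smooth_dot | apply: smooth_mulmx ].

Section SmoothGauge.
Context {R : realType} {m N : nat} (J : 'M[R]_m) (A : 'M[R]_(m, N)) (k : R).
Variable O : set 'cV[R]_N.
Hypotheses (oO : open O) (O0 : forall z, O z -> 1 + k * dot (A *m z) (A *m z) != 0).

Let smooth_lin : smooth O (fun z : 'cV[R]_N => A *m z).
Proof. exact: smooth_mulmx oO (smooth_cst O A) (@smooth_id _ _ O). Qed.

Lemma smooth_kscale : smooth O (fun z => kscale k (A *m z)).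
Proof. by apply: smoothV => //; smooth_tac. Qed.

Lemma smooth_kcoframe u : smooth O (fun z => kcoframe J k (A *m z) u).
Proof. have Q := smooth_kscale; rewrite /kcoframe; smooth_tac. Qed.

Lemma smooth_kconn u Z : smooth O (fun z => kconn J k (A *m z) u Z).
Proof. have Q := smooth_kscale; rewrite /kconn; smooth_tac. Qed.

End SmoothGauge.

Section HorizontalProjection.
Context {R : realType} {n : nat}.
Local Notation V := 'cV[R]_(n + n + 1).
Local Notation H := 'cV[R]_(n + n).
Local Notation ee := (@e0 R n).
Local Notation J := (@J0mx R n).

(** The matrix of the projection to the horizontal space, for use in the matrix
    calculus. *)
Definition hproj : 'M[R]_(n + n, n + n + 1) := row_mx 1%:M 0.

Lemma hprojE (u : V) : hproj *m u = usubmx u.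
Proof. by rewrite /hproj -{1}(vsubmxK u) mul_row_col mul1mx mul0mx addr0. Qed.
Lemma hproj_tr (X : H) : hproj^T *m X = hor X.
Proof. by rewrite /hproj tr_row_mx trmx1 trmx0 mul_col_mx mul1mx mul0mx. Qed.
Lemma hproj_hor (X : H) : hproj *m hor X = X.
Proof. by rewrite hprojE /hor col_mxKu. Qed.
Lemma hproj_e0 : hproj *m ee = 0.
Proof. by rewrite hprojE /e0 col_mxKu. Qed.
Lemma hor_hproj (u : V) : hor (hproj *m u) = prj u.
Proof. by rewrite hprojE hor_usub. Qed.
Lemma om_hproj (u v : V) : dot (J *m (hproj *m u)) (hproj *m v) = om u v.
Proof. by rewrite -(om_prjl u) -(om_prjr _ v) -!hor_hproj om_hor. Qed.
Lemma hproj_J (u : V) : hproj *m (Jmx *m u) = J *m (hproj *m u).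
Proof. by rewrite -[Jmx *m u]J_prj -hor_hproj -hor_J0 hproj_hor. Qed.

Lemma hor_comb (p q r t : H) : p - q + (r - t) = 0 ->
  hor p - hor q + (hor r - hor t) = 0 :> V.
Proof. by move=> E; rewrite -!horN -!horD E /hor col_mx0. Qed.

Lemma hor_comb_scale (c : R) (p q r t K : H) : p - q = c *: K - (r - t) ->
  hor p - hor q = c *: hor K - (hor r - hor t) :> V.
Proof. by move=> E; rewrite -horZ -!horN -!horD -horN -horD E. Qed.

End HorizontalProjection.

Section KaehlerModel.
Context {R : realType} {n : nat}.
Local Notation V := 'cV[R]_(n + n + 1).
Local Notation gl := 'M[R]_(n + n + 1).
Local Notation H := 'cV[R]_(n + n).
Local Notation ee := (@e0 R n).
Local Notation J := (@J0mx R n).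
Variables (a b be ga de kappa : R).
Local Notation la := (@lam R n a b a be ga de).
Local Notation lc := (@lamcurv R n a b a be ga de).

Local Notation k := (kappa / 16).
Local Notation A := (@hproj R n).

(** The differential [dt] corrected by a primitive of the Kaehler form, so that
    its exterior derivative is [- 2 * de] times the Kaehler form. *)
Definition vertical_coframe (z u : V) : R :=
  ec u - de * (dot (J *m (A *m z)) (A *m u) * kscale k (A *m z) ^+ 2).

Definition model_coframe (z : V) : gl := lmx (fun u =>
  A^T *m kcoframe J k (A *m z) (A *m u) + vertical_coframe z u *: ee).

(** The u(n)-part of the connection.  The second term cancels the horizontal part
    of the torsion that [lam] causes. *)
Definition model_gauge (u z : V) : gl := lmx (fun Z =>
  A^T *m kconn J k (A *m z) (A *m u) (A *m Z)
  + (be * vertical_coframe z u) *: (Jmx *m Z)).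

Definition model_connection (u z : V) : gl :=
  la (model_coframe z *m u) + model_gauge u z.

Local Notation th := vertical_coframe.
Local Notation F := model_coframe.
Local Notation G := model_gauge.

Let th_lin z (c : R) (u v : V) : th z (c *: u + v) = c * th z u + th z v.
Proof. by rewrite /th mulmxDr -scalemxAr dotDr dotZr ecD ecZ; ring. Qed.

Lemma model_coframeE z u : F z *m u = hor (kcoframe J k (A *m z) (A *m u)) + th z u *: ee.
Proof.
rewrite -lmxE => [|c v w]; first by rewrite hproj_tr.
rewrite th_lin (mulmxDr A) -(scalemxAr _ A) kcoframe_linear !hproj_tr horD horZ.
move: (hor _) (hor _) (ee) => p q e.
by apply/colP => i; rewrite !mxE; ring.
Qed.

Lemma model_gaugeE u z Z : G u z *m Z =
  hor (kconn J k (A *m z) (A *m u) (A *m Z)) + (be * th z u) *: (Jmx *m Z).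
Proof.
rewrite -lmxE => [|c X Y]; first by rewrite hproj_tr.
rewrite (mulmxDr A) -(scalemxAr _ A) kconn_linearr (mulmxDr Jmx).
rewrite -(scalemxAr _ Jmx) !hproj_tr horD horZ.
move: (hor _) (hor _) (Jmx *m X) (Jmx *m Y) => p q r t.
by apply/colP => i; rewrite !mxE; ring.
Qed.

Lemma model_gauge_linear z (c : R) u v : G (c *: u + v) z = c *: G u z + G v z.
Proof.
apply: mx_ext => Z; rewrite mulmxDl -scalemxAl !model_gaugeE th_lin.
rewrite (mulmxDr A) -(scalemxAr _ A) kconn_linearl horD horZ.
move: (hor _) (hor _) (Jmx *m Z) => p q r.
by apply/colP => i; rewrite !mxE; ring.
Qed.

Lemma model_connection_linear z (c : R) u v :
  model_connection (c *: u + v) z = c *: model_connection u z + model_connection v z.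
Proof.
rewrite /model_connection model_gauge_linear mulmxDr -scalemxAr lam_linear.
by rewrite scalerDr addrACA.
Qed.

Lemma model_gauge_unitary u z : unitary_algebra (G u z).
Proof.
apply/unitary_algebraP; split.
- apply: mx_ext => Z; apply: dot_ext => W; rewrite mulNmx dotNl dot_mulmx trmxK.
  rewrite !model_gaugeE dotDr dotZr dotDl dotZl.
  have E (X : H) (U : V) : dot (hor X) U = dot X (A *m U)
    by rewrite {1}(hor_e0 U) dotDr dotZr dot_er ec_hor mulr0 addr0 dot_hor hprojE.
  rewrite (dotC Z) !E (kconn_skew (@J0mx_tr R n)) dotJ.
  by rewrite (dotC (A *m W)); ring.
- apply: mx_ext => Z; rewrite -!mulmxA !model_gaugeE hproj_J.
  rewrite (kconn_J (@J0mx_tr R n) (@J0mx_sq R n) k).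
  have e (c : R) (X : H) (U : V) : Jmx *m (hor X + c *: U) =
      hor (J *m X) + c *: (Jmx *m U) by rewrite mulmxDr -scalemxAr -hor_J0.
  by rewrite e.
- rewrite model_gaugeE hproj_e0 Jmx_e0 scaler0 addr0.
  have -> : kconn J k (A *m z) (A *m u) 0 = 0.
    by rewrite /kconn !dot0r mulmx0 !(scale0r, scaler0, subr0, addr0).
  by rewrite /hor col_mx0.
Qed.

(** The tensor [Kcurv], extended by zero in the direction of [e]. *)
Definition kaehler_curv (c d Z : V) : V := 4^-1 *:
  (dot (prj d) Z *: prj c - dot (prj c) Z *: prj d + om d Z *: (Jmx *m c)
   - om c Z *: (Jmx *m d) - (2 * om c d) *: (Jmx *m Z)).

Definition model_curvature (c d : V) : gl :=
  lc c d + (kappa *: lmx (kaehler_curv c d) - (2 * be * de * om c d) *: Jmx).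

Lemma kaehler_curvE c d Z : lmx (kaehler_curv c d) *m Z = kaehler_curv c d Z.
Proof.
rewrite -lmxE // => t X Y; rewrite /kaehler_curv !(dotDr, dotZr, omDr, omZr).
rewrite mulmxDr -(scalemxAr t); move: (Jmx *m X) (Jmx *m Y) (Jmx *m c) (Jmx *m d) => p q r x.
move: (prj c) (prj d) => y v.
move: (dot _ X) (dot _ X) (dot _ Y) (dot _ Y) => d1 d2 d3 d4.
by apply/colP => i; rewrite !mxE; ring.
Qed.

Lemma kaehler_curv_hor c d Z :
  kaehler_curv c d Z = hor (Kcurv (A *m c) (A *m d) (A *m Z)).
Proof.
rewrite /Kcurv !(horZ, horD, horN) !hor_J0 -!dot_hor -!om_hor !hor_hproj !J_prj.
rewrite !om_prjl !om_prjr /kaehler_curv.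
by rewrite !(dot_prjr (prj _)) ec_prj mul0r !subr0 ec_prj mul0r subr0.
Qed.

Lemma kaehler_curv_unitary (g : gl) c d Z : unitary_group g ->
  kaehler_curv (g *m c) (g *m d) (g *m Z) = g *m kaehler_curv c d Z.
Proof.
move=> Ug; rewrite /kaehler_curv !unitary_om // !unitary_prj // !unitary_J //.
rewrite !unitary_dot //; move: (prj c) (prj d) => p q.
by rewrite -scalemxAr !(mulmxDr, mulmxN) -!scalemxAr.
Qed.

Lemma model_curvatureE c d (Z : V) : model_curvature c d *m Z =
  lc c d *m Z + (kappa *: kaehler_curv c d Z - (2 * be * de * om c d) *: (Jmx *m Z)).
Proof.
rewrite /model_curvature; move: (lc c d) => B.
by rewrite !mulmxDl mulNmx -!scalemxAl kaehler_curvE.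
Qed.

Lemma model_curvature_unitary (g : gl) c d (Z : V) : unitary_group g ->
  model_curvature (g *m c) (g *m d) *m (g *m Z) = g *m (model_curvature c d *m Z).
Proof.
move=> Ug; rewrite !model_curvatureE lamcurv_unitary // unitary_om //.
rewrite unitary_J // kaehler_curv_unitary //.
by rewrite !mulmxDr mulmxN -!scalemxAr.
Qed.

Let kaehler_curv_anti c d Z : kaehler_curv c d Z = - kaehler_curv d c Z.
Proof.
rewrite /kaehler_curv (omC c d); move: (prj c) (prj d) (Jmx *m c) (Jmx *m d) (Jmx *m Z).
move: (om d c) (om c Z) (om d Z) => x y t p q r r' s.
by apply/colP => i; rewrite !mxE; ring.
Qed.

Let kaehler_curv_lin t c c' d Z :
  kaehler_curv (t *: c + c') d Z = t *: kaehler_curv c d Z + kaehler_curv c' d Z.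
Proof.
rewrite /kaehler_curv prjD prjZ !(dotDl, dotZl, omDl, omZl) mulmxDr -(scalemxAr t).
move: (prj c) (prj c') (prj d) (Jmx *m c) (Jmx *m c') (Jmx *m d) (Jmx *m Z).
move=> p q r p' q' r' s.
by apply/colP => i; rewrite !mxE; ring.
Qed.

Lemma model_curvature_alternating : alternating_bilinear model_curvature.
Proof.
have [l1 l2 l3] := @lamcurv_alternating R n a b a be ga de.
have anti c d : model_curvature c d = - model_curvature d c.
  apply: mx_ext => Z; rewrite mulNmx !model_curvatureE lamcurv_anti mulNmx.
  rewrite kaehler_curv_anti (omC c d).
  move: (lc d c *m Z) (kaehler_curv d c Z) (Jmx *m Z) => p q r.
  by apply/colP => i; rewrite !mxE; ring.
have lin t c c' d : model_curvature (t *: c + c') d =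
    t *: model_curvature c d + model_curvature c' d.
  apply: mx_ext => Z; rewrite (mulmxDl (t *: model_curvature c d))
    -(scalemxAl t (model_curvature c d)) !model_curvatureE l1.
  rewrite kaehler_curv_lin omDl omZl (mulmxDl (t *: lc c d)) -(scalemxAl t (lc c d)).
  move: (lc c d *m Z) (lc c' d *m Z) (kaehler_curv c d Z) (kaehler_curv c' d Z).
  move: (Jmx *m Z) => p q r p' q'.
  by apply/colP => i; rewrite !mxE; ring.
exact: alternating_antisym anti lin.
Qed.

Lemma model_Kaehler_parameter : Kaehler_parameter model_curvature a be ga de kappa.
Proof.
move=> X Y Z.
have usub (B : gl) : ulsubmx B *m Z = usubmx (B *m hor Z).
  by rewrite -{2}(submxK B) mul_block_col !mulmx0 !addr0 col_mxKu.
rewrite usub model_curvatureE lamcurv_hor kaehler_curv_hor !hproj_hor om_hor -hor_J0.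
rewrite -!horZ -horN -!horD /hor col_mxKu /branch_block.
move: (Kcurv X Y Z) (J0 Z) (a *: X + _) (a *: Y + _) => K z p q.
by apply/colP => i; rewrite !mxE; ring.
Qed.

Section AtPoint.
Variable z : V.
Local Notation w := (A *m z).
Hypothesis rho0 : 1 + k * dot w w != 0.
Let dth (v u : V) : R := - de * (dot (J *m (A *m v)) (A *m u) * kscale k w ^+ 2
  + 2 * dot (J *m w) (A *m u) * kscale k w * dkscale k w (A *m v)).

Let has_derive_th v u : has_derive (fun z => th z u) z v (dth v u).
Proof.
have Q := has_derive_kscale v rho0.
have Q2 : has_derive (fun y => kscale k (A *m y) ^+ 2) z v
    (2 * kscale k w * dkscale k w (A *m v)).
  by apply: has_derive_eq (has_deriveM Q Q) _; ring.
apply: has_derive_eq; first by rewrite /th; has_derive_tac.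
by rewrite /dth dot0r; ring.
Qed.

Lemma has_derive_coframe v u : has_derive (fun z => F z *m u) z v
  (hor (dkcoframe J k w (A *m v) (A *m u)) + dth v u *: ee).
Proof.
have -> : (fun z => F z *m u) =
    (fun z => A^T *m kcoframe J k (A *m z) (A *m u) + th z u *: ee).
  by apply/funext => y; rewrite model_coframeE hproj_tr.
have Q := has_derive_kcoframe J v rho0 (A *m u); have T := has_derive_th v u.
apply: has_derive_eq; first by has_derive_tac.
by rewrite hproj_tr scaler0 addr0.
Qed.

Lemma has_derive_gauge v u Z : has_derive (fun z => G u z *m Z) z v
  (hor (dkconn J k w (A *m v) (A *m u) (A *m Z)) + (be * dth v u) *: (Jmx *m Z)).
Proof.
have -> : (fun z => G u z *m Z) = (fun z => A^T *m kconn J k (A *m z) (A *m u) (A *m Z)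
    + (be * th z u) *: (Jmx *m Z)).
  by apply/funext => y; rewrite model_gaugeE hproj_tr.
have Q := has_derive_kconn J v rho0 (A *m u) (A *m Z); have T := has_derive_th v u.
apply: has_derive_eq; first by has_derive_tac.
by rewrite hproj_tr scaler0 addr0 mul0r add0r.
Qed.

End AtPoint.
End KaehlerModel.

Section ModelStructure.
Context {R : realType} {n : nat}.
Local Notation V := 'cV[R]_(n + n + 1).
Local Notation gl := 'M[R]_(n + n + 1).
Local Notation H := 'cV[R]_(n + n).
Local Notation ee := (@e0 R n).
Local Notation J := (@J0mx R n).
Variables (a b be ga de kappa : R).
Local Notation la := (@lam R n a b a be ga de).
Local Notation lc := (@lamcurv R n a b a be ga de).

Local Notation k := (kappa / 16).
Local Notation A := (@hproj R n).

Local Notation th := (@vertical_coframe R n de kappa).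
Local Notation F := (@model_coframe R n de kappa).
Local Notation G := (@model_gauge R n be de kappa).
Local Notation model_connection := (@model_connection R n a b be ga de kappa).
Local Notation model_curvature := (@model_curvature R n a b be ga de kappa).

Section OnDomain.
Variable O : set V.
Hypotheses (oO : open O) (O0 : forall z, O z -> 1 + k * dot (A *m z) (A *m z) != 0).

Let smooth_th u : smooth O (fun z => th z u).
Proof.
have sA : smooth O (fun z : V => A *m z).
  exact: smooth_mulmx oO (smooth_cst O A) (@smooth_id _ _ O).
have Q := smooth_kscale oO O0; rewrite /th; smooth_tac.
Qed.

Let smooth_coframe_col (u : V) : smooth O (fun z => F z *m u).
Proof.
have T := smooth_th u; have Q := smooth_kcoframe J oO O0 (A *m u).
have S : smooth O (fun z => A^T *m kcoframe J k (A *m z) (A *m u) + th z u *: ee).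
  by smooth_tac.
by apply: smooth_eq oO _ S => z _; rewrite model_coframeE hproj_tr.
Qed.

Lemma smooth_model_coframe : smooth O F.
Proof.
apply/(smooth_mxP _ oO) => i j.
have := (smooth_mxP _ oO).1 (smooth_coframe_col (delta_mx j 0)) i 0.
by apply: smooth_eq oO _ => z _; rewrite -colE mxE.
Qed.

Lemma smooth_model_gauge u : smooth O (G u).
Proof.
apply/(smooth_mxP _ oO) => i j; pose Z : V := delta_mx j 0.
have T := smooth_th u; have Q := smooth_kconn J oO O0 (A *m u) (A *m Z).
have S : smooth O (fun z => A^T *m kconn J k (A *m z) (A *m u) (A *m Z)
    + (be * th z u) *: (Jmx *m Z)).
  by smooth_tac.
have := (smooth_mxP _ oO).1 S i 0; apply: smooth_eq oO _ => z _.
by rewrite hproj_tr -model_gaugeE -colE mxE.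
Qed.

Lemma smooth_model_connection u : smooth O (model_connection u).
Proof.
have S := smooth_linmap (@lam_linear R n a b a be ga de) oO (smooth_coframe_col u).
exact: smoothD oO S (smooth_model_gauge u).
Qed.

Section At.
Variable z : V.
Hypothesis Oz : O z.
Local Notation w := (A *m z).
Let rho0 := O0 Oz.
Local Notation L := model_connection.
Let dth (v u : V) : R := - de * (dot (J *m (A *m v)) (A *m u) * kscale k w ^+ 2
  + 2 * dot (J *m w) (A *m u) * kscale k w * dkscale k w (A *m v)).
Let dF v u : V := hor (dkcoframe J k w (A *m v) (A *m u)) + dth v u *: ee.

Let derive_coframe v u : 'D_v F z *m u = dF v u.
Proof.
have [_ E] := has_derive_coframe de rho0 v u; apply: etrans E; apply: esym.
exact/derive_mulmx_cst/(smooth_differentiable smooth_model_coframe Oz).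
Qed.

Let A_F u : A *m (F z *m u) = kcoframe J k w (A *m u).
Proof. by rewrite model_coframeE mulmxDr hproj_hor -scalemxAr hproj_e0 scaler0 addr0. Qed.

Let ec_F u : ec (F z *m u) = th z u.
Proof. by rewrite model_coframeE ecD ec_hor ecZ ec0 mulr1 add0r. Qed.

Let om_F u v : om (F z *m u) (F z *m v)
  = dot (J *m kcoframe J k w (A *m u)) (kcoframe J k w (A *m v)).
Proof. by rewrite -om_hproj !A_F. Qed.

Let lam_comm c d : la c *m d - la d *m c =
  (2 * de * om c d) *: ee + be *: (ec d *: (Jmx *m c) - ec c *: (Jmx *m d)).
Proof.
rewrite !lamE /lamf (dotC d c) (omC d c).
move: (prj c) (prj d) (Jmx *m c) (Jmx *m d) ee => p q r x e.
by apply/colP => i; rewrite !mxE; ring.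
Qed.

Let area u v : dth u v - dth v u = - (2 * de * om (F z *m u) (F z *m v)).
Proof.
rewrite om_F /dth -mulrBr (kcoframe_area (@J0mx_tr R n) (@J0mx_sq R n)); ring.
Qed.

(** The horizontal part reduces to the torsion-free coframe of the Kaehler metric
    and the vertical part to the choice of [vertical_coframe]. *)
Lemma model_structure1 u v :
  ('D_u F z *m v + L u z *m (F z *m v)) - ('D_v F z *m u + L v z *m (F z *m u)) = 0.
Proof.
pose f (p q : V) := (p + L u z *m (F z *m v)) - (q + L v z *m (F z *m u)).
apply: etrans (congr2 f (derive_coframe u v) (derive_coframe v u)) _.
rewrite /f /model_connection (mulmxDl (la (F z *m u))) (mulmxDl (la (F z *m v))).
have E1 := lam_comm (F z *m u) (F z *m v).
have E2 := kcoframe_torsion (@J0mx_tr R n) (@J0mx_sq R n) (A *m u) (A *m v) rho0.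
have {}E2 := hor_comb E2.
rewrite !model_gaugeE !A_F /dF; rewrite !ec_F in E1.
have := area u v; move: (om _ _) E1 => o E1 E3.
have -> : dth u v = dth v u - 2 * de * o by rewrite -E3 addrC subrK.
move: E1; move: (la _ *m _) (la _ *m _) (Jmx *m (F z *m u)) (Jmx *m (F z *m v)).
move=> x y p q E1; have -> : y = y - x + x by rewrite subrK.
rewrite E1 {E1 E3}; move: E2.
generalize (hor (dkcoframe J k w (A *m u) (A *m v)) : V)
  (hor (dkcoframe J k w (A *m v) (A *m u)) : V)
  (hor (kconn J k w (A *m u) (kcoframe J k w (A *m v))) : V)
  (hor (kconn J k w (A *m v) (kcoframe J k w (A *m u))) : V)
  => h1 h2 h3 h4 E2.
have -> : h1 = h2 - (h3 - h4).
  apply/eqP; rewrite -subr_eq0 -E2; apply/eqP.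
  by apply/colP => i; rewrite !mxE; ring.
move: ee => e.
by apply/colP => i; rewrite !mxE; ring.
Qed.

Let derive_gauge v u Z : 'D_v (G u) z *m Z =
  hor (dkconn J k w (A *m v) (A *m u) (A *m Z)) + (be * dth v u) *: (Jmx *m Z).
Proof.
have [_ E] := has_derive_gauge be de rho0 v u Z; apply: etrans E; apply: esym.
exact/derive_mulmx_cst/(smooth_differentiable (smooth_model_gauge u) Oz).
Qed.

Let derive_connection v u : 'D_v (L u) z = la (dF v u) + 'D_v (G u) z.
Proof.
have d1 := smooth_differentiable (smooth_coframe_col u) Oz.
have d2 := smooth_differentiable (smooth_model_gauge u) Oz.
have lla := @lam_linear R n a b a be ga de.
have E1 := derive_linmap lla v d1.
have d3 := smooth_differentiable (smooth_linmap lla oO (smooth_coframe_col u)) Oz.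
have E2 := deriveD (diff_derivable (v := v) d3) (diff_derivable (v := v) d2).
have E3 : 'D_v (fun y => F y *m u) z = dF v u by case: (has_derive_coframe de rho0 v u).
have E4 := etrans E2 (congr1 (fun B : gl => B + 'D_v (G u) z) (etrans E1 (congr1 la E3))).
exact: E4.
Qed.

Let gauge_curvature_eq u v : 'D_u (G v) z - 'D_v (G u) z
  + (G u z *m G v z - G v z *m G u z) =
  kappa *: lmx (kaehler_curv (F z *m u) (F z *m v))
  - (2 * be * de * om (F z *m u) (F z *m v)) *: Jmx.
Proof.
have E0 Z : kconn J k w (A *m u) (kconn J k w (A *m v) (A *m Z))
    - kconn J k w (A *m v) (kconn J k w (A *m u) (A *m Z))
  = kappa *: Kcurv (kcoframe J k w (A *m u)) (kcoframe J k w (A *m v)) (A *m Z)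
    - (dkconn J k w (A *m u) (A *m v) (A *m Z) - dkconn J k w (A *m v) (A *m u) (A *m Z)).
  apply/eqP; rewrite eq_sym subr_eq addrC eq_sym; apply/eqP.
  apply: dot_ext => W; rewrite dotZl Kcurv_form.
  rewrite (kconn_curv (@J0mx_tr R n) (@J0mx_sq R n)) //.
  by field.
have GG v' u' Z : G u' z *m (G v' z *m Z) =
    hor (kconn J k w (A *m u') (kconn J k w (A *m v') (A *m Z)))
    + (be * th z v') *: hor (J *m kconn J k w (A *m u') (A *m Z))
    + (be * th z u') *: hor (J *m kconn J k w (A *m v') (A *m Z))
    + (be ^+ 2 * th z u' * th z v') *: (Jmx *m (Jmx *m Z)).
  rewrite (model_gaugeE be de kappa u' z (G v' z *m Z)) model_gaugeE.
  have -> : A *m (hor (kconn J k w (A *m v') (A *m Z)) + (be * th z v') *: (Jmx *m Z)) =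
      (be * th z v') *: (J *m (A *m Z)) + kconn J k w (A *m v') (A *m Z).
    by rewrite mulmxDr hproj_hor -scalemxAr hproj_J addrC.
  rewrite kconn_linearr (kconn_J (@J0mx_tr R n) (@J0mx_sq R n)) mulmxDr.
  rewrite -(scalemxAr _ Jmx) horD horZ.
  have -> : Jmx *m hor (kconn J k w (A *m v') (A *m Z)) =
      hor (J *m kconn J k w (A *m v') (A *m Z)) by rewrite -hor_J0.
  move: (hor _) (hor _) (hor _) (Jmx *m _) => p q r x.
  by apply/colP => i; rewrite !mxE; ring.
apply: mx_ext => Z.
pose f (p q : gl) := (p - q + (G u z *m G v z - G v z *m G u z)) *m Z.
have fE p q : f p q = p *m Z - q *m Z + (G u z *m (G v z *m Z) - G v z *m (G u z *m Z)).
  by rewrite /f !(mulmxDl, mulNmx) -!mulmxA.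
apply: etrans (fE _ _) _.
pose g (p q : V) := p - q + (G u z *m (G v z *m Z) - G v z *m (G u z *m Z)).
apply: etrans (congr2 g (derive_gauge u v Z) (derive_gauge v u Z)) _.
rewrite /g !GG mulmxDl mulNmx -!scalemxAl kaehler_curvE kaehler_curv_hor !A_F.
have := hor_comb_scale (E0 Z).
have := area u v; move: (om _ _) (dth u v) (dth v u) => o d1 d2 E1.
have -> : d1 = d2 - 2 * de * o by rewrite -E1 addrC subrK.
generalize (hor (dkconn J k w (A *m u) (A *m v) (A *m Z)) : V)
  (hor (dkconn J k w (A *m v) (A *m u) (A *m Z)) : V)
  (hor (kconn J k w (A *m u) (kconn J k w (A *m v) (A *m Z))) : V)
  (hor (kconn J k w (A *m v) (kconn J k w (A *m u) (A *m Z))) : V) => p1 p2 q1 q2.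
move: (hor (Kcurv _ _ _)) (hor (J *m kconn J k w (A *m u) (A *m Z)))
  (hor (J *m kconn J k w (A *m v) (A *m Z))) => K r1 r2.
move: (Jmx *m Z) (Jmx *m (Jmx *m Z)) => x y E2.
have -> : q1 = q2 + (kappa *: K - (p1 - p2)) by rewrite -E2 addrC subrK.
by apply/colP => i; rewrite !mxE; ring.
Qed.

(** By [curvature_split] it remains to compute the curvature of the u(n)-part,
    which is that of the Kaehler metric plus [be] times the differential of
    [vertical_coframe]. *)
Lemma model_structure2 u v : 'D_u (L v) z - 'D_v (L u) z
  + (L u z *m L v z - L v z *m L u z) = model_curvature (F z *m u) (F z *m v).
Proof.
have GU u' : unitary_algebra (L u' z - la (F z *m u')).
  by rewrite /model_connection addrAC subrr add0r; exact: model_gauge_unitary.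
have S1 : (dF u v + L u z *m (F z *m v)) - (dF v u + L v z *m (F z *m u))
    = tor 0 0 0 (F z *m u) (F z *m v).
  have := model_structure1 u v.
  pose f (p q : V) := (p + L u z *m (F z *m v)) - (q + L v z *m (F z *m u)).
  move/(etrans (esym (congr2 f (derive_coframe u v) (derive_coframe v u)))) => E.
  apply: etrans E _; rewrite /tor !(mul0r, scale0r, addr0, scaler0, subr0).
  by [].
have E1 := curvature_split ('D_v (L u) z) ('D_u (L v) z) S1 (GU u) (GU v).
have T0 : tor 0 0 0 (F z *m u) (F z *m v) = 0 :> V.
  by rewrite /tor !(mul0r, scale0r, addr0, scaler0, subr0).
rewrite T0 subr0 in E1.
have LG u' : L u' z - la (F z *m u') = G u' z.
  by rewrite /model_connection addrAC subrr add0r.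
have DG u' v' : 'D_u' (L v') z - la (dF u' v') = 'D_u' (G v') z.
  by apply: etrans (congr1 (fun X => X - _) (derive_connection u' v')) _;
    rewrite addrAC subrr add0r.
pose f (p q x y : gl) := p - q + (x *m y - y *m x).
have E2 := congr2 (fun p q => f p q (L u z - la (F z *m u)) (L v z - la (F z *m v)))
  (DG u v) (DG v u).
have E3 := congr2 (f ('D_u (G v) z) ('D_v (G u) z)) (LG u) (LG v).
have E4 := etrans E1 (etrans E2 (etrans E3 (gauge_curvature_eq u v))).
have aux (X Y : gl) : X = Y + (X - Y) by rewrite (addrC Y) subrK.
by rewrite /model_curvature -E4; exact: aux.
Qed.

End At.
End OnDomain.
End ModelStructure.

Lemma lam_linear_to_quotient (R : realType) (n : nat) (a b al be ga de : R) :
  linear_to_quotient unitary_algebra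
    (fun u => coset_mod unitary_algebra (@lam R n a b al be ga de u)).
Proof.
split=> [u|t u v B C BI CI]; first by exists (lam a b al be ga de u).
rewrite /coset_mod /= lam_linear.
move: (lam _ _ _ _ _ _ u) (lam _ _ _ _ _ _ v) BI CI => l l' BI CI.
have -> : t *: B + C - (t *: l + l') = t *: (B - l) + (C - l').
  by apply/matrixP => i j; rewrite !mxE; ring.
by apply: unitary_algebraD => //; exact: unitary_algebraZ.
Qed.

Section ModelExistence.
Context {R : realType} {n : nat}.
Local Notation V := 'cV[R]_(n + n + 1).
Local Notation gl := 'M[R]_(n + n + 1).
Local Notation H := 'cV[R]_(n + n).
Local Notation ee := (@e0 R n).
Local Notation J := (@J0mx R n).
Variables (a b be ga de kappa : R).
Local Notation la := (@lam R n a b a be ga de).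
Local Notation lc := (@lamcurv R n a b a be ga de).

Local Notation k := (kappa / 16).
Local Notation A := (@hproj R n).

Local Notation th := (@vertical_coframe R n de kappa).
Local Notation F := (@model_coframe R n de kappa).
Local Notation G := (@model_gauge R n be de kappa).
Local Notation model_connection := (@model_connection R n a b be ga de kappa).
Local Notation model_curvature := (@model_curvature R n a b be ga de kappa).

Lemma model_coframe_unit z : 1 + k * dot (A *m z) (A *m z) != 0 ->
  1 - k * dot (A *m z) (A *m z) != 0 -> F z \in unitmx.
Proof.
move=> q0 q1; apply: unitmx_inj => u; rewrite model_coframeE => E.
have Au : A *m u = 0.
  apply: (kcoframe_inj (@J0mx_tr R n) (@J0mx_sq R n) q0 q1).
  have := congr1 (mulmx A) E.
  by rewrite mulmxDr hproj_hor -scalemxAr hproj_e0 scaler0 addr0 mulmx0.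
have := congr1 ec E; rewrite ecD ec_hor ecZ ec0 mulr1 add0r /th Au dot0r.
rewrite mul0r mulr0 subr0 (_ : ec 0 = 0) => [u0|]; last by rewrite /ec dot0r.
by rewrite (hor_e0 u) u0 -hprojE Au scale0r addr0 /hor col_mx0.
Qed.

(** On the unit ball of the norm scaled by this factor, [|k| |A z|^2 < 1]. *)
Definition model_scale : R := `|k| * (n + n)%:R + 1.

Lemma model_scale_ge0 : 0 <= model_scale.
Proof. by rewrite addr_ge0 // mulr_ge0. Qed.

Lemma model_domain z : open_ball model_scale z ->
  `|k| * dot (A *m z) (A *m z) < 1.
Proof.
rewrite /open_ball /= /model_scale => z1.
have zn : 0 <= `|z| by [].
have D : dot (A *m z) (A *m z) <= (n + n)%:R * `|z| ^+ 2.
  apply: dot_le_norm => i; rewrite hprojE mxE.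
  rewrite [`|z|]mx_normrE; exact: (le_bigmax _ (fun ij => `|z ij.1 ij.2|) (_, _)).
have k0 : 0 <= `|k| by [].
have K0 : 0 <= `|k| * (n + n)%:R by rewrite mulr_ge0.
apply: le_lt_trans (ler_wpM2l k0 D) _.
by rewrite mulrA; move: K0 zn z1; move: (`|k| * _) `|z| => c y; nra.
Qed.

Let dom0 z : open_ball model_scale z -> 1 + k * dot (A *m z) (A *m z) != 0.
Proof.
move=> /model_domain Dz; have := dot_ge0 (A *m z); move: (dot _ _) Dz => d Dz d0.
have : `|k * d| < 1 by rewrite normrM (ger0_norm d0).
by rewrite ltr_norml => /andP[h1 h2]; rewrite gt_eqF //; lra.
Qed.

Let dom1 z : open_ball model_scale z -> 1 - k * dot (A *m z) (A *m z) != 0.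
Proof.
move=> /model_domain Dz; have := dot_ge0 (A *m z); move: (dot _ _) Dz => d Dz d0.
have : `|k * d| < 1 by rewrite normrM (ger0_norm d0).
by rewrite ltr_norml => /andP[h1 h2]; rewrite gt_eqF //; lra.
Qed.

Local Notation M := (ball_manifold (N := n + n + 1) model_scale_ge0).
Local Notation L := model_connection.
Local Notation fr := (@dual_frame R _ model_scale model_scale_ge0 F).
Local Notation nab := (@gauge_connection R _ model_scale model_scale_ge0 F L).

Let oB : open (@open_ball R (n + n + 1) model_scale).
Proof. exact: open_open_ball. Qed.
Let F_unit z : open_ball model_scale z -> F z \in unitmx.
Proof. by move=> Bz; apply: model_coframe_unit; [exact: dom0|exact: dom1]. Qed.
Let F_smooth := smooth_model_coframe de oB dom0.
Let L_smooth := smooth_model_connection a b be ga de oB dom0.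
Let L_lin := @model_connection_linear R n a b be ga de kappa.
Let coB (x : M) : open_ball model_scale (to_ball model_scale x).
Proof. by rewrite -(to_ball_image model_scale_ge0) //; exists x. Qed.

Definition model_structure (x : M) : set gl :=
  [set p | exists2 g, unitary_group g & p = fr x *m g].

Lemma model_G_structure : G_structure unitary_group model_structure.
Proof.
have fu x : fr x \in unitmx by exact: dual_frame_unit F_unit x.
split.
- move=> x p [g Ug ->]; rewrite unitmx_mul fu /=.
  by have [] := unitary_group_unit Ug.
- move=> x p q [g Ug ->]; split=> [[h Uh ->]|[h Uh ->]].
    have [ug gV] := unitary_group_unit Ug.
    exists (g^T *m h); first exact: unitary_groupM (unitary_groupT Ug) Uh.
    by rewrite -mulmxA (mulmxA g) -gV mulmxV // mul1mx.
  by exists (g *m h); [exact: unitary_groupM|rewrite mulmxA].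
- move=> x; exists setT, fr; split=> //; split; first exact: openT.
    by move=> y _; exists 1%:M; [exact: unitary_group1|rewrite mulmx1].
  exact: smooth_dual_frame F_unit F_smooth.
Qed.

Lemma model_affine_connection : affine_connection nab.
Proof. exact: gauge_affine_connection F_unit F_smooth L_smooth L_lin. Qed.

(** Equivariance of [lam] under the structure group. *)
Lemma Ad_coset (g : gl) u : unitary_group g ->
  Ad g @` coset_mod unitary_algebra (la u) = coset_mod unitary_algebra (la (g *m u)).
Proof.
move=> Ug; have [ug gV] := unitary_group_unit Ug.
have [gg _ _] := unitary_group_tr Ug.
have E : Ad g (la u) = la (g *m u).
  apply: mx_ext => W; rewrite /Ad gV.
  have -> : W = g *m (g^T *m W) by rewrite mulmxA gg mul1mx.
  rewrite -!mulmxA (mulmxA g^T) -[g^T *m g]/(g^T *m g).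
  have -> : g^T *m g = 1%:M by have /unitary_groupP[] := Ug.
  by rewrite mul1mx lam_unitary.
have AdB (B C : gl) : Ad g (B - C) = Ad g B - Ad g C.
  by rewrite /Ad mulmxBr mulmxBl.
apply/seteqP; split=> [_ [B BI <-]|B BI].
  rewrite /coset_mod /= -E -AdB /Ad gV.
  exact: unitary_algebra_Ad Ug BI.
have UgT := unitary_groupT Ug; have [ugT gTV] := unitary_group_unit UgT.
exists (Ad g^T B); last first.
  rewrite /Ad gV gTV trmxK !mulmxA gg mul1mx -!mulmxA gg mulmx1 //.
rewrite /coset_mod /=; have -> : la u = Ad g^T (la (g *m u)).
  rewrite -E /Ad gV gTV trmxK !mulmxA.
  have -> : g^T *m g = 1%:M by have /unitary_groupP[] := Ug.
  rewrite mul1mx -mulmxA; have -> : g^T *m g = 1%:M by have /unitary_groupP[] := Ug.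
  by rewrite mulmx1.
have -> : Ad g^T B - Ad g^T (la (g *m u)) = Ad g^T (B - la (g *m u)).
  by rewrite /Ad mulmxBr mulmxBl.
by have := unitary_algebra_Ad UgT BI; rewrite /Ad gTV.
Qed.

Lemma model_homogeneous : inf_homogeneous unitary_algebra nab model_structure
  (fun _ _ => 0) model_curvature (fun u => coset_mod unitary_algebra (la u)).
Proof.
have P_str := model_G_structure.
have Fk x (v : V) : F (to_ball model_scale x) *m (fr x *m v) = v.
  by rewrite mulKVmx //; exact: F_unit (coB x).
split.
- by split=> *; rewrite ?scaler0 ?addr0.
- exact: model_curvature_alternating.
- exact: lam_linear_to_quotient.
- move=> x p _ u v; rewrite mulmx0.
  have E1 := gauge_torsion F_unit F_smooth L_smooth L_lin x (p *m u) (p *m v).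
  have E2 := model_structure1 a b be ga de oB dom0 (coB x) (p *m u) (p *m v).
  have E3 := etrans E1 (congr1 (mulmx (fr x)) E2).
  by rewrite mulmx0 in E3.
- move=> x p [g Ug pE] u v X.
  have E1 := gauge_curvature F_unit F_smooth L_smooth L_lin x (p *m u) (p *m v) (p *m X).
  have E2 := model_structure2 a b be ga de oB dom0 (coB x) (p *m u) (p *m v).
  have E3 := etrans E1
    (congr1 (fun B => fr x *m (B *m (F (to_ball model_scale x) *m (p *m X)))) E2).
  apply: etrans E3 _; rewrite pE -!(mulmxA (fr x)) !Fk.
  by rewrite model_curvature_unitary.
- move=> x p [g Ug ->] u.
  have sS : local_section model_structure setT fr.
    split; first exact: openT.
      by move=> y _; exists 1%:M; [exact: unitary_group1|rewrite mulmx1].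
    exact: smooth_dual_frame F_unit F_smooth.
  have E1 := inner_torsion_coset P_str model_affine_connection (g *m u) (I : setT x) sS.
  rewrite -mulmxA; apply: etrans E1 _.
  have -> : coset_mod unitary_algebra (Lam nab fr x (fr x *m (g *m u))) =
      coset_mod unitary_algebra (la (g *m u)).
    apply: coset_mod_eq; rewrite (Lam_gauge L F_unit) /model_connection Fk.
    rewrite addrAC subrr add0r.
    exact: model_gauge_unitary.
  rewrite -(Ad_coset u Ug).
  have [ug _] := unitary_group_unit Ug.
  have fu : fr x \in unitmx by exact: dual_frame_unit F_unit x.
  have AdM B : Ad (fr x *m g) B = Ad (fr x) (Ad g B).
    by rewrite /Ad invmxM // !mulmxA.
  apply/seteqP; split=> [_ [_ [B BI <-] <-]|_ [B BI <-]].
    by exists B; rewrite ?AdM.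
  by exists (Ad g B); [exists B|rewrite AdM].
Qed.

End ModelExistence.

Lemma Kaehler_unrestricted_all (R : realType) (n : nat) : Kaehler_unrestricted R n.
Proof.
move=> a b be ga de kappa.
do 5 eexists; split; [exact: (model_affine_connection a b be ga de kappa)|
  exact: (model_G_structure de kappa)|exact: model_homogeneous|
  exact: lam_parameters|exact: model_Kaehler_parameter].
Qed.
(** * Contact form and branch of a homogeneous structure *)

Section SymmetrizedCurvature.
Context {R : realType} {n : nat}.
Local Notation V := 'cV[R]_(n + n + 1).
Local Notation gl := 'M[R]_(n + n + 1).
Variables (t1 t2 t3 a b al be ga de : R).
Local Notation T := (@tor R n t1 t2 t3).
Local Notation TM := (@tormx R n t1 t2 t3).
Local Notation la := (@lam R n a b al be ga de).

Lemma Rsym_alternating (R0 : V -> V -> gl) : alternating_bilinear R0 ->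
  alternating_bilinear (Rsym t1 t2 t3 a b al be ga de R0).
Proof.
move=> alt; have [R1 _ _] := alt.
have TMN u : TM (- u) = - TM u.
  have TM0 : TM 0 = 0.
    by have := @tormx_linear R n t1 t2 t3 (-1) 0 0; rewrite scaler0 addr0 scaleN1r addNr.
  by have := @tormx_linear R n t1 t2 t3 (-1) u 0; rewrite !addr0 !scaleN1r TM0 addr0.
have anti c d : Rsym t1 t2 t3 a b al be ga de R0 c d
    = - Rsym t1 t2 t3 a b al be ga de R0 d c.
  rewrite /Rsym (alternating_anti alt) (tor_anti _ _ _ c d).
  have -> : - T d c - (la c *m d - la d *m c) = - (T d c - (la d *m c - la c *m d)).
    by move: (T d c) (la c *m d) (la d *m c) => x y z; apply/colP => i; rewrite !mxE; ring.
  rewrite TMN; move: (R0 d c) (TM (_ - _)) (la c *m TM d) (TM d *m la c) => x y z t.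
  move: (la d *m TM c) (TM c *m la d) (TM c *m TM d) (TM d *m TM c) => z' t' p q.
  by apply/matrixP => i j; rewrite !mxE; ring.
have lin t c c' d : Rsym t1 t2 t3 a b al be ga de R0 (t *: c + c') d =
    t *: Rsym t1 t2 t3 a b al be ga de R0 c d + Rsym t1 t2 t3 a b al be ga de R0 c' d.
  rewrite /Rsym R1 tor_linearl lam_linear tormx_linear.
  have -> : t *: T c d + T c' d - ((t *: la c + la c') *m d - la d *m (t *: c + c')) =
      t *: (T c d - (la c *m d - la d *m c)) + (T c' d - (la c' *m d - la d *m c')).
    rewrite mulmxDl mulmxDr -scalemxAl -scalemxAr.
    move: (T c d) (T c' d) (la c *m d) (la c' *m d) (la d *m c) (la d *m c')
      => x y z x' y' z'; by apply/colP => i; rewrite !mxE; ring.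
  have bl (X X' Y : gl) : (t *: X + X') *m Y - Y *m (t *: X + X') =
      t *: (X *m Y - Y *m X) + (X' *m Y - Y *m X').
    rewrite mulmxDl mulmxDr -scalemxAl -scalemxAr.
    move: (X *m Y) (X' *m Y) (Y *m X) (Y *m X') => x y z w.
    by apply/matrixP => i j; rewrite !mxE; ring.
  have br (X X' Y : gl) : Y *m (t *: X + X') - (t *: X + X') *m Y =
      t *: (Y *m X - X *m Y) + (Y *m X' - X' *m Y).
    rewrite mulmxDl mulmxDr -scalemxAl -scalemxAr.
    move: (X *m Y) (X' *m Y) (Y *m X) (Y *m X') => x y z w.
    by apply/matrixP => i j; rewrite !mxE; ring.
  rewrite tormx_linear !bl br.
  generalize (la c *m TM d - TM d *m la c) (la c' *m TM d - TM d *m la c')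
    (la d *m TM c - TM c *m la d) (la d *m TM c' - TM c' *m la d)
    (TM c *m TM d - TM d *m TM c) (TM c' *m TM d - TM d *m TM c')
    => p1 p2 p3 p4 p5 p6.
  move: (R0 c d) (R0 c' d) (TM (_ - _)) (TM (_ - _)) => r r' s s'.
  by apply/matrixP => i j; rewrite !mxE; ring.
exact: alternating_antisym.
Qed.

End SymmetrizedCurvature.

Section Homogeneous.
Context {R : realType} {n : nat} (M : manifold R (n + n + 1)).
Local Notation V := 'cV[R]_(n + n + 1).
Local Notation gl := 'M[R]_(n + n + 1).
Variables (nabla : cov_deriv M) (P : M -> set gl).
Hypotheses (conn : affine_connection nabla) (P_str : G_structure unitary_group P).
Variables (t1 t2 t3 a b al be ga de : R).
Hypothesis torE : forall x p, P x p -> forall u v : V,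
  torsion_at nabla x (p *m u) (p *m v) = p *m tor t1 t2 t3 u v.
Hypothesis innE : forall x p, P x p -> forall u : V,
  inner_torsion unitary_algebra nabla P x (p *m u)
    = Ad p @` coset_mod unitary_algebra (lam a b al be ga de u).

Section Contact.
Variables (xi : vfield M) (h : M -> V -> V -> R) (J : M -> V -> V).
Variables (eta : M -> V -> R) (omega : M -> V -> V -> R).
Hypothesis geo : geometric_data P xi h J eta omega.

Lemma ext_deriv_eta x (p : gl) u v : P x p ->
  ext_deriv_at eta x (p *m u) (p *m v) = (t3 - 2 * de) * om u v.
Proof.
move=> Pp; have [U [s [Ux sS sx]]] := section_through P_str Pp.
have up := Gstr_frame P_str Pp.
by rewrite (ext_deriv_frame conn P_str torE innE Ux sS geo) sx !mulKmx.
Qed.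

(** Two horizontal vectors are first expressed in one common frame. *)
Lemma ext_deriv_horizontal x X Y : horizontal P x X -> horizontal P x Y ->
  ext_deriv_at eta x X Y = (t3 - 2 * de) * omega x X Y.
Proof.
move=> hX hY; rewrite (geo_omega_hor geo hX hY).
have [p [X0 [Pp ->]]] := hX; have [q [Y0 [Pq ->]]] := hY.
have [g Ug ->] := (Gstr_orbit P_str q Pp).1 Pq.
have gY : g *m hor Y0 = hor (usubmx (g *m hor Y0)).
  by rewrite [LHS]hor_e0 unitary_ec // ec_hor scale0r addr0.
rewrite -mulmxA gY (ext_deriv_eta _ _ Pp) (geo_J geo Pp) (geo_h geo Pp).
by rewrite om_hor.
Qed.

Lemma contact_iff : (0 < n)%N -> contact eta <-> t3 <> 2 * de.
Proof.
move=> n0; have [x0 _] := manifold_nonempty M.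
have frame_at x : exists p, P x p.
  by have [U [s [Ux [_ sP _]]]] := Gstr_section P_str x; exists (s x); exact: sP.
split=> [ct E|ne x].
  have [v /eqP] := ct x0; apply.
  have [p Pp] := frame_at x0; have up := Gstr_frame P_str Pp.
  have B0 u w : ext_deriv_at eta x0 u w = 0.
    by rewrite -(mulKVmx up u) -(mulKVmx up w) ext_deriv_eta // E subrr mul0r.
  rewrite /wedge big1 ?mulr0 // => s _.
  by rewrite (wedge_power_eq0 _ B0 n0) mulr0.
have [p Pp] := frame_at x.
have [v vE] := wedge_contact (fun w => eta_frame geo w Pp)
  (fun u w => ext_deriv_eta u w Pp).
exists v; rewrite vE; apply: mulf_neq0; last by rewrite pnatr_eq0 -lt0n fact_gt0.
by rewrite expf_neq0 // subr_eq0; exact/eqP.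
Qed.

End Contact.

Section TorsionFree.
Variable R0 : V -> V -> gl.
Hypothesis R0_alt : alternating_bilinear R0.
Hypothesis curE : forall x p, P x p -> forall u v w : V,
  curvature_at nabla x (p *m u) (p *m v) (p *m w) = p *m (R0 u v *m w).
Hypothesis n_gt0 : (0 < n)%N.
Local Notation nablas := (symmetrized nabla).
Local Notation as_ := (a + t1 / 2).
Local Notation als := (al - t1 / 2).
Local Notation bes := (be - t2 / 2).
Local Notation des := (de - t3 / 2).
Local Notation R0s := (Rsym t1 t2 t3 a b al be ga de R0).

Let conns : affine_connection nablas := symmetrized_connection conn P_str torE.
Let tor0 u v : tor 0 0 0 u v = 0 :> V.
Proof. by rewrite /tor !(mul0r, scale0r, addr0, scaler0, subr0). Qed.
Let torEs x p : P x p -> forall u v : V,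
  torsion_at nablas x (p *m u) (p *m v) = p *m tor 0 0 0 u v.
Proof. by move=> Pp u v; rewrite (symmetrized_torsion P_str torE) tor0 mulmx0. Qed.
Let innEs x p : P x p -> forall u : V,
  inner_torsion unitary_algebra nablas P x (p *m u)
    = Ad p @` coset_mod unitary_algebra (lam as_ b als bes ga des u).
Proof. by move=> Pp u; have := symmetrized_inner conn P_str torE innE u Pp; exact. Qed.
Let curEs x p : P x p -> forall u v w : V,
  curvature_at nablas x (p *m u) (p *m v) (p *m w) = p *m (R0s u v *m w).
Proof.
move=> Pp u v w.
by have := symmetrized_curvature conn P_str torE innE curE u v w Pp; exact.
Qed.

Let modEs u v : unitary_algebra (R0s u v - lamcurv as_ b als bes ga des u v).
Proof.
have := homogeneous_curvature_mod conns P_str torEs innEs curEs u v.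
by rewrite tor0 subr0.
Qed.

Let bianchis (u v w : V) : R0s u v *m w + R0s v w *m u + R0s w u *m v = 0.
Proof.
apply: (homogeneous_bianchi conns P_str curEs) => y u' v'.
by have := symmetrized_torsion P_str torE y u' v'; exact.
Qed.

(** The relation of [torsion_free_branch] for the shifted parameters. *)
Lemma symmetrized_branch : (t3 - 2 * de) * (a + t1 - al) = 0.
Proof. by have := torsion_free_branch modEs bianchis n_gt0; nra. Qed.

Lemma symmetrized_homogeneous : inf_homogeneous unitary_algebra nablas P
  (fun _ _ => 0) R0s (fun u => coset_mod unitary_algebra (lam as_ b als bes ga des u)).
Proof.
split.
- by split=> *; rewrite ?scaler0 ?addr0.
- exact: Rsym_alternating.
- exact: lam_linear_to_quotient.
- by move=> x p Pp u v; rewrite torEs // tor0.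
- exact: curEs.
- exact: innEs.
Qed.

Lemma symmetrized_Kaehler : as_ = als ->
  exists kappa, Kaehler_parameter R0s as_ bes ga des kappa.
Proof.
move=> /esym E; have uni (g : gl) (u v w : V) : unitary_group g ->
    R0s (g *m u) (g *m v) *m (g *m w) = g *m (R0s u v *m w).
  by move=> Ug; have := homogeneous_curvature_unitary P_str curEs u v w Ug; exact.
exact: torsion_free_kaehler (Rsym_alternating _ _ _ _ _ _ _ _ _ R0_alt) modEs
  bianchis uni n_gt0 E.
Qed.

End TorsionFree.
End Homogeneous.

Theorem proposition4p16 (R : realType) (n : nat) (n_ge1 : (1 <= n)%N)
  (M : manifold R (n + n + 1)) (nabla : cov_deriv M)
  (P : M -> set 'M[R]_(n + n + 1))
  (nabla_conn : affine_connection nabla)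
  (P_str : G_structure unitary_group P)
  (T0 : 'cV[R]_(n + n + 1) -> 'cV[R]_(n + n + 1) -> 'cV[R]_(n + n + 1))
  (R0 : 'cV[R]_(n + n + 1) -> 'cV[R]_(n + n + 1) -> 'M[R]_(n + n + 1))
  (I0 : 'cV[R]_(n + n + 1) -> set 'M[R]_(n + n + 1))
  (homog : inf_homogeneous unitary_algebra nabla P T0 R0 I0)
  (tau1 tau2 tau3 a b alpha beta gamma delta : R)
  (T0_par : torsion_parameters T0 tau1 tau2 tau3)
  (I0_par : inner_torsion_parameters I0 a b alpha beta gamma delta)
  (xi : vfield M)
  (h : M -> 'cV[R]_(n + n + 1) -> 'cV[R]_(n + n + 1) -> R)
  (J : M -> 'cV[R]_(n + n + 1) -> 'cV[R]_(n + n + 1))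
  (eta : M -> 'cV[R]_(n + n + 1) -> R)
  (omega : M -> 'cV[R]_(n + n + 1) -> 'cV[R]_(n + n + 1) -> R)
  (geo : geometric_data P xi h J eta omega) :
  [/\
      forall (x : M) (X Y : 'cV[R]_(n + n + 1)),
        horizontal P x X -> horizontal P x Y ->
        ext_deriv_at eta x X Y = (tau3 - 2 * delta) * omega x X Y,
      contact eta <-> tau3 <> 2 * delta,
      contact eta -> alpha = a + tau1,
      exists (R0s : 'cV[R]_(n + n + 1) -> 'cV[R]_(n + n + 1) -> 'M[R]_(n + n + 1))
        (I0s : 'cV[R]_(n + n + 1) -> set 'M[R]_(n + n + 1))
        (a_s b_s alpha_s beta_s gamma_s delta_s : R),
        [/\ affine_connection (symmetrized nabla),
            inf_homogeneous unitary_algebra (symmetrized nabla) P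
              (fun _ _ => 0) R0s I0s,
            inner_torsion_parameters I0s a_s b_s alpha_s beta_s gamma_s delta_s,
            alpha = a + tau1 <-> a_s = alpha_s &
            a_s = alpha_s -> exists kappa_s : R,
              Kaehler_parameter R0s a_s beta_s gamma_s delta_s kappa_s] &
      Kaehler_unrestricted R n].
Proof.
have torE x p : P x p -> forall u v : 'cV[R]_(n + n + 1),
    torsion_at nabla x (p *m u) (p *m v) = p *m tor tau1 tau2 tau3 u v.
  move=> Pp u v; rewrite (char_torsionE homog Pp).
  by rewrite (torP (char_torsion_bilinear homog) T0_par).
have innE x p : P x p -> forall u : 'cV[R]_(n + n + 1),
    inner_torsion unitary_algebra nabla P x (p *m u)
      = Ad p @` coset_mod unitary_algebra (lam a b alpha beta gamma delta u).
  move=> Pp u; rewrite (char_innerE homog Pp).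
  by rewrite (inner_torsion_parametersP I0_par).
have curE := char_curvatureE homog; have altR := char_curvature_bilinear homog.
have ctP := contact_iff nabla_conn P_str torE innE geo n_ge1.
split.
- move=> x X Y hX hY.
  by have := ext_deriv_horizontal nabla_conn P_str torE innE geo hX hY; exact.
- exact: ctP.
- move=> /ctP t3; have := symmetrized_branch nabla_conn P_str torE innE curE n_ge1.
  move/eqP; rewrite mulf_eq0 subr_eq0 => /orP[/eqP //|].
  by rewrite subr_eq0 => /eqP.
- exists (Rsym tau1 tau2 tau3 a b alpha beta gamma delta R0).
  exists (fun u => coset_mod unitary_algebra (lam (a + tau1 / 2) b (alpha - tau1 / 2)
    (beta - tau2 / 2) gamma (delta - tau3 / 2) u)).
  exists (a + tau1 / 2), b, (alpha - tau1 / 2), (beta - tau2 / 2), gamma,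
    (delta - tau3 / 2).
  split.
  + by have := symmetrized_connection nabla_conn P_str torE; exact.
  + by have := symmetrized_homogeneous nabla_conn P_str torE innE altR curE; exact.
  + by have := lam_parameters (a + tau1 / 2) b (alpha - tau1 / 2)
      (beta - tau2 / 2) gamma (delta - tau3 / 2); exact.
  + by split=> E; lra.
  + by have := symmetrized_Kaehler nabla_conn P_str torE innE altR curE n_ge1; exact.
- by have := @Kaehler_unrestricted_all R n; exact.
Qed.
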